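(* Assume (A0)–(A3) as in the context, $r>-1$, and that (M$_p$) holds for some $p>\max\{2,1+r\}$. Fix $\alpha\ge0$ and let $S^{(\alpha)}_t:=\sum_{s=1}^tX_s^\alpha$. (i) If $-1<r\le1$, then for any $\varepsilon>0$, a.s., for all but finitely many $t$, $$t^{\frac{\alpha+2}{2}}(\log t)^{-\frac{(\alpha+2)(4+r)}{1+r}-\varepsilon}\le S^{(\alpha)}_t\le t^{\frac{\alpha+2}{2}}(\log t)^{\frac{3\alpha+6}{1+r}+2+\varepsilon}.$$ (ii) If $1<r\le1+\alpha$, then for any $\varepsilon>0$, a.s., for all but finitely many $t$, $$t^{\frac{\alpha+2}{1+r}}(\log t)^{-\frac{\alpha+2}{1+r}-\varepsilon}\le S^{(\alpha)}_t\le t^{\frac{\alpha+2}{1+r}}(\log t)^{\frac{2\alpha+4}{1+r}+2+\varepsilon}.$$ (iii) If $r>1+\alpha$, then as $t\to\infty$, a.s., $$t^{-1}S^{(\alpha)}_t\to\frac{\mathbb{E}[\xi^{(\alpha)}_1]}{\mathbb{E}[\eta_1]}=\sum_{x\in\mathbb{S}}x^\alpha\pi(x)\in(0,\infty).$$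
   Context: $\mathbb{N}=\{1,2,\dots\}$. (A0): $\mathbb{S}$ is a locally finite (every bounded set meets it in finitely many points), unbounded subset of $[0,\infty)$ with $0\in\mathbb{S}$; $(X_t)_{t\in\mathbb{N}}$ is an $\mathbb{S}$-valued process adapted to a filtration $(\mathcal{F}_t)_{t\in\mathbb{N}}$ with $\mathbb{P}[X_1=0]=1$. (A1): for each $x,y\in\mathbb{S}$ there exist $m(x,y)\in\mathbb{N}$, $\varphi(x,y)>0$ with $\mathbb{P}[X_{t+m(X_t,y)}=y\mid\mathcal{F}_t]\ge\varphi(X_t,y)$ a.s. for all $t$. Write $\Delta_t:=X_{t+1}-X_t$. (A2): there are $c\in\mathbb{R}$, $s^2\in(0,\infty)$ with, as $X_t\to\infty$, $\mathbb{E}[\Delta_t\mid\mathcal{F}_t]=cX_t^{-1}+o(X_t^{-1}(\log X_t)^{-1})$ and $\mathbb{E}[\Delta_t^2\mid\mathcal{F}_t]=s^2+o((\log X_t)^{-1})$ a.s., where the implicit constants in $o(\cdot)$ are non-random and uniform in $t$ and in the sample point. Set $r:=-2c/s^2$. Excursions: $\tau_0:=1$, $\tau_n:=\min\{t>\tau_{n-1}:X_t=0\}$ ($\min\emptyset=\infty$), $\eta_n:=\tau_n-\tau_{n-1}$, $\mathcal{E}_n:=(X_t)_{\tau_{n-1}\le t\le\tau_n-1}$, $N:=\min\{n\in\mathbb{N}:\tau_n=\infty\}$. (A3): (a) on $\{N=\infty\}$, $(\mathcal{E}_n)_{n\in\mathbb{N}}$ is i.i.d.; (b) $\mathbb{P}[\eta_{n+1}<\infty\mid\tau_n<\infty]=\mathbb{P}[\eta_1<\infty]$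 for all $n$. (M$_p$): there exist $\delta>0$, $C<\infty$ with $\mathbb{E}[|\Delta_t|^p\mid\mathcal{F}_t]\le C(1+X_t)^{p-2-\delta}$ a.s. for all $t$. Also $\xi^{(\alpha)}_1:=\sum_{t=\tau_0}^{\tau_1-1}X_t^\alpha$ (with $0^0=1$), $\ell_1(x):=\sum_{t=\tau_0}^{\tau_1-1}\mathbf{1}\{X_t=x\}$, and $\pi(x):=\mathbb{E}[\ell_1(x)]/\mathbb{E}[\eta_1]$ for $x\in\mathbb{S}$. *)

(* Defs.v *)
From HB Require Import structures.
From mathcomp Require Import all_boot all_order all_algebra.
From mathcomp Require Import all_classical all_reals all_analysis.
From mathcomp Require Import measurable_realfun.
Set Implicit Arguments. Unset Strict Implicit. Unset Printing Implicit Defensive.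
Import Order.TTheory GRing.Theory Num.Theory.
Import numFieldNormedType.Exports.
Local Open Scope classical_set_scope.
Local Open Scope ring_scope.

Section defs.
Context {d : measure_display} {T : measurableType d} {R : realType}.
Variable P : probability T R.

(** Time is indexed by N = {1,2,...}; index 0 is a dummy and unconstrained.
    A filtration (F_t)_t of sub-sigma-algebras of the underlying sigma-algebra. *)
Definition filtration (F : nat -> set (set T)) :=
  [/\ forall t, (0 < t)%N -> sigma_algebra setT (F t),
      forall t A, (0 < t)%N -> F t A -> measurable A &
      forall s t, (0 < s)%N -> (s <= t)%N -> F s `<=` F t].

Definition adapted (F : nat -> set (set T)) (X : nat -> T -> R) :=
  forall t (B : set R), (0 < t)%N -> measurable B -> F t (X t @^-1` B).

(** Z is a version of the (extended-valued) conditional expectation E[Y | G] of a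
    nonnegative random variable Y: Z is G-measurable, nonnegative, and has the
    same integral as Y over every G-set. *)
Definition cexp_version (G : set (set T)) (Y Z : T -> \bar R) :=
  [/\ forall B : set (\bar R), measurable B -> G (Z @^-1` B),
      forall w, (0 <= Z w)%E &
      forall A, G A -> (\int[P]_(w in A) Y w = \int[P]_(w in A) Z w)%E].

Lemma next_zero_ex (X : nat -> T -> R) (s : nat) (w : T) :
  (exists t, (s < t)%N /\ X t w = 0) ->
  exists t, (fun t => (s < t)%N && `[< X t w = 0 >]) t.
Proof. by move=> [t [h1 h2]]; exists t; rewrite h1 /=; apply/asboolP. Qed.

Definition next_zero (X : nat -> T -> R) (s : nat) (w : T) : option nat :=
  match pselect (exists t, (s < t)%N /\ X t w = 0) with
  | left h => Some (ex_minn (next_zero_ex h))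
  | right _ => None
  end.

(** tau_0 = 1, tau_n = min{t > tau_{n-1} : X_t = 0}; None encodes infinity *)
Fixpoint tau (X : nat -> T -> R) (n : nat) (w : T) : option nat :=
  match n with
  | 0 => Some 1%N
  | n'.+1 => match tau X n' w with
             | None => None
             | Some s => next_zero X s w
             end
  end.

(** the n-th excursion (X_t)_{tau_{n-1} <= t <= tau_n - 1}, for n >= 1
    (only meaningful when tau_n is finite) *)
Definition excursion (X : nat -> T -> R) (n : nat) (w : T) : seq R :=
  match tau X n.-1 w, tau X n w with
  | Some a, Some b => [seq X t w | t <- iota a (b - a)]
  | _, _ => [::]
  end.

Definition N_infinite (X : nat -> T -> R) : set T :=
  [set w | forall n, tau X n w != None].

Definition before_tau1 (X : nat -> T -> R) (t : nat) (w : T) : bool :=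
  match tau X 1 w with Some k => (t < k)%N | None => true end.

Definition xi1 (X : nat -> T -> R) (alpha : R) (w : T) : \bar R :=
  (\sum_(1 <= t <oo) ((X t w `^ alpha) * (before_tau1 X t w)%:R)%:E)%E.

(** eta_1 = tau_1 - tau_0 (extended real; +oo if tau_1 infinite) *)
Definition eta1 (X : nat -> T -> R) (w : T) : \bar R :=
  (\sum_(1 <= t <oo) ((before_tau1 X t w)%:R : R)%:E)%E.

Definition ell1 (X : nat -> T -> R) (x : R) (w : T) : \bar R :=
  (\sum_(1 <= t <oo) (((X t w == x) && before_tau1 X t w)%:R : R)%:E)%E.

Definition pi_stat (X : nat -> T -> R) (x : R) : R :=
  fine (\int[P]_w ell1 X x w)%E / fine (\int[P]_w eta1 X w)%E.

Definition Ssum (X : nat -> T -> R) (alpha : R) (t : nat) (w : T) : R :=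
  \sum_(1 <= s < t.+1) X s w `^ alpha.

Definition A0 (S : set R) (F : nat -> set (set T)) (X : nat -> T -> R) :=
  [/\ (forall M : R, finite_set (S `&` [set x | `|x| <= M])),
      (forall M : R, exists2 x, S x & M < x),
      S `<=` [set x | 0 <= x] & S 0] /\
  [/\ filtration F, adapted F X,
      (forall t w, (0 < t)%N -> S (X t w)) &
      P [set w | X 1%N w = 0] = 1%E].

Definition A1 (S : set R) (F : nat -> set (set T)) (X : nat -> T -> R) :=
  exists (m : R -> R -> nat) (phi : R -> R -> R),
    (forall x y, S x -> S y -> (0 < m x y)%N /\ 0 < phi x y) /\
    forall y, S y -> forall t, (0 < t)%N ->
      exists Z : T -> \bar R,
        cexp_version (F t)
          (fun w => (\1_[set w' | X (t + m (X t w') y)%N w' = y] w : R)%:E) Z /\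
        {ae P, forall w, ((phi (X t w) y)%:E <= Z w)%E}.

(** (A2) with constants c and s2, where Delta_t = X_{t+1} - X_t; E[Delta_t|F_t]
    is the generalized conditional expectation E[Delta_t^+|F_t] - E[Delta_t^-|F_t]. *)
Definition A2 (F : nat -> set (set T)) (X : nat -> T -> R) (c s2 : R) :=
  0 < s2 /\
  exists Zp Zm Q : nat -> T -> \bar R,
    (forall t, (0 < t)%N ->
       [/\ cexp_version (F t) (fun w => (Num.max (X t.+1 w - X t w) 0)%:E) (Zp t),
           cexp_version (F t) (fun w => (Num.max (X t w - X t.+1 w) 0)%:E) (Zm t) &
           cexp_version (F t) (fun w => ((X t.+1 w - X t w) ^+ 2)%:E) (Q t)]) /\
    forall e : R, 0 < e -> exists x0 : R, forall t, (0 < t)%N ->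
      {ae P, forall w, x0 <= X t w ->
        [/\ (Zp t w < +oo)%E, (Zm t w < +oo)%E, (Q t w < +oo)%E,
            `| fine (Zp t w) - fine (Zm t w) - c / X t w |
               <= e / (X t w * ln (X t w)) &
            `| fine (Q t w) - s2 | <= e / ln (X t w)]}.

Definition A3 (X : nat -> T -> R) :=
  (* (a) conditionally on {N = infinity}, the excursions are i.i.d. *)
  ((0 < P (N_infinite X))%E ->
    forall (k : nat) (B : nat -> set (seq R)),
      (fine (P (N_infinite X `&`
                 [set w | forall i, (i < k)%N -> B i (excursion X i.+1 w)]))
        / fine (P (N_infinite X)) =
       \prod_(i < k)
         (fine (P (N_infinite X `&` [set w | B i (excursion X 1 w)]))
           / fine (P (N_infinite X))))) /\
  (forall n, (0 < n)%N ->
     (0 < P [set w | tau X n w != None])%E ->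
     fine (P [set w | tau X n w != None /\ tau X n.+1 w != None])
       / fine (P [set w | tau X n w != None])
     = fine (P [set w | tau X 1 w != None])).

Definition Mp (F : nat -> set (set T)) (X : nat -> T -> R) (p : R) :=
  exists (delta C : R), 0 < delta /\
    forall t, (0 < t)%N ->
      exists Z : T -> \bar R,
        cexp_version (F t) (fun w => (`|X t.+1 w - X t w| `^ p)%:E) Z /\
        {ae P, forall w, (Z w <= (C * (1 + X t w) `^ (p - 2 - delta))%:E)%E}.

End defs.

(* Main.v *)
(** Write m(x) = x^q (log x)^u. By (A2) and (M_p), far from the origin the
    conditional drift of m(X_t) is close to
      (s^2/2) x^(q-2) (q (q-1-r) (log x)^u + u (2q-1-r) (log x)^(u-1)),
    so its sign can be prescribed through q and u.  As S is countable, all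
    conditional statements are used on events A of F_t with A <= {X_t = x}.

    Lower bounds in (i), (ii): for q = max(2, 1+r) and small u > 0, m(X_t) is a
    submartingale away from the origin, hence a level y is reached in mean time
    O(y^q (log y)^u), the time spent near the origin being controlled by (A1).
    After that the walk stays above y/2 for order y^2 steps with probability at
    least 1/2, because its squared displacement has bounded drift.  In [1, 2^k]
    there is room for k such attempts, and Borel-Cantelli applies.

    Upper bounds in (i), (ii): for u < 0 the drift of m(X_t) is bounded above,
    which bounds the maximum of X up to time n; the submartingale with
    q = alpha+2, u = 1 bounds the expected sum of X_t^alpha below a level.

    (iii): x^(alpha+2) has drift at most -k x^alpha for large x, so that the
    excursion sums have finite mean and, by (A3), all excursions are finite and
    i.i.d. almost surely.  The strong law for i.i.d. variables with countably
    many values follows from Chebyshev for the frequencies of single values and,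
    for the tail, from a weak (1,1) maximal inequality proved by covering. *)
Require Import Defs.
From HB Require Import structures.
From mathcomp Require Import all_boot all_order all_algebra.
From mathcomp Require Import all_classical all_reals all_analysis.
From mathcomp Require Import measurable_realfun.
From mathcomp Require Import lra ring.
Import Order.TTheory GRing.Theory Num.Theory.
Import numFieldNormedType.Exports.
Local Open Scope classical_set_scope.
Local Open Scope ring_scope.
Set Implicit Arguments. Unset Strict Implicit. Unset Printing Implicit Defensive.

(** * Drift of power-logarithmic functions *)

Section real_analysis.
Context {R : realType}.
Implicit Types (x y z a b c s p dl q u e h M C K B d : R).

Lemma powRDp x a b : 0 < x -> x `^ (a + b) = x `^ a * x `^ b.
Proof. by move=> x0; rewrite powRD// (gt_eqF x0) implybT. Qed.

Lemma powRMB1 x a : 0 < x -> x `^ a = x * x `^ (a - 1).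
Proof.
move=> x0; rewrite -{2}(powRr1 (ltW x0)) -(powRDp 1 (a - 1) x0).
by congr (_ `^ _); ring.
Qed.

Lemma powR_ge_near a M : 0 < a -> exists b, forall x, b <= x -> M <= x `^ a.
Proof.
move=> a0; exists (Num.max M 1 `^ a^-1) => x bx.
have M1 : 0 <= Num.max M 1 by rewrite le_max ler01 orbT.
apply: (@le_trans _ _ (Num.max M 1)); first by rewrite le_max lexx.
have -> : Num.max M 1 = (Num.max M 1 `^ a^-1) `^ a.
  by rewrite -powRrM mulVf ?lt0r_neq0// powRr1.
by rewrite ge0_ler_powR ?nnegrE ?powR_ge0 ?(ltW a0)// (le_trans _ bx) ?powR_ge0.
Qed.

Lemma ln_powR_le a h e : 0 < h -> 0 < e ->
  exists b, forall x, b <= x -> ln x `^ a <= e * x `^ h.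
Proof.
move=> h0 e0; pose a' := Num.max a 1.
have a'0 : 0 < a' by rewrite lt_max ltr01 orbT.
pose s := h / 2 / a'.
have s0 : 0 < s by rewrite !divr_gt0.
have [b hb] := @powR_ge_near (h / 2) (s^-1 `^ a' / e) (divr_gt0 h0 (ltr0n _ 2)).
exists (Num.max b (expR 1)) => x; rewrite ge_max => /andP[bx ex].
have x0 : 0 < x by rewrite (lt_le_trans _ ex) ?expR_gt0.
have l1 : 1 <= ln x by rewrite -(expRK 1) ler_ln ?posrE ?expR_gt0.
have lx : ln x <= s^-1 * x `^ s.
  rewrite mulrC ler_pdivlMr// mulrC -ln_powR.
  by apply/ltW/ln_sublinear; rewrite powR_gt0.
apply: (@le_trans _ _ (ln x `^ a')); first by rewrite ler_powR// le_max lexx.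
apply: (@le_trans _ _ ((s^-1 * x `^ s) `^ a')).
  rewrite ge0_ler_powR ?nnegrE ?(ltW a'0)// ?(le_trans _ l1)//.
  by rewrite mulr_ge0 ?invr_ge0 ?powR_ge0 ?(ltW s0).
rewrite powRM ?powR_ge0 ?invr_ge0 ?(ltW s0)// -powRrM divfK ?lt0r_neq0//.
have -> : x `^ h = x `^ (h / 2) * x `^ (h / 2).
  by rewrite -powRDp//; congr (_ `^ _); lra.
rewrite mulrA ler_wpM2r ?powR_ge0//.
by rewrite mulrC -ler_pdivrMr// hb.
Qed.

Lemma mvt_bound (g dg : R -> R) x y B :
  (forall z, `|z - x| <= `|y - x| -> is_derive z 1 g (dg z) /\ `|dg z| <= B) ->
  `|g y - g x| <= B * `|y - x|.
Proof.
have key s t : s <= t -> (forall z, s <= z <= t -> is_derive z 1 g (dg z) /\ `|dg z| <= B) ->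
    `|g t - g s| <= B * `|t - s|.
  move=> st H.
  have [||z zst ->] := @MVT_segment _ g dg s t st.
  - by move=> z; rewrite in_itv/= => /andP[/ltW sz /ltW zt]; apply: (H z _).1; rewrite sz.
  - apply: derivable_within_continuous => z; rewrite in_itv/= => zst.
    by have [h _] := H z zst; apply: ex_derive.
  - rewrite normrM ler_wpM2r//; apply: (H z _).2.
    by move: zst; rewrite in_itv.
move=> H; have [xy|/ltW yx] := leP x y.
  apply: key => // z /andP[xz zy]; apply: H.
  by rewrite !ger0_norm ?subr_ge0// lerD2r.
rewrite distrC (distrC y); apply: key => // z /andP[yz zx]; apply: H.
by rewrite !ler0_norm ?subr_le0// lerN2 lerD2r.
Qed.

Lemma taylor2_bound (f f1 f2 f3 : R -> R) x d K :
  (forall z, `|z - x| <= `|d| -> [/\ is_derive z 1 f (f1 z), is_derive z 1 f1 (f2 z),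
     is_derive z 1 f2 (f3 z) & `|f3 z| <= K]) ->
  `|f (x + d) - (f x + f1 x * d + f2 x / 2 * d ^+ 2)| <= K * `|d| ^+ 3.
Proof.
move=> H.
have xx : `|x - x| <= `|d| by rewrite subrr normr0.
have K0 : 0 <= K by have [_ _ _] := H x xx; apply: le_trans.
have B2 z : `|z - x| <= `|d| -> `|f2 z - f2 x| <= K * `|d|.
  move=> zd; apply: (@le_trans _ _ (K * `|z - x|)); last by rewrite ler_wpM2l.
  apply: (@mvt_bound f2 f3) => w wz.
  by have [] := H w (le_trans wz zd).
have B1 z : `|z - x| <= `|d| ->
    `|(f1 z - f2 x * z) - (f1 x - f2 x * x)| <= K * `|d| * `|d|.
  move=> zd; apply: (@le_trans _ _ (K * `|d| * `|z - x|)); last by rewrite ler_wpM2l// mulr_ge0.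
  apply: (@mvt_bound (fun z => f1 z - f2 x * z) (fun z => f2 z - f2 x)) => w wz.
  have wd := le_trans wz zd; have [_ h _ _] := H w wd; split; last exact: B2.
  by apply: is_derive_eq; rewrite /GRing.scale/= mulr1.
have := @mvt_bound (fun z => f z - f1 x * z - f2 x / 2 * (z - x) ^+ 2)
  (fun z => f1 z - f1 x - f2 x * (z - x)) x (x + d) (K * `|d| * `|d|).
rewrite subrr expr0n mulr0 subr0 (addrC x) addrK.
move=> hL; apply: (le_trans _ (le_trans (hL _) _)).
- by rewrite le_eqVlt; apply/orP; left; apply/eqP; congr (`| _ |); ring.
- move=> z zd; have [h _ _ _] := H z zd; split.
    apply: is_derive_eq; rewrite /= ?scaler0 ?addr0 ?scaler1.
    by rewrite /GRing.scale/=; field.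
  apply: le_trans (B1 z zd); rewrite le_eqVlt; apply/orP; left; apply/eqP; congr (`| _ |); ring.
- by rewrite !exprS expr0 mulr1 !mulrA.
Qed.

Definition mlog q u x := x `^ q * ln x `^ u.

Lemma is_derive_mlog q u x : 1 < x ->
  is_derive x 1 (mlog q u) (q * mlog (q - 1) u x + u * mlog (q - 1) (u - 1) x).
Proof.
move=> x1; have x0 : 0 < x by rewrite (lt_trans _ x1).
have lx0 : 0 < ln x by rewrite ln_gt0.
have d1 := @is_derive1_powR R q x x0.
have d2 := @is_derive1_powR R u (ln x) lx0.
have d3 := @is_derive1_ln R x x0.
have d4 : is_derive x 1 (fun x => ln x `^ u) (x^-1 * (u * ln x `^ (u - 1))).
  have := @is_derive1_comp R (fun y => y `^ u) (@ln R) x _ _ d2 d3.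
  by rewrite /comp; move=> h; apply: is_derive_eq h _; rewrite /GRing.scale/= mulrC.
have := is_deriveM d1 d4; rewrite /mlog => h; apply: is_derive_eq h _.
rewrite /GRing.scale/=.
rewrite (powRMB1 q x0).
by field; rewrite lt0r_neq0.
Qed.

Definition mlog1 q u x := q * mlog (q - 1) u x + u * mlog (q - 1) (u - 1) x.

Definition mlog2 q u x := q * (q - 1) * mlog (q - 2) u x
  + u * (2 * q - 1) * mlog (q - 2) (u - 1) x + u * (u - 1) * mlog (q - 2) (u - 2) x.

Lemma mlog_ge0 q u x : 0 <= mlog q u x.
Proof. by rewrite mulr_ge0 ?powR_ge0. Qed.

Lemma mlogMx q u x : 0 < x -> mlog q u x = x * mlog (q - 1) u x.
Proof.
by move=> x0; rewrite /mlog mulrA -powRMB1.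
Qed.

Lemma mlogMln q u x : 1 < x -> mlog q u x = ln x * mlog q (u - 1) x.
Proof.
by move=> x0; rewrite /mlog mulrCA -powRMB1 ?ln_gt0.
Qed.

Lemma mlog_le_ln q u v x : 1 <= ln x -> u <= v -> mlog q u x <= mlog q v x.
Proof. by move=> lx uv; rewrite /mlog ler_wpM2l ?powR_ge0// ler_powR. Qed.

Lemma expR1_ge2 : 2 <= expR 1 :> R.
Proof. by have := @expR_ge1Dx R 1; lra. Qed.

Lemma ln_ge1 x : expR 1 <= x -> 1 <= ln x.
Proof.
move=> ex; have x0 : 0 < x by rewrite (lt_le_trans _ ex) ?expR_gt0.
by rewrite -(expRK 1) ler_ln ?posrE ?expR_gt0.
Qed.

Lemma expR1_le_half x : expR 2 <= x -> expR 1 <= x / 2.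
Proof.
have -> : expR 2 = expR 1 * expR 1 :> R by rewrite -expRD; congr expR; lra.
by move=> h; have := expR1_ge2; nra.
Qed.

Lemma is_derive_mlog1 q u x : 1 < x -> is_derive x 1 (mlog1 q u) (mlog2 q u x).
Proof.
move=> x1; rewrite /mlog1 /mlog2.
have h1 := is_derive_mlog (q - 1) u x1.
have h2 := is_derive_mlog (q - 1) (u - 1) x1.
have := is_deriveD (is_deriveZ q h1) (is_deriveZ u h2).
have -> : q - 1 - 1 = q - 2 by ring.
have -> : u - 1 - 1 = u - 2 by ring.
move=> h; apply: is_derive_eq h _; rewrite /GRing.scale/=; ring.
Qed.

Lemma mlog2_derive q u : exists f3 : R -> R, exists K, 0 <= K /\
  forall x, expR 1 <= x -> is_derive x 1 (mlog2 q u) (f3 x) /\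
   (`|u| <= 1 -> `|f3 x| <= K * mlog (q - 3) 1 x).
Proof.
exists (fun x => q * (q - 1) * ((q - 2) * mlog (q - 3) u x + u * mlog (q - 3) (u - 1) x)
  + u * (2 * q - 1) * ((q - 2) * mlog (q - 3) (u - 1) x + (u - 1) * mlog (q - 3) (u - 2) x)
  + u * (u - 1) * ((q - 2) * mlog (q - 3) (u - 2) x + (u - 2) * mlog (q - 3) (u - 3) x)).
exists (`|q * (q - 1)| * (`|q - 2| + `|u|) + `|u * (2 * q - 1)| * (`|q - 2| + `|u - 1|)
  + `|u * (u - 1)| * (`|q - 2| + `|u - 2|)); split.
  by rewrite !addr_ge0 ?mulr_ge0 ?addr_ge0.
move=> x ex; have l1 := ln_ge1 ex; have x1 : 1 < x by have := expR1_ge2; lra.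
split.
  have h0 := is_derive_mlog (q - 2) u x1.
  have h1 := is_derive_mlog (q - 2) (u - 1) x1.
  have h2 := is_derive_mlog (q - 2) (u - 2) x1.
  have := is_deriveD (is_deriveD (is_deriveZ (q * (q - 1)) h0)
    (is_deriveZ (u * (2 * q - 1)) h1)) (is_deriveZ (u * (u - 1)) h2).
  have -> : q - 2 - 1 = q - 3 by ring.
  have -> : u - 1 - 1 = u - 2 by ring.
  have -> : u - 2 - 1 = u - 3 by ring.
  by move=> h; apply: is_derive_eq h _; rewrite /GRing.scale/=.
rewrite ler_norml => /andP[_ u1].
have B v : v <= u -> `|mlog (q - 3) v x| <= mlog (q - 3) 1 x.
  by move=> vu; rewrite ger0_norm ?mlog_ge0// mlog_le_ln// (le_trans vu).
have B1 a b v w : v <= u -> w <= u ->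
   `|a * mlog (q - 3) v x + b * mlog (q - 3) w x| <= (`|a| + `|b|) * mlog (q - 3) 1 x.
  move=> vu wu; rewrite mulrDl (le_trans (ler_normD _ _))// lerD// normrM ler_wpM2l//; exact: B.
rewrite !mulrDl (le_trans (ler_normD _ _))// lerD ?(le_trans (ler_normD _ _))// ?lerD//.
all: rewrite ?normrM -?mulrA ?ler_wpM2l// ?normrM -?mulrA ?ler_wpM2l// -?mulrDl; apply: B1; clear; lra.
Qed.

Lemma mlog_taylor q u : 0 <= q -> `|u| <= 1 -> exists K, 0 <= K /\
  forall x d, expR 2 <= x -> `|d| <= x / 2 ->
  `|mlog q u (x + d) - (mlog q u x + mlog1 q u x * d + mlog2 q u x / 2 * d ^+ 2)|
    <= K * mlog (q - 3) 1 x * `|d| ^+ 3.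
Proof.
move=> q0 u1; have [f3 [K [K0 hK]]] := mlog2_derive q u.
exists (K * (2 `^ q * 16)); split; first by rewrite mulr_ge0// mulr_ge0 ?powR_ge0.
move=> x d ex dx; apply: (@taylor2_bound _ _ _ f3) => z zx.
have x2 := expR1_le_half ex; have := expR1_ge2 => e2.
have /andP[z1 z2] : x / 2 <= z <= 2 * x.
  by move: (le_trans zx dx); rewrite ler_norml => /andP[]; lra.
have z3 : 1 < z by lra.
split; [exact: is_derive_mlog|exact: is_derive_mlog1|apply: (hK _ _).1; lra|].
apply: (le_trans ((hK z _).2 u1)); first lra.
rewrite -mulrA ler_wpM2l// /mlog.
have z0 : 0 < z by lra.
have x0 : 0 < x by lra.
have e3 (w : R) : 0 < w -> w `^ (q - 3) = w `^ q * w ^- 3.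
  by move=> w0; rewrite powRDp// powR_invn ?ltW.
have lz : 0 <= ln z by rewrite ln_ge0; clear -e2 q0 x2 z1; lra.
have lx : 0 <= ln x by rewrite ln_ge0; clear -e2 q0 x2; lra.
rewrite !e3// !powRr1//.
have l2 : ln z <= 2 * ln x.
  have -> : 2 * ln x = ln (x ^+ 2) by rewrite lnXn// mulr_natl.
  by rewrite ler_ln ?posrE ?exprn_gt0//; clear -e2 x2 z2; nra.
have i3 : z ^- 3 <= 8 * x ^- 3.
  rewrite ler_pdivlMr ?exprn_gt0// mulrC ler_pdivrMr ?exprn_gt0//.
  have -> : 8 * z ^+ 3 = (2 * z) ^+ 3 by ring.
  by rewrite lerXn2r ?nnegrE; clear -e2 q0 x2 z1; lra.
have p3 : z `^ q <= 2 `^ q * x `^ q.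
  by rewrite -powRM ?(ltW x0)// ge0_ler_powR ?nnegrE; clear -e2 q0 x2 z1 z2; lra.
have -> : 2 `^ q * 16 * (x `^ q * x ^- 3 * ln x) = (2 `^ q * x `^ q) * (8 * x ^- 3) * (2 * ln x) by ring.
apply: ler_pM => //.
- by rewrite mulr_ge0 ?powR_ge0// invr_ge0 exprn_ge0 ?ltW.
- by apply: ler_pM; rewrite ?powR_ge0// invr_ge0 exprn_ge0 ?ltW.
Qed.

Lemma mlog1_norm_le q u x : 0 <= q -> `|u| <= 1 -> expR 1 <= x ->
  `|mlog1 q u x| <= (q + 1) * mlog (q - 1) u x.
Proof.
move=> q0 u1 ex; have l1 := ln_ge1 ex; rewrite /mlog1 mulrDl mul1r.
rewrite (le_trans (ler_normD _ _))// lerD//.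
  by rewrite ger0_norm// mulr_ge0// mlog_ge0.
rewrite normrM (ger0_norm (mlog_ge0 _ _ _)) -[leRHS]mul1r ler_pM ?mlog_ge0//.
by rewrite mlog_le_ln//; lra.
Qed.

Lemma mlog2_norm_le q u : exists K, 0 <= K /\ forall x, expR 1 <= x ->
  `|mlog2 q u x| <= K * mlog (q - 2) u x.
Proof.
exists (`|q * (q - 1)| + `|u * (2 * q - 1)| + `|u * (u - 1)|); split.
  by rewrite !addr_ge0.
move=> x ex; have l1 := ln_ge1 ex; rewrite /mlog2.
rewrite !mulrDl (le_trans (ler_normD _ _))// lerD ?(le_trans (ler_normD _ _))// ?lerD//.
all: rewrite normrM ler_wpM2l// (ger0_norm (mlog_ge0 _ _ _))//.
all: by rewrite mlog_le_ln//; lra.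
Qed.

Lemma mlogDx q a u x : 0 < x -> mlog (q + a) u x = x `^ a * mlog q u x.
Proof. by move=> x0; rewrite /mlog powRDp// mulrCA mulrA. Qed.

Lemma mlog_pointwise q u p h : 0 <= q -> `|u| <= 1 -> 2 <= p -> 0 < h < 1 ->
  exists K b, [/\ 0 < K, expR 2 <= b & forall x d, b <= x ->
    let T := mlog q u x + mlog1 q u x * d + mlog2 q u x / 2 * d ^+ 2 in
    let E := K * (mlog (q - 2 - h) 1 x * d ^+ 2
                + mlog q 1 x * (`|d| / x `^ (1 - h)) `^ p) in
    (`|d| <= x `^ (1 - h) -> `|d| <= x / 2 /\ `|mlog q u (x + d) - T| <= E) /\
    (x `^ (1 - h) < `|d| -> `|T| <= E /\ (q <= p -> (x + `|d|) `^ q <= E))].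
Proof.
move=> q0 u1 p2 /andP[h0 h1].
have [K0 [K00 hK0]] := mlog_taylor q0 u1.
have [K2 [K20 hK2]] := mlog2_norm_le q u.
have [b0 hb0] := @powR_ge_near h 2 h0.
pose K := K0 + (1 + (q + 1) + K2 / 2) + 2 `^ q.
have p2q : 0 <= 2 `^ q :> R by rewrite powR_ge0.
have K0' : 0 < K by rewrite /K; clear -K00 K20 p2q q0; lra.
exists K, (Num.max (expR 2) b0); split => //; first by rewrite le_max lexx.
move=> x d; rewrite ge_max => /andP[ex bx] T E.
have x2 := expR1_le_half ex; have e2 := expR1_ge2.
have x0 : 0 < x by (clear -e2 x2; lra).
have xh := hb0 x bx.
have ex1 : expR 1 <= x by (clear -e2 x2; lra).
have l1 := ln_ge1 ex1.
have xx : x = x `^ (1 - h) * x `^ h.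
  by rewrite -powRDp// subrK powRr1// ltW.
have y0 : 0 < x `^ (1 - h) by rewrite powR_gt0.
have yx : x `^ (1 - h) <= x / 2 by (clear -e2 x2 xh xx; nra).
have E1 : 0 <= mlog (q - 2 - h) 1 x * d ^+ 2 by rewrite mulr_ge0 ?mlog_ge0 ?sqr_ge0.
have E2 : 0 <= mlog q 1 x * (`|d| / x `^ (1 - h)) `^ p.
  by rewrite mulr_ge0 ?mlog_ge0 ?powR_ge0.
split.
  move=> dx; split; first (clear -dx yx; lra).
  have dx2 : `|d| <= x / 2 by (clear -dx yx; lra).
  apply: (le_trans (hK0 x d ex dx2)); rewrite /E.
  apply: (@le_trans _ _ (K0 * (mlog (q - 2 - h) 1 x * d ^+ 2))).
    rewrite -mulrA ler_wpM2l// -(real_normK (num_real d)).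
    have -> : q - 2 - h = q - 3 + (1 - h) by ring.
    rewrite (mlogDx (q - 3) (1 - h) 1 x0) exprS mulrA [X in X * _]mulrC.
    by rewrite ler_wpM2r ?sqr_ge0// ler_wpM2r ?mlog_ge0.
  apply: (@le_trans _ _ (K * (mlog (q - 2 - h) 1 x * d ^+ 2))).
    by apply: ler_wpM2r => //; rewrite /K; clear -K20 p2q q0; lra.
  by rewrite ler_wpM2l ?lerDl// ltW.
move=> dx; pose z := `|d| / x `^ (1 - h).
have z1 : 1 <= z by rewrite /z ler_pdivlMr// mul1r ltW.
have dz : `|d| <= x * z.
  have -> : `|d| = x `^ (1 - h) * z by rewrite /z mulrCA divff ?mulr1// lt0r_neq0.
  by rewrite ler_wpM2r; clear -e2 q0 x2 yx z1; lra.
have zp1 : z <= z `^ p by rewrite le1r_powR//; clear -p2; lra.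
have zp2 : z ^+ 2 <= z `^ p by rewrite -powR_mulrn ?ler_powR//; clear -z1; lra.
have zp0 : 1 <= z `^ p by (clear -z1 zp1; lra).
have mE w : 0 <= w -> w <= K * (mlog q 1 x * z `^ p) -> w <= E.
  move=> w0 wK; apply: (le_trans wK); rewrite /E ler_wpM2l ?lerDr//; exact: ltW.
have mq : 0 <= mlog q 1 x by rewrite mlog_ge0.
have u1' : u <= 1 by move: u1; rewrite ler_norml => /andP[].
split.
  apply: mE => //; rewrite /T.
  have t0 : `|mlog q u x| <= mlog q 1 x * z `^ p.
    rewrite ger0_norm ?mlog_ge0// -[leLHS]mulr1 ler_pM ?mlog_ge0 ?ler01//.
    exact: mlog_le_ln.
  have t1 : `|mlog1 q u x * d| <= (q + 1) * (mlog q 1 x * z `^ p).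
    rewrite normrM (mlogMx q 1 x0).
    apply: (@le_trans _ _ ((q + 1) * mlog (q - 1) u x * (x * z))).
      by rewrite ler_pM// mlog1_norm_le.
    rewrite -mulrA ler_wpM2l//; first (clear -q0; lra).
    rewrite mulrCA -[leRHS]mulrA ler_wpM2l ?(ltW x0)// ler_pM ?mlog_ge0//; first (clear -z1; lra).
    by rewrite mlog_le_ln.
  have t2 : `|mlog2 q u x / 2 * d ^+ 2| <= K2 / 2 * (mlog q 1 x * z `^ p).
    rewrite normrM normrX normrM.
    have -> : `|2^-1| = 2^-1 :> R by rewrite ger0_norm// invr_ge0.
    have d2 : `|d| ^+ 2 <= x ^+ 2 * z ^+ 2.
      by rewrite -exprMn lerXn2r ?nnegrE// mulr_ge0// ?(ltW x0)//; clear -z1; lra.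
    apply: (@le_trans _ _ (K2 * mlog (q - 2) u x / 2 * (x ^+ 2 * z ^+ 2))).
      apply: ler_pM => //; rewrite ?sqr_ge0 ?mulr_ge0 ?invr_ge0//.
      by rewrite ler_wpM2r ?invr_ge0// hK2.
    have -> : mlog q 1 x = x ^+ 2 * mlog (q - 2) 1 x.
      rewrite (mlogMx q 1 x0) (mlogMx (q - 1) 1 x0) mulrA expr2; congr (_ * mlog _ _ _); clear; lra.
    rewrite [leLHS]mulrAC -[leLHS]mulrA [leLHS](_ : _ = K2 / 2 * (x ^+ 2 * (mlog (q - 2) u x * z ^+ 2))); last ring.
    rewrite ler_wpM2l ?divr_ge0// -[leRHS]mulrA ler_wpM2l ?sqr_ge0// ler_pM ?mlog_ge0 ?sqr_ge0//.
    by rewrite mlog_le_ln.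
  rewrite (le_trans (ler_normD _ _))// (le_trans (lerD (ler_normD _ _) t2))//.
  apply: (le_trans (lerD (lerD t0 t1) (lexx _))).
  rewrite -[X in X + _ * _ + _]mul1r -2!mulrDl ler_wpM2r ?mulr_ge0 ?powR_ge0//.
  by rewrite /K; clear -K00 p2q; lra.
move=> qp; apply: mE => //; first by rewrite powR_ge0.
apply: (@le_trans _ _ ((2 * (x * z)) `^ q)).
  have xz : x <= x * z by rewrite ler_peMr// ltW.
  by rewrite ge0_ler_powR// ?nnegrE ?addr_ge0 ?(ltW x0)//; clear -dx dz xz y0; lra.
have z0 : 0 <= z by (clear -z1; lra).
have pM (w : R) : 0 <= w -> (2 * (x * w)) `^ q = 2 `^ q * (x `^ q * w `^ q).
  by move=> w0; rewrite !powRM ?mulr_ge0 ?(ltW x0).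
rewrite pM//.
apply: ler_pM; rewrite ?mulr_ge0 ?powR_ge0//; first by rewrite /K; clear -K00 K20 q0; lra.
apply: ler_pM; rewrite ?powR_ge0//; last by rewrite ler_powR.
by rewrite /mlog powRr1 ?ler_peMr ?powR_ge0//; clear -l1; lra.
Qed.

(* The generator of a diffusion with drift c/x and variance s2, applied to [mlog q u]. *)
Definition Lmlog c (s2 : R) q u x :=
  c * (q * mlog (q - 2) u x + u * mlog (q - 2) (u - 1) x) + s2 / 2 * mlog2 q u x.

Lemma mlog_small q u h e : 0 < h -> 0 < e ->
  exists b, forall x, b <= x -> mlog (q - h) 1 x <= e * mlog q (u - 1) x.
Proof.
move=> h0 e0; have [b hb] := ln_powR_le (2 - u) h0 e0.
exists (Num.max b (expR 1)) => x; rewrite ge_max => /andP[bx ex].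
have l1 := ln_ge1 ex; have x0 : 0 < x by have := expR1_ge2; lra.
have := hb x bx => hx.
have -> : mlog (q - h) 1 x = x `^ (- h) * (ln x `^ (2 - u) * mlog q (u - 1) x).
  rewrite mlogDx//; congr (_ * _); rewrite /mlog mulrCA; congr (_ * _).
  by rewrite -powRDp; [congr (_ `^ _); ring|lra].
have -> : e * mlog q (u - 1) x = x `^ (- h) * (e * x `^ h * mlog q (u - 1) x).
  by rewrite powRN; field; rewrite powR_eq0 negb_and lt0r_neq0.
by rewrite ler_wpM2l ?powR_ge0// ler_wpM2r ?mlog_ge0.
Qed.

Lemma powR1D_le a : exists K, 0 <= K /\ forall x, 1 <= x -> (1 + x) `^ a <= K * x `^ a.
Proof.
have [a0|a0] := leP 0 a.
  exists (2 `^ a); split => [|x x1]; first by rewrite powR_ge0.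
  by rewrite -powRM; [rewrite ge0_ler_powR ?nnegrE|..]; lra.
exists 1; split => // x x1; rewrite mul1r -(opprK a) !(powRN _ (- a)).
by rewrite lef_pV2 ?posrE ?powR_gt0// ?ge0_ler_powR ?nnegrE; lra.
Qed.

Lemma mlog_drift q u c (s2 : R) p dl C K (e0 : R) :
  0 <= q -> `|u| <= 1 -> 0 < s2 -> 2 <= p -> 0 < dl -> 0 <= C -> 0 < K -> 0 < e0 ->
  let h := dl / (2 * p) in
  exists e x0, 0 < e /\ forall x, x0 <= x -> forall D1 D2 Dp,
    `|D1 - c / x| <= e / (x * ln x) -> `|D2 - s2| <= e / ln x ->
    Dp <= C * (1 + x) `^ (p - 2 - dl) ->
    `|mlog1 q u x * D1 + mlog2 q u x / 2 * D2 - Lmlog c s2 q u x|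
    + K * (mlog (q - 2 - h) 1 x * D2 + mlog q 1 x * (Dp / (x `^ (1 - h)) `^ p))
    <= e0 * mlog (q - 2) (u - 1) x.
Proof.
move=> q0 u1 s20 p2 dl0 C0 K0 e00 h.
have h0 : 0 < h by rewrite divr_gt0; lra.
have [K2 [K20 hK2]] := mlog2_norm_le q u.
have [K1 [K10 hK1]] := powR1D_le (p - 2 - dl).
pose e := Num.min 1 (e0 / (4 * (q + 1 + K2))).
have e_gt0 : 0 < e by rewrite lt_min ltr01 divr_gt0//; lra.
have e1 : e <= 1 by rewrite ge_min lexx.
have e2 : (q + 1 + K2) * e <= e0 / 4.
  rewrite -ler_pdivlMl; last lra.
  rewrite ge_min; apply/orP; right; rewrite invfM mulrA le_eqVlt; apply/orP; left.
  by apply/eqP; field; rewrite lt0r_neq0; clear -K20 q0; lra.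
have [b1 hb1] := @mlog_small (q - 2) u h (e0 / (4 * K * (s2 + 1))) h0 ltac:(by rewrite divr_gt0// !mulr_gt0//; (clear -s20; lra)).
have [b2 hb2] := @mlog_small (q - 2) u (dl / 2) (e0 / (4 * K * (C * K1 + 1))) ltac:((clear -dl0; lra))
  ltac:(by rewrite divr_gt0// !mulr_gt0// ltr_wpDl ?mulr_ge0).
exists e, (Num.max (expR 1) (Num.max b1 b2)); split=> // x.
rewrite !ge_max => /and3P[ex /hb1 h1 /hb2 h2] D1 D2 Dp H1 H2 H3.
have l1 := ln_ge1 ex; have ee := expR1_ge2.
have x0 : 0 < x by (clear -ee ex; lra).
have x1 : 1 < x by (clear -ee ex; lra).
set B := mlog (q - 2) (u - 1) x in h1 h2 *.
have B0 : 0 <= B by rewrite mlog_ge0.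
have mB : mlog (q - 2) u x = ln x * B by rewrite mlogMln.
have m1B : mlog1 q u x = x * (q * mlog (q - 2) u x + u * B).
  rewrite /mlog1 (mlogMx (q - 1) u x0) (mlogMx (q - 1) (u - 1) x0).
  have -> : q - 1 - 1 = q - 2 by ring.
  rewrite -/B; ring.
have T1 : `|mlog1 q u x * (D1 - c / x)| <= (q + 1) * e * B.
  rewrite normrM; apply: (@le_trans _ _ ((q + 1) * mlog (q - 1) u x * (e / (x * ln x)))).
    by rewrite ler_pM// mlog1_norm_le.
  rewrite (mlogMx (q - 1) u x0); have -> : q - 1 - 1 = q - 2 by ring.
  rewrite mB le_eqVlt; apply/orP; left; apply/eqP; field.
  by apply/andP; split; rewrite lt0r_neq0//; clear -l1; lra.
have T2 : `|mlog2 q u x / 2 * (D2 - s2)| <= K2 * e * B.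
  rewrite !normrM; have -> : `|2^-1| = 2^-1 :> R by rewrite ger0_norm// invr_ge0.
  apply: (@le_trans _ _ (K2 * mlog (q - 2) u x / 2 * (e / ln x))).
    by rewrite ler_pM ?mulr_ge0 ?invr_ge0 ?ler_wpM2r ?invr_ge0 ?hK2.
  rewrite mB (_ : _ * _ = K2 * e * B / 2); last by field; rewrite lt0r_neq0//; clear -l1; lra.
  have : 0 <= K2 * e * B by rewrite mulr_ge0// mulr_ge0// ltW.
  (clear; lra).
have D2s : D2 <= s2 + 1.
  have : e / ln x <= 1 by rewrite ler_pdivrMr; clear -e1 l1; lra.
  by move: H2; rewrite ler_norml => /andP[_]; clear; lra.
have T3 : K * (mlog (q - 2 - h) 1 x * D2) <= e0 / 4 * B.
  apply: (@le_trans _ _ (K * (s2 + 1) * mlog (q - 2 - h) 1 x)).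
    by rewrite -mulrA ler_wpM2l ?(ltW K0)// mulrC ler_wpM2r ?mlog_ge0.
  rewrite -ler_pdivlMl; last by rewrite mulr_gt0//; clear -s20; lra.
  apply: (le_trans h1); rewrite le_eqVlt; apply/orP; left; apply/eqP; field.
  by apply/andP; split; rewrite lt0r_neq0//; clear -s20; lra.
have T4 : K * (mlog q 1 x * (Dp / (x `^ (1 - h)) `^ p)) <= e0 / 4 * B.
  apply: (@le_trans _ _ (K * ((C * K1 + 1) * mlog (q - 2 - dl / 2) 1 x))).
    rewrite ler_wpM2l ?(ltW K0)//.
    have -> : mlog (q - 2 - dl / 2) 1 x = mlog q 1 x * (x `^ (p - 2 - dl) / (x `^ (1 - h)) `^ p).
      rewrite -powRrM -powRN -powRDp//.
      rewrite [RHS]mulrC -mlogDx//; congr (mlog _ _ _); rewrite /h; field; clear -p2; lra.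
    rewrite [leRHS]mulrCA ler_wpM2l ?mlog_ge0// mulrA ler_wpM2r ?invr_ge0 ?powR_ge0//.
    apply: (le_trans H3); apply: (@le_trans _ _ (C * (K1 * x `^ (p - 2 - dl)))).
      by rewrite ler_wpM2l// hK1 ?ltW.
    by rewrite mulrA ler_wpM2r ?powR_ge0//; clear; lra.
  rewrite mulrA -ler_pdivlMl; last by rewrite mulr_gt0// ltr_wpDl ?mulr_ge0.
  apply: (le_trans h2); rewrite le_eqVlt; apply/orP; left; apply/eqP; field.
  by apply/andP; split; rewrite lt0r_neq0// ltr_wpDl ?mulr_ge0.
rewrite mulrDr.
have -> : mlog1 q u x * D1 + mlog2 q u x / 2 * D2 - Lmlog c s2 q u x =
   mlog1 q u x * (D1 - c / x) + mlog2 q u x / 2 * (D2 - s2).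
  by rewrite /Lmlog -/B m1B; field; rewrite lt0r_neq0.
apply: (le_trans (lerD (le_trans (ler_normD _ _) (lerD T1 T2)) (lerD T3 T4))).
rewrite -mulrDl -mulrDl; have : (q + 1 + K2) * e * B <= e0 / 4 * B by rewrite ler_wpM2r.
have : 0 <= e0 * B by rewrite mulr_ge0// ltW.
by rewrite -mulrDl; clear; lra.
Qed.

End real_analysis.

(** * Processes on a countable state space *)

Section discrete_process.
Context {d : measure_display} {T : measurableType d} {R : realType}.
Variables (P : probability T R) (S : set R) (F : nat -> set (set T)) (X : nat -> T -> R).
Hypothesis hA0 : A0 P S F X.
Implicit Types (t s n : nat) (A B : set T).

Let Slf (M : R) : finite_set (S `&` [set x | `|x| <= M]).
Proof. by case: hA0 => -[]. Qed.

Lemma state_ge0 x : S x -> 0 <= x.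
Proof. by case: hA0 => -[_ _ h _] _; apply: h. Qed.

Let Fs t : (0 < t)%N -> sigma_algebra setT (F t).
Proof. by case: hA0 => _ [[]] + _ _ _ _ _; apply. Qed.

Lemma F_measurable t A : (0 < t)%N -> F t A -> measurable A.
Proof. by case: hA0 => _ [[]] _ + _ _ _ _; apply. Qed.

Lemma F_mono s t A : (0 < s)%N -> (s <= t)%N -> F s A -> F t A.
Proof. by case: hA0 => _ [[_ _ h] _ _ _] s0 st; exact: (h _ _ s0 st). Qed.

Lemma X_state t w : (0 < t)%N -> S (X t w).
Proof. by case: hA0 => _ [_ _ + _]; apply. Qed.

Lemma X_ge0 t w : (0 < t)%N -> 0 <= X t w.
Proof. by move=> t0; apply/state_ge0/X_state. Qed.

Lemma state_countable : countable S.
Proof.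
have -> : S = \bigcup_n (S `&` [set x | `|x| <= n%:R]).
  apply/seteqP; split=> [x Sx|x [n _ []]//].
  exists (Num.truncn `|x|).+1 => //; split => //=.
  by apply/ltW; rewrite truncnS_gt.
apply: bigcup_countable => // n _; exact/finite_set_countable/Slf.
Qed.

Lemma F_setC t A : (0 < t)%N -> F t A -> F t (~` A).
Proof. by move=> /Fs[_ h _] /h; rewrite setTD. Qed.

Lemma F_set0 t : (0 < t)%N -> F t set0.
Proof. by move=> /Fs[]. Qed.

Lemma F_setT t : (0 < t)%N -> F t setT.
Proof. by move=> t0; rewrite -setC0; apply/F_setC/F_set0. Qed.

Lemma F_bigcup t (A : nat -> set T) : (0 < t)%N -> (forall n, F t (A n)) ->
  F t (\bigcup_n A n).
Proof. by move=> /Fs[_ _]; apply. Qed.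

Lemma F_setU t A B : (0 < t)%N -> F t A -> F t B -> F t (A `|` B).
Proof.
move=> t0 FA FB; rewrite -bigcup2E; apply: F_bigcup => // -[|[|n]] //=.
exact: F_set0.
Qed.

Lemma F_setI t A B : (0 < t)%N -> F t A -> F t B -> F t (A `&` B).
Proof.
move=> t0 FA FB; rewrite -[A `&` B]setCK setCI.
by apply: F_setC => //; apply: F_setU => //; apply: F_setC.
Qed.

Lemma F_X t (B : set R) : (0 < t)%N -> F t (X t @^-1` B).
Proof.
move=> t0; have -> : X t @^-1` B = X t @^-1` (B `&` S).
  by apply/seteqP; split=> w //= => [Bw|[]//]; split => //; apply: X_state.
case: hA0 => _ [_ h _ _]; apply: h => //.
apply: countable_measurable; first exact: measurable_set1.
exact: sub_countable (subset_card_le (@subIsetr _ _ _)) state_countable.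
Qed.

Lemma measurable_X t (B : set R) : (0 < t)%N -> measurable (X t @^-1` B).
Proof. by move=> t0; apply: F_measurable (F_X B t0). Qed.

Lemma measurable_fun_X t d' (U : measurableType d') (f : R -> U) D : (0 < t)%N ->
  measurable_fun D (fun w => f (X t w)).
Proof.
move=> t0; apply: (@measurable_funTS _ _ _ _ D) => _ B mB; rewrite setTI.
exact: (measurable_X (f @^-1` B) t0).
Qed.

Lemma le_integral_loc t A (f g : T -> \bar R) : (0 < t)%N -> F t A ->
  measurable_fun setT f -> measurable_fun setT g ->
  (forall w, 0 <= f w)%E -> (forall w, 0 <= g w)%E ->
  (forall x, S x -> \int[P]_(w in A `&` X t @^-1` [set x]) f w <=
                    \int[P]_(w in A `&` X t @^-1` [set x]) g w)%E ->
  (\int[P]_(w in A) f w <= \int[P]_(w in A) g w)%E.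
Proof.
move=> t0 FA mf mg f0 g0 H.
have /countable_injP[j injj] := state_countable.
pose E n := A `&` X t @^-1` [set x | S x /\ j x = n].
have EA : A = \bigcup_n E n.
  apply/seteqP; split=> [w Aw|w [n _ []]//].
  by exists (j (X t w)) => //; split => //; split => //; apply: X_state.
have mE n : measurable (E n).
  by apply: measurableI; [exact: F_measurable FA|exact: measurable_X].
have tE : trivIset setT E.
  apply/trivIsetP => i k _ _ ik; apply/seteqP; split=> // w [[_ [_ h1]] [_ [_ h2]]].
  by move: ik; rewrite -h1 -h2 eqxx.
rewrite EA !ge0_integral_bigcup//; try exact: measurable_funTS.
apply: lee_nneseries => [n _ _|n _]; first by apply: integral_ge0.
have [[x [Sx jx]]|nx] := pselect (exists x, S x /\ j x = n).
  suff -> : E n = A `&` X t @^-1` [set x] by exact: H.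
  apply/seteqP; split=> w [Aw] /=.
    by move=> [Sw jw]; split => //=; apply: injj; rewrite ?inE// jw.
  by move=> xw; split => //=; rewrite xw.
have -> : E n = set0 by apply/seteqP; split=> // w [_ [Sw jw]]; apply: nx; exists (X t w).
by rewrite !integral_set0.
Qed.

Section stopped.
Variables (t0 : nat) (D : set R).
Hypothesis t0_gt0 : (0 < t0)%N.

Fixpoint stopped (n : nat) (w : T) : R :=
  match n with
  | 0 => X t0 w
  | n'.+1 => if `[< D (stopped n' w) >] then X (t0 + n)%N w else stopped n' w
  end.

Lemma stopped_in n w : D (stopped n w) ->
  stopped n w = X (t0 + n)%N w /\ forall j, (j <= n)%N -> D (X (t0 + j)%N w).
Proof.
elim: n => [|n IH] /=.
  by rewrite addn0 => h; split => // j; rewrite leqn0 => /eqP ->; rewrite addn0.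
case: asboolP => // Dn Dn1; split => // j; rewrite leq_eqVlt => /orP[/eqP -> //|].
by rewrite ltnS => /((IH Dn).2).
Qed.

Lemma stopped_inP n w : (forall j, (j <= n)%N -> D (X (t0 + j)%N w)) ->
  D (stopped n w).
Proof.
elim: n => [|n IH] H /=; first by rewrite -[t0]addn0; apply: H.
by rewrite asboolT; [apply: H|apply: IH => j jn; apply: H; rewrite (leq_trans jn)].
Qed.

Lemma stopped_out n w : ~ D (stopped n w) -> exists j, [/\ (j <= n)%N,
  stopped n w = X (t0 + j)%N w & forall i, (i < j)%N -> D (X (t0 + i)%N w)].
Proof.
elim: n => [|n IH] /=; first by exists 0%N; rewrite addn0.
case: asboolP => [Dn Dn1|Dn _].
  exists n.+1; split => // i; rewrite ltnS; exact: (stopped_in Dn).2.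
by have [j [jn e h]] := IH Dn; exists j; split => //; rewrite (leq_trans jn).
Qed.

Lemma stopped_outW n m w : (n <= m)%N -> D (stopped m w) -> D (stopped n w).
Proof.
move=> nm /stopped_in[_ h]; apply: stopped_inP => j jn; apply: h.
exact: leq_trans nm.
Qed.

Lemma stopped_state n w : S (stopped n w).
Proof. by elim: n => [|n IH] /=; [exact: X_state|case: ifPn => // _; apply: X_state; rewrite addn_gt0 t0_gt0]. Qed.

Lemma F_stopped n (B : set R) : F (t0 + n)%N (stopped n @^-1` B).
Proof.
elim: n B => [|n IH] B; first by rewrite addn0; exact: F_X.
have tn : (0 < t0 + n)%N by rewrite addn_gt0 t0_gt0.
have -> : stopped n.+1 @^-1` B = (stopped n @^-1` D `&` X (t0 + n.+1)%N @^-1` B)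
    `|` (stopped n @^-1` (~` D `&` B)).
  apply/seteqP; split=> w /=; first by case: asboolP => h1 h2; [left|right].
  by case: asboolP => h1 [[]|[]].
rewrite addnS; apply: F_setU => //; last exact: F_mono (IH _).
by apply: F_setI => //; [exact: F_mono (IH _)|exact: F_X].
Qed.

Lemma measurable_stopped n (B : set R) : measurable (stopped n @^-1` B).
Proof. by apply: F_measurable (F_stopped n B); rewrite addn_gt0 t0_gt0. Qed.

Lemma measurable_fun_stopped n d' (U : measurableType d') (f : R -> U) E :
  measurable_fun E (fun w => f (stopped n w)).
Proof.
apply: (@measurable_funTS _ _ _ _ E) => _ B mB; rewrite setTI.
exact: (measurable_stopped n (f @^-1` B)).
Qed.

Definition drift_le (f a b : R -> R) := forall t x A, (0 < t)%N -> S x -> D x ->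
  F t A -> A `<=` X t @^-1` [set x] ->
  (\int[P]_(w in A) (f (X t.+1 w))%:E + (a x)%:E * P A <= (f x + b x)%:E * P A)%E.

Lemma drift_stopped (f a b : R -> R) A n :
  (forall x, S x -> 0 <= f x) -> (forall x, S x -> D x -> 0 <= a x) ->
  (forall x, S x -> D x -> 0 <= b x) -> drift_le f a b -> F t0 A ->
  (\int[P]_(w in A) (f (stopped n w))%:E
     + \sum_(j < n) \int[P]_(w in A `&` stopped j @^-1` D) (a (stopped j w))%:E
   <= \int[P]_(w in A) (f (X t0 w))%:E
     + \sum_(j < n) \int[P]_(w in A `&` stopped j @^-1` D) (b (stopped j w))%:E)%E.
Proof.
move=> f0 a0 b0 H FA; elim: n => [|n IH]; first by rewrite !big_ord0.
have tn : (0 < t0 + n)%N by rewrite addn_gt0 t0_gt0.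
have mA : measurable A by exact: F_measurable FA.
pose A' := A `&` stopped n @^-1` D.
have FA' : F (t0 + n)%N A'.
  by apply: F_setI => //; [apply: F_mono FA => //; rewrite leq_addr|exact: F_stopped].
have mA' : measurable A' by exact: F_measurable FA'.
pose A'' := A `&` stopped n @^-1` (~` D).
have mA'' : measurable A'' by apply: measurableI => //; exact: measurable_stopped.
have AE : A = A' `|` A'' by rewrite /A' /A'' -setIUr -preimage_setU setUv preimage_setT setIT.
have dA : [disjoint A' & A''].
  by apply/disj_setPS => w [[_ h] [_ h']].
have f0' m w : (0 <= (f (stopped m w))%:E)%E by rewrite lee_fin f0//; exact: stopped_state.
have split m : (\int[P]_(w in A) (f (stopped m w))%:E = \int[P]_(w in A') (f (stopped m w))%:E
    + \int[P]_(w in A'') (f (stopped m w))%:E)%E.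
  rewrite [in LHS]AE ge0_integral_setU// -AE.
  exact: (measurable_fun_stopped m (fun x => (f x)%:E)).
have step : (\int[P]_(w in A') (f (stopped n.+1 w))%:E + \int[P]_(w in A') (a (stopped n w))%:E
    <= \int[P]_(w in A') (f (stopped n w))%:E + \int[P]_(w in A') (b (stopped n w))%:E)%E.
  have fe t w : (0 < t)%N -> (0 <= (f (X t w))%:E)%E.
    by move=> ?; rewrite lee_fin f0//; exact: X_state.
  pose a' x := if `[< S x /\ D x >] then a x else 0.
  pose b' x := if `[< S x /\ D x >] then b x else 0.
  have ae x : (0 <= (a' x)%:E)%E.
    by rewrite lee_fin /a'; case: asboolP => // -[? ?]; exact: a0.
  have be x : (0 <= (b' x)%:E)%E.
    by rewrite lee_fin /b'; case: asboolP => // -[? ?]; exact: b0.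
  have -> : (\int[P]_(w in A') (f (stopped n.+1 w))%:E = \int[P]_(w in A') (f (X (t0 + n).+1 w))%:E)%E.
    apply: eq_integral => w; rewrite inE => -[_ /= Dw].
    by rewrite asboolT// addnS.
  have -> : (\int[P]_(w in A') (a (stopped n w))%:E = \int[P]_(w in A') (a' (X (t0 + n) w))%:E)%E.
    apply: eq_integral => w; rewrite inE => -[_ /= Dw].
    by have [<- _] := stopped_in Dw; rewrite /a' asboolT//; split => //; exact: stopped_state.
  have -> : (\int[P]_(w in A') (b (stopped n w))%:E = \int[P]_(w in A') (b' (X (t0 + n) w))%:E)%E.
    apply: eq_integral => w; rewrite inE => -[_ /= Dw].
    by have [<- _] := stopped_in Dw; rewrite /b' asboolT//; split => //; exact: stopped_state.
  have -> : (\int[P]_(w in A') (f (stopped n w))%:E = \int[P]_(w in A') (f (X (t0 + n) w))%:E)%E.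
    apply: eq_integral => w; rewrite inE => -[_ /= Dw].
    by have [<- _] := stopped_in Dw.
  have mX t (g : R -> R) E : (0 < t)%N -> measurable_fun E (fun w => (g (X t w))%:E).
    by move=> tt; exact: (measurable_fun_X (fun x => (g x)%:E)).
  rewrite -!ge0_integralD//; try exact: mX; try (by move=> w _; apply: fe); try (by move=> w _; apply: ae); try (by move=> w _; apply: be).
  apply: (le_integral_loc tn FA') => //.
  - by apply: emeasurable_funD; apply: mX.
  - by apply: emeasurable_funD; apply: mX.
  - by move=> w; apply: adde_ge0; rewrite ?ae ?be//; apply: fe.
  - by move=> w; apply: adde_ge0; rewrite ?ae ?be//; apply: fe.
  move=> x Sx; set A3 := _ `&` _.
  have FA3 : F (t0 + n)%N A3 by apply: F_setI => //; exact: F_X.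
  have mA3 : measurable A3 by exact: F_measurable FA3.
  rewrite !ge0_integralD//; try exact: mX; try (by move=> w _; apply: fe); try (by move=> w _; apply: ae); try (by move=> w _; apply: be).
  have [[w0 A3w0]|nA3] := pselect (exists w, A3 w); last first.
    have -> : A3 = set0 by apply/seteqP; split=> // w A3w; apply: nA3; exists w.
    by rewrite !integral_set0.
  have Dx : D x.
    by case: A3w0 => -[_ /= Dw] xw; have [e _] := stopped_in Dw; rewrite -xw -e.
  have c (g : R -> R) : (\int[P]_(w in A3) (g (X (t0 + n)%N w))%:E = (g x)%:E * P A3)%E.
    rewrite -integral_cst//; apply: eq_integral => w; rewrite inE => -[_ /= <-]; by [].
  rewrite !c; have := H (t0 + n)%N x A3 tn Sx Dx FA3 (@subIsetr _ _ _).
  rewrite EFinD muleDl ?fin_num_measure// /a' /b' !asboolT//.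
rewrite !big_ord_recr/= [X in (X + _)%E](split n.+1).
have -> : (\int[P]_(w in A'') (f (stopped n.+1 w))%:E = \int[P]_(w in A'') (f (stopped n w))%:E)%E.
  by apply: eq_integral => w; rewrite inE => -[_ /= Dw]; rewrite asboolF.
rewrite addeA.
apply: (@le_trans _ _ ((\int[P]_(w in A') (f (stopped n w))%:E + \int[P]_(w in A') (b (stopped n w))%:E)
   + \int[P]_(w in A'') (f (stopped n w))%:E
   + \sum_(j < n) \int[P]_(w in A `&` stopped j @^-1` D) (a (stopped j w))%:E)%E).
  rewrite [leLHS]addeAC [X in (X + _)%E]addeAC leeD2r//.
  by rewrite leeD2r.
rewrite [X in (X + _ <= _)%E]addeAC -split [leLHS]addeAC.
by apply: (le_trans (leeD2r _ IH)); rewrite -[leLHS]addeA.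
Qed.

End stopped.

End discrete_process.

Lemma maxr0_subN (R : realType) (k : R) : Num.max k 0 - Num.max (- k) 0 = k.
Proof. by case: (leP (- k) 0) => ?; case: (leP k 0) => ?; lra. Qed.

Section local_laws.
Context {d : measure_display} {T : measurableType d} {R : realType}.
Variables (P : probability T R) (S : set R) (F : nat -> set (set T)) (X : nat -> T -> R).
Hypothesis hA0 : A0 P S F X.
Implicit Types (t n : nat) (A B : set T) (x : R).

Let PA_fin A : measurable A -> P A = (fine (P A))%:E.
Proof. by move=> mA; rewrite fineK// fin_num_measure. Qed.

Lemma cexp_measurable t Y Z : (0 < t)%N -> cexp_version P (F t) Y Z ->
  measurable_fun setT Z.
Proof.
by move=> t0 [h _ _] _ B mB; rewrite setTI; apply: (F_measurable hA0 t0); apply: h.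
Qed.

Lemma A1_local x y : A1 P S F X -> S x -> S y -> exists m phi, [/\ (0 < m)%N, 0 < phi &
  forall t A, (0 < t)%N -> F t A -> A `<=` X t @^-1` [set x] ->
  (phi%:E * P A <= P (A `&` X (t + m)%N @^-1` [set y]))%E].
Proof.
move=> [m [phi [mphi h]]] Sx Sy; have [m0 phi0] := mphi x y Sx Sy.
exists (m x y), (phi x y); split => // t A t0 FA Ax.
have mA := F_measurable hA0 t0 FA.
have [Z [hZ ae]] := h y Sy t t0.
have mZ := cexp_measurable t0 hZ.
case: hZ => _ Z0 /(_ A FA) e.
set Y := [set w' | _] in e.
have AY : A `&` Y = A `&` X (t + m x y)%N @^-1` [set y].
  apply/seteqP; split=> w [Aw]; rewrite /Y/= => h'; split => //=; move: h';
    by rewrite (Ax w Aw : X t w = x).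
have mAY : measurable (A `&` Y).
  by rewrite AY; apply: measurableI => //; apply: (measurable_X hA0); rewrite addn_gt0 t0.
rewrite -AY.
have -> : (P (A `&` Y) = \int[P]_(w in A) Z w)%E.
  rewrite -e -[in LHS](setIidl (@subIsetl _ A Y)) -integral_indic//.
  apply: eq_integral => w; rewrite inE => Aw; congr (_%:E).
  by rewrite !indicE in_setI mem_set.
rewrite -integral_cst//; apply: ae_ge0_le_integral => //.
- by move=> w _; rewrite lee_fin ltW.
- exact: measurable_funTS.
- by apply: filterS ae => w hw Aw; move: hw; rewrite (Ax w Aw).
Qed.

Lemma Mp_local p : Mp P F X p -> exists dl C, [/\ 0 < dl, dl <= 1, 0 <= C &
  forall t x A, (0 < t)%N -> S x -> F t A -> A `<=` X t @^-1` [set x] ->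
  (\int[P]_(w in A) (`|X t.+1 w - x| `^ p)%:E
     <= (C * (1 + x) `^ (p - 2 - dl))%:E * P A)%E].
Proof.
move=> [dl [C [dl0 h]]]; exists (Num.min dl 1), (Num.max C 0); split.
- by rewrite lt_min dl0 ltr01.
- by rewrite ge_min lexx orbT.
- by rewrite le_max lexx orbT.
move=> t x A t0 Sx FA Ax; have [Z [hZ ae]] := h t t0.
have x0 := state_ge0 hA0 Sx.
have mA := F_measurable hA0 t0 FA.
have mZ := cexp_measurable t0 hZ.
case: hZ => _ Z0 /(_ A FA) e.
have -> : (\int[P]_(w in A) (`|X t.+1 w - x| `^ p)%:E = \int[P]_(w in A) Z w)%E.
  by rewrite -e; apply: eq_integral => w; rewrite inE => Aw; rewrite (Ax w Aw).
rewrite -integral_cst//; apply: ae_ge0_le_integral => //.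
- exact: measurable_funTS.
- by move=> w _; rewrite lee_fin mulr_ge0 ?powR_ge0// le_max lexx orbT.
apply: filterS ae => w hw Aw; apply: (le_trans hw).
rewrite (Ax w Aw : X t w = x) lee_fin.
apply: (@le_trans _ _ (Num.max C 0 * (1 + x) `^ (p - 2 - dl))).
  by rewrite ler_wpM2r ?powR_ge0// le_max lexx.
rewrite ler_wpM2l ?le_max ?lexx ?orbT// ler_powR ?lerDl// lerB// ge_min lexx//.
Qed.

Section local_measure.
Variables (p : R) (t : nat) (x : R) (A : set T).
Hypotheses (p2 : 2 < p) (t0 : (0 < t)%N) (FA : F t A).
Hypothesis Mfin : (\int[P]_(w in A) (`|X t.+1 w - x| `^ p)%:E < +oo)%E.

Let mA : measurable A := F_measurable hA0 t0 FA.
Let mX (U : R -> R) D : measurable_fun D (fun w => (U (X t.+1 w))%:E).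
Proof. exact: (measurable_fun_X hA0 (fun z => (U z)%:E)). Qed.

Lemma local_integrable (U : R -> R) (K : R) :
  (forall z, `|U z| <= K * (1 + `|z - x| `^ p)) ->
  P.-integrable A (EFin \o (fun w => U (X t.+1 w))).
Proof.
move=> hU; have K0 : 0 <= K.
  have p0 : p != 0 by have := p2; move=> ?; apply/lt0r_neq0; lra.
  have := hU x; rewrite subrr normr0 powR0// addr0 mulr1.
  exact: le_trans.
apply: (@le_integrable _ _ _ _ _ mA _ (EFin \o (fun w => K * (1 + `|X t.+1 w - x| `^ p)))).
- exact: mX.
- by move=> w _ /=; rewrite lee_fin (ger0_norm (mulr_ge0 K0 _))// addr_ge0 ?powR_ge0.
apply/integrableP; split; first exact: (@mX (fun z => K * (1 + `|z - x| `^ p))).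
under eq_integral do rewrite /= ger0_norm ?mulr_ge0 ?addr_ge0 ?powR_ge0// EFinM EFinD.
rewrite ge0_integralZl//; last 2 first.
- by apply: emeasurable_funD => //; exact: (@mX (fun z => `|z - x| `^ p)).
- by move=> w _; rewrite adde_ge0 ?lee_fin ?powR_ge0.
rewrite ge0_integralD//; last exact: (@mX (fun z => `|z - x| `^ p)).
rewrite integral_cst// lte_mul_pinfty// ?lee_fin//.
  by rewrite mul1e lte_add_pinfty// ltey_eq fin_num_measure.
Qed.

Let le_1Dp (z k : R) : 0 <= k <= p -> `|z| `^ k <= 1 + `|z| `^ p.
Proof.
move=> /andP[k0 kp]; have [z1|z1] := leP `|z| 1.
  have : `|z| `^ k <= 1 by rewrite -[leRHS](congr1 (@^~ k) (powR1 R)) ge0_ler_powR ?nnegrE.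
  by have := powR_ge0 `|z| p; lra.
have : `|z| `^ k <= `|z| `^ p by rewrite ler_powR// ltW.
lra.
Qed.

Lemma local_integrable1 : P.-integrable A (EFin \o (fun w => X t.+1 w - x)).
Proof.
apply: (@local_integrable (fun z => z - x) 1) => z.
by have := p2 => ?; rewrite mul1r -[leLHS]powRr1// le_1Dp//; lra.
Qed.

Lemma local_integrable2 : P.-integrable A (EFin \o (fun w => (X t.+1 w - x) ^+ 2)).
Proof.
apply: (@local_integrable (fun z => (z - x) ^+ 2) 1) => z.
by have := p2 => ?; rewrite normrX mul1r -powR_mulrn// le_1Dp//; lra.
Qed.

Lemma local_integrablep : P.-integrable A (EFin \o (fun w => `|X t.+1 w - x| `^ p)).
Proof.
apply: (@local_integrable (fun z => `|z - x| `^ p) 1) => z.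
by rewrite mul1r ger0_norm ?powR_ge0// lerDr.
Qed.

Lemma local_upper (g : R -> R) k0 k1 k2 kp :
  (forall z, S z -> 0 <= g z) ->
  (forall z, S z -> g z <= k0 + k1 * (z - x) + k2 * (z - x) ^+ 2 + kp * `|z - x| `^ p) ->
  (\int[P]_(w in A) (g (X t.+1 w))%:E <=
    (k0 * fine (P A) + k1 * \int[P]_(w in A) (X t.+1 w - x)
     + k2 * \int[P]_(w in A) ((X t.+1 w - x) ^+ 2)
     + kp * \int[P]_(w in A) (`|X t.+1 w - x| `^ p))%:E)%E.
Proof.
move=> g0 gk.
have i0 : P.-integrable A (EFin \o (fun w => k0)).
  by apply: finite_measure_integrable_cst.
have i1 := integrableZl mA k1 local_integrable1.
have i2 := integrableZl mA k2 local_integrable2.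
have ip := integrableZl mA kp local_integrablep.
have i01 := integrableD mA i0 i1.
have i012 := integrableD mA i01 i2.
have iall := integrableD mA i012 ip.
rewrite -!RintegralZl//; [|exact: local_integrablep|exact: local_integrable2|exact: local_integrable1].
rewrite -(@Rintegral_cst _ _ _ P)// -!RintegralD//.
rewrite /Rintegral fineK; last exact: (integrable_fin_num mA iall).
apply: ge0_le_integral => //.
- by move=> w _; rewrite lee_fin g0//; apply: (X_state hA0).
- exact: (@mX (fun z => k0 + k1 * (z - x) + k2 * (z - x) ^+ 2 + kp * `|z - x| `^ p)).
- by move=> w _; rewrite lee_fin gk//; apply: (X_state hA0).
Qed.

End local_measure.

Lemma A2_local (c s2 p : R) : A2 P F X c s2 -> 2 < p -> forall e : R, 0 < e -> exists x0 : R, forall t x A,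
  (0 < t)%N -> F t A -> A `<=` X t @^-1` [set x] -> x0 <= x ->
  (\int[P]_(w in A) (`|X t.+1 w - x| `^ p)%:E < +oo)%E ->
  `|\int[P]_(w in A) (X t.+1 w - x) - c / x * fine (P A)| <= e / (x * ln x) * fine (P A) /\
  `|\int[P]_(w in A) ((X t.+1 w - x) ^+ 2) - s2 * fine (P A)| <= e / ln x * fine (P A).
Proof.
move=> [s20 [Zp [Zm [Q [hcexp h]]]]] p2 e e0; have [x0 hx0] := h e e0.
exists x0 => t x A t0 FA Ax xx0 Mfin.
have mA := F_measurable hA0 t0 FA.
have i1 := local_integrable1 p2 t0 FA Mfin.
have i2 := local_integrable2 p2 t0 FA Mfin.
have [cZp cZm cQ] := hcexp t t0.
have [[mZp mZm] mQ] := (cexp_measurable t0 cZp, cexp_measurable t0 cZm, cexp_measurable t0 cQ).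
case: cZp cZm cQ => _ Zp0 /(_ A FA) ep [_ Zm0 /(_ A FA) em] [_ Q0 /(_ A FA) eq].
have {hx0}ae := hx0 t t0.
have intc (k : R) : (\int[P]_(w in A) (k%:E) = (k * fine (P A))%:E)%E.
  by rewrite EFinM -(PA_fin mA) -(integral_cst P mA).
split.
  set e' := e / (x * ln x).
  pose Ip := (\int[P]_(w in A) (Num.max (X t.+1 w - x) 0)%:E)%E.
  pose Im := (\int[P]_(w in A) (Num.max (x - X t.+1 w) 0)%:E)%E.
  have Ipe : Ip = (\int[P]_(w in A) Zp t w)%E.
    by rewrite -ep; apply: eq_integral => w; rewrite inE => Aw; rewrite (Ax w Aw : X t w = x).
  have Ime : Im = (\int[P]_(w in A) Zm t w)%E.
    by rewrite -em; apply: eq_integral => w; rewrite inE => Aw; rewrite (Ax w Aw : X t w = x).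
  have ipe : P.-integrable A (EFin \o (fun w => Num.max (X t.+1 w - x) 0)).
    apply: le_integrable i1 => //.
      exact: (measurable_fun_X hA0 (fun z => (Num.max (z - x) 0)%:E)).
    move=> w _ /=; rewrite lee_fin ger0_norm ?le_max ?lexx ?orbT//.
    by rewrite ge_max ler_norm normr_ge0.
  have ime : P.-integrable A (EFin \o (fun w => Num.max (x - X t.+1 w) 0)).
    apply: le_integrable i1 => //.
      exact: (measurable_fun_X hA0 (fun z => (Num.max (x - z) 0)%:E)).
    move=> w _ /=; rewrite lee_fin ger0_norm ?le_max ?lexx ?orbT//.
    by rewrite ge_max normr_ge0 -normrN opprB ler_norm.
  have Ipf : Ip = (fine Ip)%:E by rewrite fineK//; exact: integrable_fin_num ipe.
  have Imf : Im = (fine Im)%:E by rewrite fineK//; exact: integrable_fin_num ime.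
  have I1 : \int[P]_(w in A) (X t.+1 w - x) = fine Ip - fine Im.
    rewrite -[RHS]/(\int[P]_(w in A) (Num.max (X t.+1 w - x) 0) - \int[P]_(w in A) (Num.max (x - X t.+1 w) 0)).
    rewrite -RintegralB//; apply: eq_Rintegral => w _.
    by rewrite -[LHS]maxr0_subN opprB.
  have cmp (k : R) (U V : T -> \bar R) : measurable_fun setT U -> measurable_fun setT V ->
      (forall w, 0 <= U w)%E -> (forall w, 0 <= V w)%E ->
      {ae P, forall w, A w -> (U w <= V w + k%:E)%E} ->
      forall u v, (\int[P]_(w in A) U w = u%:E)%E -> (\int[P]_(w in A) V w = v%:E)%E ->
      u <= v + k * fine (P A).
    move=> mU mV U0 V0 aeUV u v hu hv.
    have : (\int[P]_(w in A) (U w + (Num.max (- k) 0)%:E) <= \int[P]_(w in A) (V w + (Num.max k 0)%:E))%E.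
      apply: ae_ge0_le_integral => //.
      - by move=> w _; rewrite adde_ge0// lee_fin le_max lexx orbT.
      - by apply: emeasurable_funD => //; apply: measurable_funTS.
      - by move=> w _; rewrite adde_ge0// lee_fin le_max lexx orbT.
      - by apply: emeasurable_funD => //; apply: measurable_funTS.
      apply: filterS aeUV => w hw Aw; apply: (le_trans (leeD2r _ (hw Aw))).
      rewrite -addeA leeD2l// -EFinD lee_fin.
      by rewrite -[X in X + _](maxr0_subN k) subrK.
    rewrite !ge0_integralD//; try (exact: measurable_funTS);
      try (by move=> w _; rewrite lee_fin le_max lexx orbT).
    rewrite hu hv !intc -!EFinD lee_fin => huv.
    rewrite -[X in X * _](maxr0_subN k) mulrBl.
    by rewrite addrA lerBrDr.
  have fineP : 0 <= fine (P A) by rewrite fine_ge0.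
  rewrite I1 ler_norml; apply/andP; split.
    have := cmp (e' - c / x) (Zm t) (Zp t) mZm mZp (Zm0) (Zp0) _ (fine Im) (fine Ip).
    rewrite -Ipe -Ime -Ipf -Imf => /(_ _ erefl erefl).
    suff H : {ae P, forall w : T, A w -> (Zm t w <= Zp t w + (e' - c / x)%:E)%E} by move=> /(_ H); lra.
    apply: filterS ae => w hw Aw; move: hw; rewrite (Ax w Aw : X t w = x) => /(_ xx0)[zp zm _].
    rewrite -/e' -[Zp t w]fineK ?ge0_fin_numE// -[Zm t w]fineK ?ge0_fin_numE//=.
    by rewrite ler_norml => /andP[h1 h2] _; rewrite -EFinD lee_fin; lra.
  have := cmp (e' + c / x) (Zp t) (Zm t) mZp mZm (Zp0) (Zm0) _ (fine Ip) (fine Im).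
  rewrite -Ipe -Ime -Ipf -Imf => /(_ _ erefl erefl).
  suff H : {ae P, forall w : T, A w -> (Zp t w <= Zm t w + (e' + c / x)%:E)%E} by move=> /(_ H); lra.
  apply: filterS ae => w hw Aw; move: hw; rewrite (Ax w Aw : X t w = x) => /(_ xx0)[zp zm _].
  rewrite -/e' -[Zp t w]fineK ?ge0_fin_numE// -[Zm t w]fineK ?ge0_fin_numE//=.
  by rewrite ler_norml => /andP[h1 h2] _; rewrite -EFinD lee_fin; lra.
set e' := e / ln x.
have I2 : ((\int[P]_(w in A) ((X t.+1 w - x) ^+ 2))%:E = \int[P]_(w in A) Q t w)%E.
  rewrite -eq /Rintegral fineK; last exact: integrable_fin_num i2.
  by apply: eq_integral => w; rewrite inE => Aw; rewrite (Ax w Aw : X t w = x).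
have aeQ : {ae P, forall w, A w -> ((s2 - e')%:E <= Q t w)%E /\ (Q t w <= (s2 + e')%:E)%E}.
  apply: filterS ae => w hw Aw; move: hw; rewrite (Ax w Aw : X t w = x) => /(_ xx0)[_ _ q _].
  rewrite -/e' -[Q t w]fineK ?ge0_fin_numE//= ler_norml => /andP[h1 h2].
  by rewrite !lee_fin; lra.
rewrite ler_norml; apply/andP; split.
  rewrite lerBrDr -lee_fin I2.
  have [se|se] := leP (s2 - e') 0.
    apply: (@le_trans _ _ 0%E); last exact: integral_ge0.
    have fineP : 0 <= fine (P A) by rewrite fine_ge0.
    by rewrite lee_fin; nra.
  have -> : - (e' * fine (P A)) + s2 * fine (P A) = (s2 - e') * fine (P A) by ring.
  rewrite -intc; apply: ae_ge0_le_integral => //.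
  - by move=> w _; rewrite lee_fin ltW.
  - exact: measurable_funTS.
  - by apply: filterS aeQ => w /[apply] -[].
rewrite lerBlDr -lee_fin I2.
have -> : e' * fine (P A) + s2 * fine (P A) = (s2 + e') * fine (P A) by ring.
rewrite -intc.
have [se|se] := leP 0 (s2 + e').
  apply: ae_ge0_le_integral => //.
  - exact: measurable_funTS.
  - by apply: filterS aeQ => w /[apply] -[].
rewrite le_eqVlt; apply/orP; left; apply/eqP.
have PA0 : P A = 0%E.
  have [N [mN PN AN]] := aeQ.
  apply: (@subset_measure0 _ _ _ P A N) => // w Aw; apply: AN => /= h'.
  have [_ h2] := h' Aw; have := le_trans (Q0 w) h2.
  by rewrite lee_fin leNgt se.
by rewrite !null_set_integral//; apply: measurable_funTS.
Qed.

Lemma local_law (c s2 p : R) : A2 P F X c s2 -> Mp P F X p -> 2 < p ->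
  exists dl C : R, [/\ 0 < dl, dl <= 1, 0 <= C & forall e : R, 0 < e -> exists x0 : R,
  forall t x A, (0 < t)%N -> S x -> F t A -> A `<=` X t @^-1` [set x] -> 0 < fine (P A) ->
  exists D1 D2 Dp : R,
  [/\ x0 <= x -> `|D1 - c / x| <= e / (x * ln x) /\ `|D2 - s2| <= e / ln x,
      0 <= Dp, Dp <= C * (1 + x) `^ (p - 2 - dl) &
      forall (g : R -> R) (k0 k1 k2 kp : R), (forall z, S z -> 0 <= g z) ->
      (forall z, S z -> g z <= k0 + k1 * (z - x) + k2 * (z - x) ^+ 2 + kp * `|z - x| `^ p) ->
      (\int[P]_(w in A) (g (X t.+1 w))%:E <= (k0 + k1 * D1 + k2 * D2 + kp * Dp)%:E * P A)%E]].
Proof.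
move=> hA2 hMp p2; have [dl [C [dl0 dl1 C0 hC]]] := Mp_local hMp.
exists dl, C; split => // e e0; have [x0 hx0] := A2_local hA2 p2 e0.
exists x0 => t x A t0 Sx FA Ax PA.
have mA := F_measurable hA0 t0 FA.
have Cx := hC t x A t0 Sx FA Ax.
have Mfin : (\int[P]_(w in A) (`|X t.+1 w - x| `^ p)%:E < +oo)%E.
  by rewrite (le_lt_trans Cx)// (PA_fin mA) -EFinM ltry.
have iP := local_integrablep p2 t0 FA Mfin.
exists ((\int[P]_(w in A) (X t.+1 w - x)) / fine (P A)),
  ((\int[P]_(w in A) ((X t.+1 w - x) ^+ 2)) / fine (P A)),
  ((\int[P]_(w in A) (`|X t.+1 w - x| `^ p)) / fine (P A)).
have nP : fine (P A) != 0 by rewrite lt0r_neq0.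
split.
- move=> xx0; have [h1 h2] := hx0 t x A t0 FA Ax xx0 Mfin.
  have dv (a b k : R) : `|a - b * fine (P A)| <= k * fine (P A) -> `|a / fine (P A) - b| <= k.
    move=> hab; rewrite -(ler_pM2r PA) -[X in `|_| * X](gtr0_norm PA) -normrM.
    by rewrite mulrBl divfK.
  by split; apply: dv.
- by apply: divr_ge0; [apply: Rintegral_ge0 => w _; exact: powR_ge0|exact: fine_ge0].
- rewrite ler_pdivrMr// -lee_fin /Rintegral fineK; last exact: integrable_fin_num iP.
  by rewrite EFinM -(PA_fin mA).
- move=> g k0 k1 k2 kp g0 gk.
  have := local_upper p2 t0 FA Mfin g0 gk.
  rewrite [X in (_ * X)%E](PA_fin mA) -EFinM.
  suff -> : forall a b m : R, (k0 + k1 * (a / fine (P A)) + k2 * (b / fine (P A)) + kp * (m / fine (P A)))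
    * fine (P A) = k0 * fine (P A) + k1 * a + k2 * b + kp * m by [].
  by move=> a b m; field.
Qed.

End local_laws.

Section drift_steps.
Context {R : realType}.
Implicit Types (x y z q u c p dl C D : R).

Lemma mlog_homo q u x y : 1 <= q -> `|u| <= 1 -> expR 1 <= x -> x <= y ->
  mlog q u x <= mlog q u y.
Proof.
move=> q1 u1 ex xy; have e2 := @expR1_ge2 R.
have D z : x <= z -> is_derive z 1 (mlog q u) (mlog1 q u z).
  by move=> xz; apply: is_derive_mlog; lra.
have [||z zxy e] := @MVT_segment _ (mlog q u) (mlog1 q u) x y xy.
- by move=> z; rewrite in_itv/= => /andP[/ltW xz _]; apply: D.
- apply: derivable_within_continuous => z; rewrite in_itv/= => /andP[xz _].
  by have h := D z xz; apply: ex_derive.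
rewrite -subr_ge0 e mulr_ge0// ?subr_ge0//.
move: zxy; rewrite in_itv/= => /andP[xz _].
have l1 : 1 <= ln z by apply: ln_ge1; lra.
have h1 : mlog (q - 1) (u - 1) z <= mlog (q - 1) u z by rewrite mlog_le_ln//; lra.
have h0 := @mlog_ge0 R (q - 1) (u - 1) z.
rewrite /mlog1; move: u1; rewrite ler_norml => /andP[u1 u2]; clear -h0 h1 q1 u1; nra.
Qed.

Lemma powR_div (a b k : R) : 0 <= a -> 0 < b -> (a / b) `^ k = a `^ k / b `^ k.
Proof.
move=> a0 b0; rewrite powRM ?invr_ge0 ?(ltW b0)//; congr (_ * _).
by rewrite -(powR_inv1 (ltW b0)) -powRrM mulN1r powRN.
Qed.

Lemma Lmlog_ge c (s2 : R) q u x : 2 <= q -> 0 < u <= 1 -> 0 < s2 -> 0 <= c + (q - 1) * s2 / 2 ->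
  expR 1 <= x -> u * s2 / 2 * mlog (q - 2) (u - 1) x <= Lmlog c s2 q u x.
Proof.
move=> q2 /andP[u0 u1] s20 k0 ex; have l1 := ln_ge1 ex.
have m1 : mlog (q - 2) (u - 2) x <= mlog (q - 2) (u - 1) x by rewrite mlog_le_ln//; lra.
rewrite /Lmlog /mlog2.
have := @mlog_ge0 R (q - 2) u x; have := @mlog_ge0 R (q - 2) (u - 1) x.
have := @mlog_ge0 R (q - 2) (u - 2) x.
move: (mlog (q - 2) (u - 2) x) (mlog (q - 2) (u - 1) x) (mlog (q - 2) u x) m1 => m2 m1 m0 m21 m20 m10 m00.
rewrite -subr_ge0.
have -> : c * (q * m0 + u * m1) + s2 / 2 * (q * (q - 1) * m0 + u * (2 * q - 1) * m1
   + u * (u - 1) * m2) - u * s2 / 2 * m1 =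
   q * m0 * (c + (q - 1) * s2 / 2) + u * m1 * (c + (q - 1) * s2 / 2) +
   u * (s2 / 2) * ((q - 1) * m1 - (1 - u) * m2) by field.
have a1 : 0 <= q * m0 * (c + (q - 1) * s2 / 2) by rewrite !mulr_ge0//; lra.
have a2 : 0 <= u * m1 * (c + (q - 1) * s2 / 2) by rewrite !mulr_ge0//; lra.
have a3 : 0 <= u * (s2 / 2) * ((q - 1) * m1 - (1 - u) * m2).
  rewrite mulr_ge0//; first by rewrite mulr_ge0//; clear -s20 u0; lra.
  by nra.
lra.
Qed.

Definition clamp (a b z : R) := Num.min (Num.max z a) b.

Lemma mlog_lower_step c (s2 : R) q u p dl C : 0 < s2 -> 2 < p -> 0 < dl <= 1 -> 0 <= C ->
  2 <= q -> 0 < u <= 1 -> 0 <= c + (q - 1) * s2 / 2 ->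
  exists x0 e : R, [/\ expR 2 <= x0, 0 < e & forall x, x0 <= x -> exists k1 k2 kp : R,
    (forall x0' y z, expR 1 <= x0' <= x -> x < y ->
      mlog q u x - mlog q u (clamp x0' (2 * y) z)
      <= k1 * (z - x) + k2 * (z - x) ^+ 2 + kp * `|z - x| `^ p) /\
    forall D1 D2 Dp : R, `|D1 - c / x| <= e / (x * ln x) -> `|D2 - s2| <= e / ln x ->
      Dp <= C * (1 + x) `^ (p - 2 - dl) ->
      k1 * D1 + k2 * D2 + kp * Dp + u * s2 / 4 * mlog (q - 2) (u - 1) x <= 0].
Proof.
move=> s20 p2 /andP[dl0 dl1] C0 q2 u01 hq; have /andP[u0 u1] := u01.
have un : `|u| <= 1 by rewrite ger0_norm// ltW.
pose h := dl / (2 * p).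
have h0 : 0 < h by rewrite divr_gt0; clear -dl0 p2 s20; lra.
have h1 : h < 1 by rewrite /h ltr_pdivrMr; clear -dl1 p2; lra.
have q0 : 0 <= q by lra.
have h01 : 0 < h < 1 by rewrite h0.
have [K [b [K0 eb hK]]] := mlog_pointwise q0 un (ltW p2) h01.
have e00 : 0 < u * s2 / 4 by rewrite divr_gt0// mulr_gt0.
have [e [x1 [e0 hdr]]] := mlog_drift c q0 un s20 (ltW p2) dl0 C0 K0 e00.
exists (Num.max b x1), e; split => //; first by rewrite le_max eb.
move=> x; rewrite ge_max => /andP[bx x1x].
have {}hK z := hK x (z - x) bx.
have {}hdr := hdr x x1x.
have ex : expR 2 <= x by exact: le_trans bx.
have e12 := expR1_le_half ex; have e2 := @expR1_ge2 R.
have xgt0 : 0 < x by (clear -e12 e2; lra).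
have y0 : 0 < x `^ (1 - h) by rewrite powR_gt0.
exists (- mlog1 q u x), (- (mlog2 q u x / 2) + K * mlog (q - 2 - h) 1 x),
  (K * mlog q 1 x / (x `^ (1 - h)) `^ p); split.
  move=> x0' y z /andP[ex0 x0x] xy; have [H1 H2] := hK z; clear hK hdr.
  rewrite powR_div// in H1 H2.
  set V := mlog q u (clamp _ _ _).
  have V0 : 0 <= V by rewrite mlog_ge0.
  have [dx|dx] := leP `|z - x| (x `^ (1 - h)).
    have [d2] := H1 dx; rewrite (addrC x) subrK => hT.
    have Vz : mlog q u z <= V.
      move: d2; rewrite ler_norml => /andP[d2 d3].
      rewrite /V mlog_homo//; [by rewrite (le_trans _ q2)// ler1n|(clear -d2 e12; lra)|].
      by rewrite /clamp le_min le_max lexx /=; clear -d3 e12 e2 xy; lra.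
    move: hT; rewrite ler_norml => /andP[hT _]; clear H1 H2.
    by move: hT; set W := `|z - x| `^ p; clear -Vz; lra.
  have [hT _] := H2 dx; clear H1 H2.
  move: hT; rewrite ler_norml => /andP[_ hT].
  by move: hT; set W := `|z - x| `^ p; clear -V0; lra.
move=> D1 D2 Dp hD1 hD2 hDp.
have ex1 : expR 1 <= x by (clear -e12 e2; lra).
have hL := Lmlog_ge q2 u01 s20 hq ex1.
have := hdr D1 D2 Dp hD1 hD2 hDp; clear hdr hK; set Z := _ - Lmlog _ _ _ _ _ => hdrift.
have := ler_norm (- Z); rewrite normrN /Z {Z} in hdrift * => hZ.
have e1 : K * mlog q 1 x / (x `^ (1 - h)) `^ p * Dp = K * (mlog q 1 x * (Dp / (x `^ (1 - h)) `^ p)).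
  by field; rewrite powR_eq0 negb_and (lt0r_neq0 y0).
rewrite [X in _ + X + _ <= _]e1.
by clear hD1 hD2 hDp; clear -hL hZ hdrift; lra.
Qed.

(* [mlog q u] is used only above e, where [ln] is at least 1. *)
Definition ftop q u z := mlog q u (Num.max z (expR 1)).

Lemma ftop_ge0 q u z : 0 <= ftop q u z.
Proof. exact: mlog_ge0. Qed.

Lemma ftop_le q u x z : 0 <= q -> u <= 0 -> expR 1 <= x -> ftop q u z <= (x + `|z - x|) `^ q.
Proof.
move=> q0 u0 ex; have e2 := @expR1_ge2 R.
have e1 : expR 1 <= Num.max z (expR 1) by rewrite le_max lexx orbT.
have l1 := ln_ge1 e1; rewrite /ftop /mlog.
apply: (@le_trans _ _ (Num.max z (expR 1) `^ q * 1)).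
  rewrite ler_wpM2l ?powR_ge0//.
  apply: (@le_trans _ _ (ln (Num.max z (expR 1)) `^ 0)); first by rewrite ler_powR.
  by rewrite powRr0.
rewrite mulr1 ge0_ler_powR ?nnegrE//; [lra|by rewrite addr_ge0//; lra|].
have := ler_norm (z - x); have := normr_ge0 (z - x).
by move=> h1 h2; rewrite ge_max; apply/andP; split; lra.
Qed.

Lemma ftop_step c (s2 : R) q u p dl C (e0 : R) : 0 < s2 -> 2 < p -> 0 < dl <= 1 -> 0 <= C ->
  1 <= q -> q <= p -> -1 <= u <= 0 -> 0 < e0 ->
  exists x0 e : R, [/\ expR 2 <= x0, 0 < e & forall x, x0 <= x -> exists k1 k2 kp : R,
    (forall z, ftop q u z <= mlog q u x + k1 * (z - x) + k2 * (z - x) ^+ 2 + kp * `|z - x| `^ p) /\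
    forall D1 D2 Dp : R, `|D1 - c / x| <= e / (x * ln x) -> `|D2 - s2| <= e / ln x ->
      Dp <= C * (1 + x) `^ (p - 2 - dl) ->
      k1 * D1 + k2 * D2 + kp * Dp <= Lmlog c s2 q u x + e0 * mlog (q - 2) (u - 1) x].
Proof.
move=> s20 p2 /andP[dl0 dl1] C0 q1 qp /andP[u1 u0] e00.
have un : `|u| <= 1 by rewrite ler_norml u1 (le_trans u0).
pose h := dl / (2 * p).
have h0 : 0 < h by rewrite divr_gt0; clear -dl0 p2 s20; lra.
have h1 : h < 1 by rewrite /h ltr_pdivrMr; clear -dl1 p2; lra.
have q0 : 0 <= q by lra.
have h01 : 0 < h < 1 by rewrite h0.
have [K [b [K0 eb hK]]] := mlog_pointwise q0 un (ltW p2) h01.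
have K20 : 0 < 2 * K by (clear -K0; lra).
have [e [x1 [e0' hdr]]] := mlog_drift c q0 un s20 (ltW p2) dl0 C0 K20 e00.
exists (Num.max b x1), e; split => //; first by rewrite le_max eb.
move=> x; rewrite ge_max => /andP[bx x1x].
have {}hK z := hK x (z - x) bx.
have {}hdr := hdr x x1x.
have ex : expR 2 <= x by exact: le_trans bx.
have e12 := expR1_le_half ex; have e2 := @expR1_ge2 R.
have xgt0 : 0 < x by (clear -e12 e2; lra).
have y0 : 0 < x `^ (1 - h) by rewrite powR_gt0.
exists (mlog1 q u x), (mlog2 q u x / 2 + 2 * K * mlog (q - 2 - h) 1 x),
  (2 * K * mlog q 1 x / (x `^ (1 - h)) `^ p); split.
  move=> z; have [H1 H2] := hK z; clear hK hdr.
  rewrite powR_div// in H1 H2.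
  have [dx|dx] := leP `|z - x| (x `^ (1 - h)).
    have [d2] := H1 dx; rewrite (addrC x) subrK => hT.
    have -> : ftop q u z = mlog q u z.
      rewrite /ftop max_l//; move: d2; rewrite ler_norml => /andP[]; clear -e12; lra.
    have := le_trans (normr_ge0 _) hT => hE.
    move: hT hE; rewrite ler_norml => /andP[_ hT]; clear H1 H2.
    by move: hT; set W := `|z - x| `^ p; clear; lra.
  have [hT hq] := H2 dx.
  have ex1 : expR 1 <= x by (clear -e12 e2; lra).
  have hf := le_trans (ftop_le z q0 u0 ex1) (hq qp).
  clear H1 H2; move: hT hf; rewrite ler_norml => /andP[hT _].
  by move: hT; set W := `|z - x| `^ p; clear; lra.
move=> D1 D2 Dp hD1 hD2 hDp.
have := hdr D1 D2 Dp hD1 hD2 hDp; clear hdr hK; set Z := _ - Lmlog _ _ _ _ _ => hdrift.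
have := ler_norm Z; rewrite /Z {Z} in hdrift * => hZ.
have e1 : 2 * K * mlog q 1 x / (x `^ (1 - h)) `^ p * Dp
    = 2 * K * (mlog q 1 x * (Dp / (x `^ (1 - h)) `^ p)).
  by field; rewrite powR_eq0 negb_and (lt0r_neq0 y0).
rewrite [X in _ + X <= _]e1.
by clear hD1 hD2 hDp; clear -hZ hdrift; lra.
Qed.

Lemma ftop_near0_step q u p (x0 : R) : 1 <= q -> q <= p -> u <= 0 -> expR 2 <= x0 ->
  exists k0 kp, [/\ 0 <= k0, 0 <= kp & forall x z, 0 <= x < x0 ->
    ftop q u z <= k0 + kp * `|z - x| `^ p].
Proof.
move=> q1 qp u0 ex0.
have e2 := @expR1_ge2 R; have e12 := expR1_le_half ex0.
have q0 : 0 <= q by lra.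
have [N [N1 N2]] : exists N, 1 <= N /\ N = 2 * x0 by exists (2 * x0); split => //; lra.
have NN : 0 <= (2 * N) `^ q by rewrite powR_ge0.
have p2q : 0 <= 2 `^ q :> R by rewrite powR_ge0.
exists ((2 * N) `^ q), (2 `^ q); split => // x z /andP[xge0 xx0].
have ex0' : expR 1 <= x0 by lra.
apply: (le_trans (ftop_le z q0 u0 ex0')).
have dz0 := normr_ge0 (z - x).
have [hN0 hN] : 0 <= x0 + `|z - x0| /\ x0 + `|z - x0| <= N + `|z - x|.
  have := ler_normD (z - x) (x - x0); rewrite addrA subrK.
  rewrite (ler0_norm (_ : x - x0 <= 0)); last by rewrite subr_le0 ltW.
  by have := normr_ge0 (z - x0); lra.
apply: (@le_trans _ _ ((N + `|z - x|) `^ q)).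
  by rewrite ge0_ler_powR// nnegrE (le_trans hN0).
have [zN|zN] := leP `|z - x| N.
  apply: (@le_trans _ _ ((2 * N) `^ q)).
    by rewrite ge0_ler_powR// ?nnegrE; clear -N1 dz0 zN; lra.
  by rewrite lerDl mulr_ge0// powR_ge0.
have zN1 : 1 <= `|z - x| by (clear -N1 zN; lra).
apply: (@le_trans _ _ ((2 * `|z - x|) `^ q)).
  by rewrite ge0_ler_powR// ?nnegrE; clear -N1 dz0 zN; lra.
rewrite powRM//; apply: (@le_trans _ _ (2 `^ q * `|z - x| `^ p)).
  by rewrite ler_wpM2l// ler_powR.
by rewrite lerDr.
Qed.

End drift_steps.

Section drift_estimates.
Context {d : measure_display} {T : measurableType d} {R : realType}.
Variables (P : probability T R) (S : set R) (F : nat -> set (set T)) (X : nat -> T -> R).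
Variables (c s2 p : R).
Hypotheses (hA0 : A0 P S F X) (hA2 : A2 P F X c s2) (hMp : Mp P F X p) (p_gt2 : 2 < p).
Implicit Types (t n : nat) (A B : set T) (x y z q u : R).

Lemma integral_null A (f : T -> \bar R) : measurable A -> fine (P A) = 0 ->
  measurable_fun setT f -> (\int[P]_(w in A) f w = 0)%E.
Proof.
move=> mA PA mf; apply: null_set_integral => //; first exact: measurable_funTS.
by apply/eqP; rewrite -fine_eq0 ?fin_num_measure// PA.
Qed.

Lemma drift_lower q u (b : R) : 2 <= q -> 0 < u <= 1 -> 0 <= c + (q - 1) * s2 / 2 ->
  exists x0, [/\ expR 2 <= x0, b <= x0 & forall y, x0 <= y ->
  drift_le P S F X [set z | z < y]
    (fun z => mlog q u (2 * y) - mlog q u (clamp x0 (2 * y) z))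
    (fun z => if x0 <= z then u * s2 / 4 * mlog (q - 2) (u - 1) z else 0)
    (fun => 0)].
Proof.
move=> q2 u01 hq; have /andP[u0 u1] := u01.
have s20 : 0 < s2 by case: hA2.
have un : `|u| <= 1 by rewrite ger0_norm// ltW.
have [dl [C [dl0 dl1 C0 hlaw]]] := local_law hA0 hA2 hMp p_gt2.
have dl01 : 0 < dl <= 1 by rewrite dl0.
have [x1 [e [ex1 e0 hstep]]] := mlog_lower_step s20 p_gt2 dl01 C0 q2 u01 hq.
have [x2 hx2] := hlaw e e0.
have [x0 [x1x0 x2x0 bx0]] : exists x0, [/\ x1 <= x0, x2 <= x0 & b <= x0].
  by exists (Num.max (Num.max x1 x2) b); rewrite !le_max !lexx !orbT.
have ex0 : expR 2 <= x0 by exact: le_trans x1x0.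
exists x0; split => // y x0y t x A t0 Sx /= xy FA Ax.
have mA := F_measurable hA0 t0 FA.
have e1x0 : expR 1 <= x0 by rewrite (le_trans _ ex0)// ler_expR ler1n.
have y2 : x0 <= 2 * y.
  by rewrite (le_trans x0y)// ler_peMl ?ler1n// (le_trans _ x0y)// (le_trans _ ex0)// expR_ge0.
have cl z : expR 1 <= clamp x0 (2 * y) z /\ clamp x0 (2 * y) z <= 2 * y.
  split; last by rewrite /clamp ge_min lexx orbT.
  by rewrite /clamp le_min (le_trans e1x0 y2) le_max e1x0 orbT.
have q1 : 1 <= q by rewrite (le_trans _ q2)// ler1n.
pose g z := mlog q u (2 * y) - mlog q u (clamp x0 (2 * y) z).
have g0 z : S z -> 0 <= g z.
  by move=> _; rewrite subr_ge0; have [c1 c2] := cl z; apply: mlog_homo.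
have [PA0|PA0] := eqVneq (fine (P A)) 0.
  rewrite integral_null//; last exact: (measurable_fun_X hA0 (fun z => (g z)%:E)).
  by rewrite -(fineK (fin_num_measure P _ mA)) PA0 !mule0 adde0.
have {}PA0 : 0 < fine (P A) by rewrite lt0r PA0 fine_ge0.
have [D1 [D2 [Dp [hD Dp0 hDp hg]]]] := hx2 t x A t0 Sx FA Ax PA0.
have fin (a b' k : R) (I : \bar R) : (I <= k%:E * P A)%E -> k + a <= b' ->
    (I + a%:E * P A <= b'%:E * P A)%E.
  move=> hI kab; apply: (le_trans (leeD2r _ hI)).
  rewrite -muleDl ?fin_num_measure// -EFinD.
  by apply: lee_wpmul2r => //; rewrite lee_fin.
have [x0x|xx0] := leP x0 x; last first.
  apply: (fin _ _ _ _ (hg g (g x) 0 0 0 g0 _)) => //.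
    move=> z Sz; rewrite !mul0r !addr0 lerB// mlog_homo//.
      by have [] := cl x.
    rewrite /clamp (max_r (ltW xx0)) le_min; apply/andP; split.
      by rewrite ge_min; apply/orP; left; rewrite le_max lexx orbT.
    by rewrite ge_min lexx orbT.
  by rewrite !mul0r !addr0 /g.
have clx : clamp x0 (2 * y) x = x.
  rewrite /clamp (max_l x0x) min_l// (le_trans (ltW xy))// ler_peMl ?ler1n//.
  by rewrite (le_trans _ (ltW xy))// (le_trans _ x0x)// (le_trans _ ex0)// expR_ge0.
rewrite clx.
have [k1 [k2 [kp [hk hkD]]]] := hstep x (le_trans x1x0 x0x).
apply: (fin _ _ _ _ (hg g (mlog q u (2 * y) - mlog q u x) k1 k2 kp g0 _)).
  move=> z Sz; have := hk x0 y z _ xy; rewrite e1x0 x0x => /(_ isT).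
  move=> hz; apply: (@le_trans _ _ (mlog q u (2 * y) - mlog q u x
    + (mlog q u x - mlog q u (clamp x0 (2 * y) z)))); first by rewrite /g addrA subrK.
  by rewrite -[leRHS]addrA -[leRHS]addrA lerD2l addrA.
have [hD1 hD2] := hD (le_trans x2x0 x0x).
have := hkD D1 D2 Dp hD1 hD2 hDp.
by move=> hh; rewrite -[leLHS]addrA -[leLHS]addrA -[leLHS]addrA lerD2l !addrA.
Qed.

Lemma drift_upper q u (e0 : R) : 1 <= q -> q <= p -> -1 <= u <= 0 -> 0 < e0 ->
  exists x0 C0, [/\ expR 2 <= x0, 0 <= C0 & forall t x A, (0 < t)%N -> S x -> F t A ->
    A `<=` X t @^-1` [set x] ->
    (\int[P]_(w in A) (ftop q u (X t.+1 w))%:E <=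
     (if x0 <= x then mlog q u x + Lmlog c s2 q u x + e0 * mlog (q - 2) (u - 1) x else C0)%:E
       * P A)%E].
Proof.
move=> q1 qp u01 e00; have /andP[u1 u0] := u01.
have s20 : 0 < s2 by case: hA2.
have [dl [C [dl0 dl1 C0 hlaw]]] := local_law hA0 hA2 hMp p_gt2.
have dl01 : 0 < dl <= 1 by rewrite dl0.
have [x1 [e [ex1 e0' hstep]]] := ftop_step c s20 p_gt2 dl01 C0 q1 qp u01 e00.
have [x2 hx2] := hlaw e e0'.
have [x0 [x1x0 x2x0]] : exists x0, x1 <= x0 /\ x2 <= x0.
  by exists (Num.max x1 x2); rewrite !le_max !lexx !orbT.
have ex0 : expR 2 <= x0 by exact: le_trans x1x0.
have [k0 [kp [k00 kp0 hk]]] := ftop_near0_step q1 qp u0 ex0.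
pose a := Num.max (p - 2 - dl) 0.
pose C1 := C * (1 + x0) `^ a.
have C10 : 0 <= C1 by rewrite mulr_ge0// powR_ge0.
exists x0, (k0 + kp * C1); split => //; first by rewrite addr_ge0// mulr_ge0.
move=> t x A t0 Sx FA Ax.
have mA := F_measurable hA0 t0 FA.
have [PA0|PA0] := eqVneq (fine (P A)) 0.
  rewrite integral_null//; last exact: (measurable_fun_X hA0 (fun z => (ftop q u z)%:E)).
  by rewrite -(fineK (fin_num_measure P _ mA)) PA0 mule0.
have {}PA0 : 0 < fine (P A) by rewrite lt0r PA0 fine_ge0.
have [D1 [D2 [Dp [hD Dp0 hDp hg]]]] := hx2 t x A t0 Sx FA Ax PA0.
have fin (b' k : R) (I : \bar R) : (I <= k%:E * P A)%E -> k <= b' -> (I <= b'%:E * P A)%E.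
  move=> hI kab; apply: (le_trans hI).
  by apply: lee_wpmul2r => //; rewrite lee_fin.
have xge0 := state_ge0 hA0 Sx.
have g0 z : S z -> 0 <= ftop q u z by move=> _; exact: ftop_ge0.
have [x0x|xx0] := leP x0 x; last first.
  apply: (fin _ _ _ (hg (ftop q u) k0 0 0 kp g0 _)).
    by move=> z Sz; rewrite !mul0r !addr0; apply: hk; rewrite xge0.
  rewrite !mul0r !addr0 lerD2l ler_wpM2l//.
  apply: (le_trans hDp); rewrite ler_wpM2l//.
  apply: (@le_trans _ _ ((1 + x) `^ a)); first by rewrite ler_powR ?lerDl// le_max lexx.
  rewrite ge0_ler_powR ?nnegrE ?addr_ge0// ?(le_trans xge0 (ltW xx0))//.
    by rewrite le_max lexx orbT.
  by rewrite lerD2l ltW.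
have [k1 [k2 [kp' [hk' hkD]]]] := hstep x (le_trans x1x0 x0x).
apply: (fin _ _ _ (hg (ftop q u) (mlog q u x) k1 k2 kp' g0 _)); first by move=> z _; exact: hk'.
have [hD1 hD2] := hD (le_trans x2x0 x0x).
have := hkD D1 D2 Dp hD1 hD2 hDp.
by rewrite -!addrA lerD2l.
Qed.

End drift_estimates.

Lemma finite_uniform_bounds (R : realType) (E : set R) (m : R -> nat) (phi : R -> R) :
  finite_set E -> (forall x, E x -> 0 < phi x) ->
  exists (M : nat) (phi0 : R), 0 < phi0 /\ forall x, E x -> (m x <= M)%N /\ phi0 <= phi x.
Proof.
move=> /finite_seqP[s ->]; elim: s => [|a s IH] h; first by exists 0%N, 1; split.
have [x xs|M [phi0 [phi00 hM]]] := IH; first by apply: h; rewrite /= in_cons xs orbT.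
exists (maxn (m a) M), (Num.min (phi a) phi0); split.
  by rewrite lt_min phi00 h//= mem_head.
move=> x; rewrite /= in_cons => /orP[/eqP ->|/hM[h1 h2]].
  by rewrite leq_maxl ge_min lexx.
by rewrite (leq_trans h1) ?leq_maxr// ge_min h2 orbT.
Qed.

(** * Occupation times *)

Section hitting.
Context {d : measure_display} {T : measurableType d} {R : realType}.
Variables (P : probability T R) (S : set R) (F : nat -> set (set T)) (X : nat -> T -> R).
Hypotheses (hA0 : A0 P S F X).
Implicit Types (t n : nat) (A B : set T) (x y z q u : R).
Local Notation pr A := (fine (P A)).

Lemma prE A : measurable A -> P A = (pr A)%:E.
Proof. by move=> mA; rewrite fineK// fin_num_measure. Qed.

Lemma pr_ge0 A : 0 <= pr A.
Proof. exact: fine_ge0. Qed.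

Lemma pr_le A B : measurable A -> measurable B -> A `<=` B -> pr A <= pr B.
Proof.
by move=> mA mB AB; rewrite fine_le ?fin_num_measure// le_measure ?inE.
Qed.

Lemma pr_le1 A : measurable A -> pr A <= 1.
Proof. by move=> mA; rewrite -lee_fin -prE// probability_le1. Qed.

Lemma prU_le A B : measurable A -> measurable B -> pr (A `|` B) <= pr A + pr B.
Proof.
move=> mA mB; rewrite -lee_fin EFinD -!prE//; first exact: measureU2.
exact: measurableU.
Qed.

Lemma pr_splitC A B : measurable A -> measurable B -> pr A = pr (A `&` B) + pr (A `&` ~` B).
Proof.
move=> mA mB; have mC := measurableC mB.
apply: EFin_inj; rewrite EFinD -!prE//; try exact: measurableI.
by rewrite -setDE addeC -measureDI.
Qed.

Lemma irreducible_below (x0 y0 : R) : A1 P S F X -> S y0 ->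
  exists (M : nat) (phi : R), 0 < phi /\ forall t A, (0 < t)%N -> F t A ->
    A `<=` X t @^-1` [set x | x < x0] ->
    phi * pr A <= \sum_(i < M.+1) pr (A `&` X (t + i)%N @^-1` [set y0]).
Proof.
move=> hA1 Sy0.
have h x : S x -> {mphi : nat * R | 0 < mphi.2 /\
    forall t A, (0 < t)%N -> F t A -> A `<=` X t @^-1` [set x] ->
    (mphi.2%:E * P A <= P (A `&` X (t + mphi.1)%N @^-1` [set y0]))%E}.
  move=> Sx; apply: cid; have [m [phi [m0 phi0 hm]]] := A1_local hA0 hA1 Sx Sy0.
  by exists (m, phi).
pose mphi x := if pselect (S x) is left Sx then sval (h x Sx) else (0%N, 1).
have hmphi x : S x -> 0 < (mphi x).2 /\
    forall t A, (0 < t)%N -> F t A -> A `<=` X t @^-1` [set x] ->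
    ((mphi x).2%:E * P A <= P (A `&` X (t + (mphi x).1)%N @^-1` [set y0]))%E.
  by move=> Sx; rewrite /mphi; case: pselect => // Sx'; exact: (svalP (h x Sx')).
have fE : finite_set (S `&` [set x | x < x0]).
  apply: (@sub_finite_set _ _ (S `&` [set x | `|x| <= `|x0|])); last by case: hA0 => -[].
  move=> x [Sx /= xx0]; split => //=.
  by rewrite (ger0_norm (state_ge0 hA0 Sx)) (le_trans (ltW xx0))// ler_norm.
have [x [Sx _]|M [phi [phi0 hM]]] := @finite_uniform_bounds R _ (fun x => (mphi x).1)
  (fun x => (mphi x).2) fE; first exact: (hmphi x Sx).1.
exists M, phi; split => // t A t0 FA Ax.
have mA := F_measurable hA0 t0 FA.
pose E i := X (t + i)%N @^-1` [set y0].
have mE i : measurable (E i).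
  by apply: (measurable_X hA0); rewrite addn_gt0 t0.
have int1 i B : measurable B -> (\int[P]_(w in B) (\1_(E i) w)%:E = (pr (B `&` E i))%:E)%E.
  by move=> mB; rewrite integral_indic// setIC -prE//; apply: measurableI.
have ints B : measurable B -> (\int[P]_(w in B) (\sum_(i < M.+1) (\1_(E i) w)%:E) =
    (\sum_(i < M.+1) pr (B `&` E i))%:E)%E.
  move=> mB; rewrite ge0_integral_sum//; last first.
    by move=> i; apply/measurable_EFinP; apply: measurable_indic.
  by rewrite -sumEFin; apply: eq_bigr => i _; rewrite int1.
rewrite -lee_fin EFinM -prE// -ints// -integral_cst//.
apply: (le_integral_loc hA0 t0 FA) => //.
- apply: emeasurable_sum => i; apply/measurable_EFinP; exact: measurable_indic.
- by move=> w; rewrite lee_fin ltW.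
- by move=> w; apply: sume_ge0 => i _; rewrite lee_fin.
move=> x Sx; set A' := A `&` _.
have FA' : F t A' by apply: (F_setI hA0) => //; exact: (F_X hA0).
have mA' := F_measurable hA0 t0 FA'.
rewrite ints// integral_cst//.
have [xx0|x0x] := ltP x x0; last first.
  have -> : A' = set0.
    by apply/seteqP; split=> // w [/Ax/= h1 h2]; move: h1; rewrite (h2 : X t w = x) ltNge x0x.
  by rewrite measure0 mule0 lee_fin sumr_ge0// => i _; exact: pr_ge0.
have [hm hp] := hM x (conj Sx xx0).
have hx := (hmphi x Sx).2 t A' t0 FA' (@subIsetr _ _ _).
apply: (@le_trans _ _ ((mphi x).2%:E * P A')%E).
  by apply: lee_wpmul2r => //; rewrite lee_fin.
apply: (le_trans hx); rewrite -/(E (mphi x).1) (prE (measurableI _ _ mA' (mE _))).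
have hmM : ((mphi x).1 < M.+1)%N by rewrite ltnS.
rewrite lee_fin (bigD1 (Ordinal hmM))//= lerDl sumr_ge0// => i _; exact: pr_ge0.
Qed.

Lemma sum_shift (a : nat -> R) m i :
  \sum_(i <= j < m + i) a j = \sum_(j < m) a (j + i)%N.
Proof. by rewrite -{1}(add0n i) big_addn addnK big_mkord. Qed.

Lemma telescope_occupation (a : nat -> R) (M : R) n i : 0 <= M ->
  (forall j, 0 <= a j) -> (forall j, a j <= M) ->
  \sum_(j < n) (a j - a (j + i)%N) <= i%:R * M.
Proof.
move=> M0 a0 aM; rewrite sumrB -(big_mkord xpredT a) -sum_shift.
have e : \sum_(0 <= j < n + i) a j = \sum_(0 <= j < i) a j + \sum_(i <= j < n + i) a j.
  by rewrite (@big_cat_nat _ _ _ i)// leq_addl.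
have h1 : \sum_(0 <= j < n) a j <= \sum_(0 <= j < n + i) a j.
  by rewrite [leRHS](@big_cat_nat _ _ _ n)//= ?leq_addr// lerDl sumr_ge0.
have h2 : \sum_(0 <= j < i) a j <= i%:R * M.
  rewrite big_mkord; apply: (@le_trans _ _ (\sum_(j < i) M)).
    by apply: ler_sum => j _; exact: aM.
  by rewrite sumr_const card_ord mulr_natl.
by rewrite lerBlDr (le_trans h1)// e lerD2r.
Qed.

Section occupation.
Variables (t0 : nat) (D : set R).
Hypothesis t0_gt0 : (0 < t0)%N.
Local Notation W := (stopped X t0 D).

Lemma measurable_occ A n (B : set R) : F t0 A -> measurable (A `&` W n @^-1` B).
Proof.
move=> FA; apply: measurableI; first exact: (F_measurable hA0 t0_gt0).
exact: (measurable_stopped hA0).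
Qed.

Lemma sum_leaving A n i : F t0 A ->
  \sum_(j < n) pr (A `&` W j @^-1` D `&` W (j + i)%N @^-1` (~` D)) <= i%:R * pr A.
Proof.
move=> FA; have mA := F_measurable hA0 t0_gt0 FA.
have h j : pr (A `&` W j @^-1` D `&` W (j + i)%N @^-1` (~` D)) =
    pr (A `&` W j @^-1` D) - pr (A `&` W (j + i)%N @^-1` D).
  rewrite (@pr_splitC (A `&` W j @^-1` D) (W (j + i)%N @^-1` D)); last 2 first.
  - exact: measurable_occ.
  - exact: (measurable_stopped hA0).
  have -> : A `&` W j @^-1` D `&` W (j + i)%N @^-1` D = A `&` W (j + i)%N @^-1` D.
    apply/seteqP; split=> [w [[]]//|w [Aw Dw]]; split => //; split => //.
    by apply: (@stopped_outW _ _ _ X t0 D j (j + i)) => //; rewrite leq_addr.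
  by rewrite addrAC subrr add0r.
under eq_bigr do rewrite h.
apply: (@telescope_occupation (fun j => pr (A `&` W j @^-1` D))) => //; try exact: pr_ge0.
- by move=> j; exact: pr_ge0.
- by move=> j; apply: pr_le => //; exact: measurable_occ.
Qed.

Lemma time_below (M : nat) (phi x0 y0 : R) A n :
  (forall t A, (0 < t)%N -> F t A -> A `<=` X t @^-1` [set x | x < x0] ->
    phi * pr A <= \sum_(i < M.+1) pr (A `&` X (t + i)%N @^-1` [set y0])) ->
  F t0 A ->
  phi * \sum_(j < n) pr (A `&` W j @^-1` (D `&` [set x | x < x0])) <=
  \sum_(i < M.+1) \sum_(j < n) pr (A `&` W j @^-1` D `&` W (j + i)%N @^-1` (D `&` [set y0]))
   + \sum_(i < M.+1) i%:R * pr A.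
Proof.
move=> hM FA; have mA := F_measurable hA0 t0_gt0 FA.
apply: (@le_trans _ _ (\sum_(j < n) \sum_(i < M.+1)
  (pr (A `&` W j @^-1` D `&` W (j + i)%N @^-1` (D `&` [set y0]))
    + pr (A `&` W j @^-1` D `&` W (j + i)%N @^-1` (~` D))))).
  rewrite mulr_sumr; apply: ler_sum => j _.
  set A' := A `&` _.
  have tj : (0 < t0 + j)%N by rewrite addn_gt0 t0_gt0.
  have FA' : F (t0 + j)%N A'.
    apply: (F_setI hA0) => //; last exact: (F_stopped hA0).
    by apply: (F_mono hA0) FA; rewrite ?leq_addr.
  have mA' := F_measurable hA0 tj FA'.
  apply: (le_trans (hM _ A' tj FA' _)).
    by move=> w [Aw [/= Dw ww]]; have [<- _] := stopped_in Dw.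
  apply: ler_sum => i _.
  have mX : measurable (X (t0 + j + i)%N @^-1` [set y0]).
    by apply: (measurable_X hA0); rewrite !addn_gt0 t0_gt0.
  have mB (B : set R) : measurable (A `&` W j @^-1` D `&` W (j + i)%N @^-1` B).
    by apply: measurableI; [exact: measurable_occ|exact: (measurable_stopped hA0)].
  apply: le_trans (prU_le (mB _) (mB _)); apply: pr_le.
  - exact: measurableI.
  - exact: measurableU.
  - move=> w [[Aw [Dw xw]] /= Xw].
    have [Dji|Dji] := pselect (D (W (j + i)%N w)); [left|right]; split => //=.
    split => //; have [-> _] := stopped_in Dji.
    by rewrite addnA.
rewrite exchange_big/= -big_split/=; apply: ler_sum => i _.
by rewrite big_split/= lerD2l; exact: sum_leaving.
Qed.

End occupation.

End hitting.

Section arithmetic.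
Context {R : realType}.

Lemma quadratic_drift_arith (c s2 x x' D1 D2 : R) : expR 2 <= x' -> x / 2 <= x' -> 0 <= x ->
  `|D1 - c / x'| <= 1 / (x' * ln x') -> `|D2 - s2| <= 1 / ln x' ->
  2 * (x' - x) * D1 + D2 <= 2 * (`|c| + 1) + s2 + 1.
Proof.
move=> ex xx' x0.
have e12 := expR1_le_half ex; have e2 := @expR1_ge2 R.
have l1 : 1 <= ln x' by apply: ln_ge1; lra.
have x'0 : 0 < x' by lra.
have dx : `|x' - x| <= x' by rewrite ler_norml; lra.
have i1 : 1 / ln x' <= 1 by rewrite ler_pdivrMr; lra.
have i2 : 1 / (x' * ln x') <= 1 / x'.
  by rewrite ler_pM2l// lef_pV2 ?posrE ?mulr_gt0//; [rewrite ler_peMr// ltW|lra].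
move=> h1 /ler_normlP[_ h2].
have D1b : `|D1| <= (`|c| + 1) / x'.
  rewrite -[D1](subrK (c / x')) (le_trans (ler_normD _ _))// mulrDl addrC lerD//.
    by rewrite normrM normfV (gtr0_norm x'0).
  by rewrite (le_trans h1).
have : (x' - x) * D1 <= `|c| + 1.
  rewrite (le_trans (ler_norm _))// normrM.
  apply: (@le_trans _ _ (x' * ((`|c| + 1) / x'))); first exact: ler_pM.
  by rewrite mulrCA divff ?mulr1// lt0r_neq0.
by rewrite -mulrA; lra.
Qed.

Lemma sqr_dist_half (x z : R) : 0 < x -> z < x / 2 -> x ^+ 2 / 4 <= (z - x) ^+ 2.
Proof. by move=> x0 zx; nra. Qed.

Lemma staying_arith (C y x n a b b' e : R) : 0 < C -> 0 < y -> y <= x ->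
  n <= (8 * C)^-1 * y ^+ 2 -> x ^+ 2 / 4 * b' <= n * (C * a) -> a = b + b' -> b <= e ->
  0 <= a -> a <= 2 * e.
Proof.
move=> C0 y0 yx ny h ab be a0.
have h2 : n * C <= x ^+ 2 / 8.
  have : n * C <= y ^+ 2 / 8.
    by rewrite (le_trans (ler_wpM2r (ltW C0) ny))// invfM; rewrite le_eqVlt; apply/orP; left; apply/eqP; field; rewrite lt0r_neq0.
  have : y ^+ 2 <= x ^+ 2 by rewrite lerXn2r ?nnegrE//; lra.
  by lra.
have x20 : 0 < x ^+ 2 by rewrite exprn_gt0//; lra.
have h3 : n * (C * a) <= x ^+ 2 / 8 * a by rewrite mulrA ler_wpM2r.
have h4 : b' <= a / 2.
  have : x ^+ 2 * b' <= x ^+ 2 * (a / 2) by lra.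
  by rewrite ler_pM2l.
by lra.
Qed.

Lemma sojourn_arith (k n a ad an ag ac : R) : 0 < k -> n * ad <= k * a -> 2 * k <= n ->
  a = ad + an -> a = ag + ac -> an <= 2 * ag -> 0 <= ad -> 0 <= a -> ac <= 3 / 4 * a.
Proof.
move=> k0 h1 h2 h3 h4 h5 ad0 a0.
have : ad <= a / 2.
  have : 2 * k * ad <= k * a by apply: le_trans h1; rewrite ler_wpM2r.
  by rewrite (_ : k * a = 2 * k * (a / 2)); [rewrite ler_pM2l ?mulr_gt0|field].
lra.
Qed.

End arithmetic.

Section path_estimates.
Context {d : measure_display} {T : measurableType d} {R : realType}.
Variables (P : probability T R) (S : set R) (F : nat -> set (set T)) (X : nat -> T -> R).
Variables (c s2 p : R).
Hypotheses (hA0 : A0 P S F X) (hA1 : A1 P S F X) (hA2 : A2 P F X c s2)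
  (hMp : Mp P F X p) (p_gt2 : 2 < p).
Implicit Types (t n : nat) (A B : set T) (x y z q u : R).
Local Notation pr A := (fine (P A)).
Local Notation below y := [set z : R | (z < y)%R].
Local Notation between a b := [set z : R | (a <= z < b)%R].

Let s20 : 0 < s2. Proof. by case: hA2. Qed.

Lemma occupation_lower q u (b : R) : 2 <= q -> 0 < u <= 1 -> 0 <= c + (q - 1) * s2 / 2 ->
  exists x0, [/\ expR 2 <= x0, b <= x0 & forall y t0 A n, x0 <= y -> (0 < t0)%N -> F t0 A ->
  (\sum_(j < n) \int[P]_(w in A `&` stopped X t0 (below y) j @^-1` (between x0 y))
      (u * s2 / 4 * mlog (q - 2) (u - 1) (stopped X t0 (below y) j w))%:E
    <= (mlog q u (2 * y) * pr A)%:E)%E].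
Proof.
move=> q2 u01 hq; have /andP[u0 u1] := u01.
have [x0 [ex0 bx0 hx0]] := drift_lower hA0 hA2 hMp p_gt2 b q2 u01 hq.
exists x0; split => // y t0 A n x0y t00 FA.
have mA := F_measurable hA0 t00 FA.
set f := (fun z => mlog q u (2 * y) - mlog q u (clamp x0 (2 * y) z)) in hx0.
have e1x0 : expR 1 <= x0 by rewrite (le_trans _ ex0)// ler_expR ler1n.
have y2 : x0 <= 2 * y.
  by rewrite (le_trans x0y)// ler_peMl ?ler1n// (le_trans _ x0y)// (le_trans _ ex0)// expR_ge0.
have q1 : 1 <= q by rewrite (le_trans _ q2)// ler1n.
have f0 z : 0 <= f z.
  rewrite subr_ge0 mlog_homo//.
  - by rewrite ger0_norm// ltW.
  - by rewrite /clamp le_min (le_trans e1x0 y2) le_max e1x0 orbT.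
  - by rewrite /clamp ge_min lexx orbT.
have u40 : 0 <= u * s2 / 4 by rewrite divr_ge0// mulr_ge0// ltW.
have aa z : 0 <= u * s2 / 4 * mlog (q - 2) (u - 1) z by rewrite mulr_ge0// mlog_ge0.
pose a z := if x0 <= z then u * s2 / 4 * mlog (q - 2) (u - 1) z else 0.
have a0 z : 0 <= a z by rewrite /a; case: ifP.
have := @drift_stopped _ _ _ P S F X hA0 t0 (below y) t00 f a (fun => 0) A n
  (fun z _ => f0 z) (fun z _ _ => a0 z) (fun _ _ _ => lexx 0) (hx0 y x0y) FA.
set W := stopped X t0 _ => H.
have mW j (B : set R) : measurable (A `&` W j @^-1` B) by exact: (measurable_occ hA0).
apply: (@le_trans _ _ (\sum_(j < n) \int[P]_(w in A `&` W j @^-1` (below y)) (a (W j w))%:E)%E).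
  apply: lee_sum => j _.
  set A1 := A `&` _; set A2 := A `&` _.
  have A12 : A1 `<=` A2 by move=> w [Aw /= /andP[_ h]]; split.
  apply: (@le_trans _ _ (\int[P]_(w in A1) (a (W j w))%:E)%E).
    rewrite le_eqVlt; apply/orP; left; apply/eqP; apply: eq_integral => w.
    by rewrite inE => -[_ /= /andP[h _]]; rewrite /a h.
  apply: ge0_subset_integral => //; first exact: mW.
  - exact: mW.
  - exact: (@measurable_fun_stopped _ _ _ P S F X hA0 t0 (below y) t00 j _ _ (fun z => (a z)%:E)).
  - by move=> w _; rewrite lee_fin.
have H2 : (\sum_(j < n) \int[P]_(w in A `&` W j @^-1` (below y)) (a (W j w))%:E
     <= \int[P]_(w in A) (f (X t0 w))%:E)%E.
  apply: (le_trans _ (le_trans H _)).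
    by rewrite leeDr// integral_ge0// => w _; rewrite lee_fin.
  by rewrite big1 ?adde0// => j _; rewrite integral0.
apply: (le_trans H2).
apply: (@le_trans _ _ (\int[P]_(w in A) (mlog q u (2 * y))%:E)%E).
  apply: ge0_le_integral => //.
  - by move=> w _; rewrite lee_fin.
  - exact: (measurable_fun_X hA0 (fun z => (f z)%:E)).
  - by move=> w _; rewrite lee_fin gerBl mlog_ge0.
by rewrite [leRHS]EFinM -prE// -integral_cst.
Qed.

Lemma hitting_time q u (b : R) : 2 <= q -> 0 < u <= 1 -> 0 <= c + (q - 1) * s2 / 2 ->
  (forall x, b <= x -> 1 <= mlog (q - 2) (u - 1) x) ->
  exists K b' : R, [/\ 0 < K, expR 2 <= b' & forall y t0 A n, b' <= y -> (0 < t0)%N -> F t0 A ->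
    n%:R * pr (A `&` stopped X t0 (below y) n @^-1` (below y))
      <= K * mlog q u (2 * y) * pr A].
Proof.
move=> q2 u01 hq hb; have /andP[u0 u1] := u01.
have [x0 [ex0 bx0 hx0]] := occupation_lower b q2 u01 hq.
have [y0 Sy0 x0y0] : exists2 y0, S y0 & x0 < y0 by case: hA0 => -[].
have [M [phi [phi0 hM]]] := irreducible_below hA0 x0 hA1 Sy0.
pose k := u * s2 / 4.
have k0 : 0 < k by rewrite divr_gt0// mulr_gt0.
pose M1 := \sum_(i < M.+1) (k^-1 + i%:R).
have M10 : 0 <= M1.
  by rewrite sumr_ge0// => i _; rewrite addr_ge0// invr_ge0 ltW.
have K0 : 0 < k^-1 + phi^-1 * M1.
  by rewrite ltr_pwDl ?invr_gt0// mulr_ge0// invr_ge0 ltW.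
have ey0 : expR 2 <= y0 + 1 by rewrite (le_trans ex0)// (le_trans (ltW x0y0))// lerDl.
exists (k^-1 + phi^-1 * M1), (y0 + 1); split => // y t0 A n y0y t00 FA.
have mA := F_measurable hA0 t00 FA.
have y0y' : y0 < y by rewrite (lt_le_trans _ y0y)// ltrDl.
have x0y : x0 <= y by rewrite (le_trans (ltW x0y0))// ltW.
set D := (below y); set W := stopped X t0 D.
have mW j (B : set R) : measurable (A `&` W j @^-1` B) by exact: (measurable_occ hA0).
set G := mlog q u (2 * y).
have G1 : 1 <= G.
  have ey : expR 1 <= 2 * y.
    rewrite (le_trans _ (_ : expR 2 <= _))// ?ler_expR ?ler1n//.
    rewrite (le_trans ey0)// (le_trans y0y)// ler_peMl ?ler1n//.
    by rewrite (le_trans _ y0y)// (le_trans _ ey0)// expR_ge0.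
  have l1 := ln_ge1 ey.
  rewrite /G /mlog; apply: mulr_ege1.
    apply: (@le_trans _ _ ((2 * y) `^ 0)); first by rewrite powRr0.
    rewrite ler_powR ?(le_trans _ q2)//.
    by rewrite (le_trans _ ey)// -expR0 ler_expR.
  apply: (@le_trans _ _ (ln (2 * y) `^ 0)); first by rewrite powRr0.
  by rewrite ler_powR// ltW.
have up m : \sum_(j < m) pr (A `&` W j @^-1` (between x0 y)) <= k^-1 * (G * pr A).
  rewrite mulrC ler_pdivlMr// mulrC mulr_sumr -lee_fin -sumEFin.
  apply: le_trans (hx0 y t0 A m x0y t00 FA); apply: lee_sum => j _.
  rewrite EFinM -prE// -integral_cst//; apply: ge0_le_integral => //.
  - by move=> w _; rewrite lee_fin ltW.
  - exact: (@measurable_fun_stopped _ _ _ P S F X hA0 t0 (below y) t00 j _ _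
      (fun z => (u * s2 / 4 * mlog (q - 2) (u - 1) z)%:E)).
  - move=> w [_ /= /andP[h _]]; rewrite lee_fin -/k ler_peMr ?(ltW k0)//.
    by rewrite hb// (le_trans bx0).
have prA := pr_ge0 P A.
have below m : \sum_(j < m) pr (A `&` W j @^-1` (D `&` [set x | x < x0])) <= phi^-1 * (M1 * (G * pr A)).
  rewrite [leRHS]mulrC ler_pdivlMr// mulrC.
  apply: (le_trans (@time_below _ _ _ P S F X hA0 t0 D t00 M phi x0 y0 A m hM FA)).
  rewrite -big_split/= /M1 mulr_suml; apply: ler_sum => i _.
  rewrite mulrDl; apply: lerD; last by rewrite ler_wpM2l// ler_peMl.
  apply: le_trans (up (m + i)%N).
  rewrite -[leRHS](big_mkord xpredT (fun j => pr (A `&` W j @^-1` (between x0 y)))).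
  rewrite [leRHS](@big_cat_nat _ _ _ i)//= ?leq_addl//.
  rewrite (sum_shift (fun j => pr (A `&` W j @^-1` (between x0 y)))).
  apply: (@le_trans _ _ (\sum_(j < m) pr (A `&` W (j + i)%N @^-1` (between x0 y)))).
    apply: ler_sum => j _; apply: pr_le => //.
      by apply: measurableI => //; exact: (measurable_stopped hA0).
    move=> w [[Aw Dj] [/= Dji yji]]; split => //.
    by rewrite /= /W (yji : stopped X t0 D (j + i) w = y0) (ltW x0y0)/= y0y'.
  by rewrite lerDr sumr_ge0// => j _; exact: pr_ge0.
have tot : \sum_(j < n) pr (A `&` W j @^-1` D) <= (k^-1 + phi^-1 * M1) * G * pr A.
  have -> : (k^-1 + phi^-1 * M1) * G * pr A = k^-1 * (G * pr A) + phi^-1 * (M1 * (G * pr A)) by ring.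
  apply: le_trans (lerD (up n) (below n)); rewrite -big_split/=; apply: ler_sum => j _.
  apply: le_trans (prU_le _ (mW _ _) (mW _ _)); apply: pr_le => //; first exact: measurableU.
  move=> w [Aw Dw]; have [xw|xw] := leP x0 (W j w); [left|right]; split => //=.
  by rewrite xw.
apply: le_trans tot.
apply: (@le_trans _ _ (\sum_(j < n) pr (A `&` W n @^-1` D))).
  by rewrite sumr_const card_ord mulr_natl.
apply: ler_sum => j _; apply: pr_le => // w [Aw Dw]; split => //.
by apply: (@stopped_outW _ _ _ X t0 D j n) => //; exact: ltnW.
Qed.

Lemma quadratic_drift : exists C b : R, [/\ 0 < C, expR 2 <= b & forall x, 2 * b <= x ->
  drift_le P S F X [set z | x / 2 <= z] (fun z => (z - x) ^+ 2) (fun=> 0) (fun=> C)].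
Proof.
have [dl [C0 [dl0 dl1 C00 hlaw]]] := local_law hA0 hA2 hMp p_gt2.
have [x1 hx1] := hlaw 1 ltr01.
pose C := 2 * (`|c| + 1) + s2 + 1.
have Cgt0 : 0 < C by rewrite addr_gt0// addr_gt0// mulr_gt0// ltr_pwDr.
exists C, (Num.max (expR 2) x1); split => //; first by rewrite le_max lexx.
move=> x bx t x' A t0 Sx' /= xx' FA Ax.
have mA := F_measurable hA0 t0 FA.
rewrite mul0e adde0.
have [PA0|PA0] := eqVneq (pr A) 0.
  rewrite (integral_null mA PA0).
    by rewrite prE// PA0 mule0.
  exact: (measurable_fun_X hA0 (fun z => ((z - x) ^+ 2)%:E)).
have {}PA0 : 0 < pr A by rewrite lt0r PA0 pr_ge0.
have [D1 [D2 [Dp [hD Dp0 hDp hg]]]] := hx1 t x' A t0 Sx' FA Ax PA0.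
have bx' : Num.max (expR 2) x1 <= x'.
  by apply: le_trans xx'; rewrite ler_pdivlMr// mulrC.
move: bx'; rewrite ge_max => /andP[ex' x1x'].
have [hD1 hD2] := hD x1x'.
apply: (le_trans (hg (fun z => (z - x) ^+ 2) ((x' - x) ^+ 2) (2 * (x' - x)) 1 0 _ _)).
- by move=> z _; rewrite sqr_ge0.
- by move=> z _; rewrite mul0r addr0 le_eqVlt; apply/orP; left; apply/eqP; ring.
apply: lee_wpmul2r => //; rewrite lee_fin mul0r addr0 mul1r -addrA lerD2l.
apply: quadratic_drift_arith hD1 hD2 => //.
by rewrite (le_trans _ bx)// mulr_ge0// le_max expR_ge0.
Qed.

Lemma staying : exists e b : R, [/\ 0 < e, expR 2 <= b & forall y t0 A n, b <= y ->
  (0 < t0)%N -> F t0 A -> A `<=` X t0 @^-1` [set z | y <= z] -> n%:R <= e * y ^+ 2 ->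
  pr A <= 2 * pr (A `&` [set w | forall j, (j <= n)%N -> y / 2 <= X (t0 + j)%N w])].
Proof.
have [C [b [C0 eb hb]]] := quadratic_drift.
have b0 : 0 <= b by rewrite (le_trans _ eb)// expR_ge0.
exists (8 * C)^-1, (2 * b); split.
- by rewrite invr_gt0 mulr_gt0.
- by rewrite (le_trans eb)// ler_peMl// ler1n.
move=> y t0 A n by_ t00 FA Ay ny.
have mA := F_measurable hA0 t00 FA.
pose E := [set w | forall j, (j <= n)%N -> y / 2 <= X (t0 + j)%N w].
have mE : measurable E.
  have -> : E = \bigcap_(j in [set j | (j <= n)%N]) (X (t0 + j)%N @^-1` [set z | y / 2 <= z]).
    by apply/seteqP; split=> w h j /=; apply: h.
  apply: bigcap_measurable; [by exists 0%N|move=> j _].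
  by apply: (measurable_X hA0); rewrite addn_gt0 t00.
have intE B : measurable B -> (\int[P]_(w in B) (2 * \1_E w)%:E = (2 * pr (B `&` E))%:E)%E.
  move=> mB; under eq_integral do rewrite EFinM.
  rewrite ge0_integralZl//; last exact/measurable_EFinP/measurable_indic.
  rewrite integral_indic// setIC EFinM -prE//; exact: measurableI.
rewrite -lee_fin -intE// -prE// -[leLHS]mul1e -integral_cst//.
apply: (le_integral_loc hA0 t00 FA) => //.
- apply/measurable_EFinP; apply: measurable_funM => //; exact: measurable_indic.
move=> x Sx; set A' := A `&` _.
have FA' : F t0 A' by apply: (F_setI hA0) => //; exact: (F_X hA0).
have mA' := F_measurable hA0 t00 FA'.
have int1 : (\int[P]_(w in A') cst 1%E w = (pr A')%:E)%E.
  by rewrite integral_cst// mul1e; exact: prE.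
rewrite intE// int1 lee_fin.
have [yx|xy] := leP y x; last first.
  have -> : A' = set0.
    by apply/seteqP; split=> // w [/Ay/= h1 h2]; move: h1; rewrite (h2 : X t0 w = x) leNgt xy.
  by rewrite measure0/= mulr_ge0// pr_ge0.
have y0 : 0 < y by rewrite (lt_le_trans _ by_)// (lt_le_trans _ (_ : expR 2 <= _)) ?expR_gt0//
  (le_trans eb)// ler_peMl// ler1n.
have x0 : 0 < x by exact: lt_le_trans yx.
set D := [set z | x / 2 <= z]; set W := stopped X t0 D.
have bx : 2 * b <= x by exact: le_trans yx.
have := @drift_stopped _ _ _ P S F X hA0 t0 D t00 (fun z => (z - x) ^+ 2) (fun=> 0) (fun=> C) A' n
  (fun z _ => sqr_ge0 _) (fun _ _ _ => lexx 0) (fun _ _ _ => ltW C0) (hb x bx) FA'.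
rewrite -/W [X in (_ + X <= _)%E]big1 ?adde0; last by move=> j _; rewrite integral0.
rewrite [X in (_ <= X + _)%E](_ : _ = 0%E) ?add0e; last first.
  rewrite -[RHS](integral0 P A'); apply: eq_integral => w; rewrite inE => -[_ /= ->].
  by rewrite subrr expr0n.
have mW (B : set R) j : measurable (A' `&` W j @^-1` B) by exact: (measurable_occ hA0).
move=> H.
have H1 : ((x ^+ 2 / 4 * pr (A' `&` W n @^-1` (~` D)))%:E <= (n%:R * (C * pr A'))%:E)%E.
  apply: (le_trans _ (le_trans H _)).
    rewrite EFinM -prE// -integral_cst//.
    apply: (@le_trans _ _ (\int[P]_(w in A' `&` W n @^-1` (~` D)) ((W n w - x) ^+ 2)%:E)%E).
      apply: ge0_le_integral => //.
      - by move=> w _; rewrite lee_fin divr_ge0// sqr_ge0.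
      - exact: (@measurable_fun_stopped _ _ _ P S F X hA0 t0 D t00 n _ _ (fun z => ((z - x) ^+ 2)%:E)).
      - move=> w [_ /= /negP]; rewrite -ltNge => h; rewrite lee_fin.
        exact: sqr_dist_half.
    apply: ge0_subset_integral => //.
    - exact: (@measurable_fun_stopped _ _ _ P S F X hA0 t0 D t00 n _ _ (fun z => ((z - x) ^+ 2)%:E)).
    - by move=> w _; rewrite lee_fin sqr_ge0.
  have -> : (n%:R * (C * pr A'))%:E = (\sum_(j < n) (C * pr A')%:E)%E.
    by rewrite sumEFin sumr_const card_ord mulr_natl.
  apply: lee_sum => j _; rewrite integral_cst// EFinM -[(pr A')%:E]prE//.
  by apply: lee_wpmul2l; rewrite ?lee_fin ?(ltW C0)// le_measure ?inE//; exact: mW.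
rewrite lee_fin in H1.
have split' : pr A' = pr (A' `&` W n @^-1` D) + pr (A' `&` W n @^-1` (~` D)).
  by rewrite (pr_splitC P mA' (@measurable_stopped _ _ _ P S F X hA0 t0 D t00 n D)).
have stay : pr (A' `&` W n @^-1` D) <= pr (A' `&` E).
  apply: pr_le => //; first exact: measurableI.
  move=> w [A'w Dw]; split => // j jn; have [_ /(_ j jn)] := stopped_in Dw.
  by apply: le_trans; rewrite ler_pM2r.
by apply: staying_arith C0 y0 yx ny H1 split' stay (pr_ge0 _ _).
Qed.

Lemma F_forall t0 n (B : set R) : (0 < t0)%N ->
  F (t0 + n)%N [set w | forall j, (j <= n)%N -> B (X (t0 + j)%N w)].
Proof.
move=> t00.
have h m : (m <= n)%N -> F (t0 + n)%N [set w | forall j, (j <= m)%N -> B (X (t0 + j)%N w)].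
  elim: m => [|m IH] mn.
    have -> : [set w | forall j, (j <= 0)%N -> B (X (t0 + j)%N w)] = X t0 @^-1` B.
      apply/seteqP; split=> w /=; first by move=> /(_ 0%N isT); rewrite addn0.
      by move=> h j; rewrite leqn0 => /eqP ->; rewrite addn0.
    by apply: (F_mono hA0) (F_X hA0 B t00); rewrite ?leq_addr.
  have -> : [set w | forall j, (j <= m.+1)%N -> B (X (t0 + j)%N w)] =
     [set w | forall j, (j <= m)%N -> B (X (t0 + j)%N w)] `&` X (t0 + m.+1)%N @^-1` B.
    apply/seteqP; split=> w /=.
      by move=> h; split; [move=> j jm; apply: h; rewrite (leq_trans jm)|exact: h].
    by move=> [h1 h2] j; rewrite leq_eqVlt => /orP[/eqP -> //|]; exact: h1.
  have tn : (0 < t0 + n)%N by rewrite addn_gt0 t00.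
  apply: (F_setI hA0) => //; first exact: IH (ltnW mn).
  by apply: (F_mono hA0) (F_X hA0 B _); rewrite ?addn_gt0 ?t00 ?leq_add2l.
exact: h.
Qed.

Definition sojourn t0 n1 n2 y := [set w | exists j, (j <= n1)%N /\
  forall i, (i <= n2)%N -> y / 2 <= X (t0 + j + i)%N w].

Lemma F_sojourn t0 n1 n2 y : (0 < t0)%N -> F (t0 + n1 + n2)%N (sojourn t0 n1 n2 y).
Proof.
move=> t00; have tn : (0 < t0 + n1 + n2)%N by rewrite -addnA addn_gt0 t00.
have -> : sojourn t0 n1 n2 y = \bigcup_j (if (j <= n1)%N then
    [set w | forall i, (i <= n2)%N -> y / 2 <= X (t0 + j + i)%N w] else set0).
  apply/seteqP; split=> w /=.
    by move=> [j [jn h]]; exists j => //; rewrite jn.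
  by move=> [j _]; case: ifP => // jn h; exists j.
apply: (F_bigcup hA0) => // j; case: ifP => jn; last exact: (F_set0 hA0).
apply: (F_mono hA0) (@F_forall (t0 + j) n2 [set z | y / 2 <= z] _).
- by rewrite -addnA addn_gt0 t00.
- by rewrite -!addnA leq_add2l leq_add2r.
- by rewrite addn_gt0 t00.
Qed.

Lemma sojourn_prob q u (b : R) : 2 <= q -> 0 < u <= 1 -> 0 <= c + (q - 1) * s2 / 2 ->
  (forall x, b <= x -> 1 <= mlog (q - 2) (u - 1) x) ->
  exists K e b' : R, [/\ 0 < K, 0 < e, expR 2 <= b' & forall y t0 A n1 n2, b' <= y -> (0 < t0)%N ->
    F t0 A -> K * mlog q u (2 * y) <= n1%:R -> n2%:R <= e * y ^+ 2 ->
    pr (A `&` ~` sojourn t0 n1 n2 y) <= 3 / 4 * pr A].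
Proof.
move=> q2 u01 hq hb.
have [K [b1 [K0 eb1 hK]]] := hitting_time q2 u01 hq hb.
have [e [b2 [e0 eb2 he]]] := staying.
exists (2 * K), e, (Num.max b1 b2); split => //.
- by rewrite mulr_gt0.
- by rewrite le_max eb1.
move=> y t0 A n1 n2; rewrite ge_max => /andP[b1y b2y] t00 FA hn1 hn2.
have mA := F_measurable hA0 t00 FA.
set G := sojourn t0 n1 n2 y.
have mG : measurable G.
  by apply: (F_measurable hA0 _ (F_sojourn n1 n2 y t00)); rewrite -addnA addn_gt0 t00.
have H1 := hK y t0 A n1 b1y t00 FA.
set D := (below y) in H1; set W := stopped X t0 D in H1.
have mW (B : set R) j : measurable (A `&` W j @^-1` B) by exact: (measurable_occ hA0).
pose H j := A `&` [set w | (forall i, (i < j)%N -> X (t0 + i)%N w < y) /\ y <= X (t0 + j)%N w].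
have FH j : F (t0 + j)%N (H j).
  have tj : (0 < t0 + j)%N by rewrite addn_gt0 t00.
  apply: (F_setI hA0) => //; first by apply: (F_mono hA0) FA; rewrite ?leq_addr.
  have -> : [set w | (forall i, (i < j)%N -> X (t0 + i)%N w < y) /\ y <= X (t0 + j)%N w] =
     [set w | forall i, (i < j)%N -> X (t0 + i)%N w < y] `&` X (t0 + j)%N @^-1` [set z | y <= z].
    by apply/seteqP; split.
  apply: (F_setI hA0) => //; last exact: (F_X hA0).
  case: j tj => [|j] tj.
    rewrite [X in F _ X](_ : _ = setT); first exact: (F_setT hA0).
    by apply/seteqP; split.
  apply: (F_mono hA0) (@F_forall t0 j [set z | z < y] t00); rewrite ?addn_gt0 ?t00//.
  by rewrite leq_add2l.
have mH j : measurable (H j) by apply: (F_measurable hA0 _ (FH j)); rewrite addn_gt0 t00.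
pose St j := [set w | forall i, (i <= n2)%N -> y / 2 <= X (t0 + j + i)%N w].
have mSt j : measurable (St j).
  have tj : (0 < t0 + j)%N by rewrite addn_gt0 t00.
  apply: (F_measurable hA0 _ (@F_forall (t0 + j)%N n2 [set z | y / 2 <= z] tj)).
  by rewrite addn_gt0 tj.
have hSt j : pr (H j) <= 2 * pr (H j `&` St j).
  by apply: (he y (t0 + j)%N) => //; [rewrite addn_gt0 t00|move=> w [_ []]].
have tH : trivIset setT H.
  apply/trivIsetP => i j _ _.
  wlog ij : i j / (i < j)%N.
    move=> hw; rewrite neq_ltn => /orP[ij|ij]; first by apply: hw => //; rewrite neq_ltn ij.
    by rewrite setIC; apply: hw => //; rewrite neq_ltn ij.
  move=> _; apply/seteqP; split=> // w [[_ [_ h1]] [_ [/(_ i ij) + _]]].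
  by rewrite ltNge h1.
have tHS : trivIset setT (fun j => H j `&` St j).
  apply/trivIsetP => i j ii jj ij; move/trivIsetP : tH => /(_ i j ii jj ij) HH.
  by apply/seteqP; split=> // w [[h1 _] [h2 _]]; rewrite -HH; split.
have prsum (E : nat -> set T) n : (forall j, measurable (E j)) -> trivIset setT E ->
    pr (\big[setU/set0]_(j < n) E j) = \sum_(j < n) pr (E j).
  move=> mE tE; apply: EFin_inj; rewrite -prE; last exact: bigsetU_measurable.
  rewrite -sumEFin measure_semi_additive_ord//; last exact: bigsetU_measurable.
    by apply: eq_bigr => j _; rewrite -prE.
  by apply/trivIsetP => i j _ _ ij; move/trivIsetP : tE => /(_ i j); apply.
have up : pr (A `&` W n1 @^-1` (~` D)) <= 2 * pr (A `&` G).
  apply: (@le_trans _ _ (pr (\big[setU/set0]_(j < n1.+1) H j))).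
    apply: pr_le => //; first exact: bigsetU_measurable.
    move=> w [Aw Dw]; have [j [jn e1 h]] := stopped_out Dw.
    rewrite -bigcup_mkord; exists j => //=; split => //; split => //.
    by rewrite -e1 leNgt; apply/negP.
  rewrite prsum//; apply: (@le_trans _ _ (\sum_(j < n1.+1) 2 * pr (H j `&` St j))).
    by apply: ler_sum => j _; exact: hSt.
  rewrite -mulr_sumr ler_pM2l// -(prsum (fun j => H j `&` St j))//; last first.
    by move=> j; exact: measurableI.
  apply: pr_le; [|exact: measurableI|].
    by apply: bigsetU_measurable => j _; exact: measurableI.
  rewrite -(bigcup_mkord _ (fun j => H j `&` St j)) => w [j /= jn [[Aw _] Stw]]; split => //.
  by exists j; split.
have split1 : pr A = pr (A `&` W n1 @^-1` D) + pr (A `&` W n1 @^-1` (~` D)).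
  by rewrite (pr_splitC P mA (@measurable_stopped _ _ _ P S F X hA0 t0 D t00 n1 D)).
have split2 := pr_splitC P mA mG.
have M0 : 0 < mlog q u (2 * y).
  have ey : expR 2 <= y by exact: le_trans b1y.
  have y1 : 1 < 2 * y.
    rewrite (lt_le_trans (_ : 1 < expR 2))//; first by rewrite -expR0 ltr_expR.
    by rewrite (le_trans ey)// ler_peMl ?ler1n// (le_trans _ ey)// expR_ge0.
  by rewrite mulr_gt0 ?powR_gt0 ?ln_gt0// (lt_trans _ y1).
apply: sojourn_arith (mulr_gt0 K0 M0) H1 _ split1 split2 up (pr_ge0 P _) (pr_ge0 P _).
by rewrite mulrA.
Qed.

End path_estimates.

(** * Almost sure lower bound *)

Section borel_cantelli.
Context {d : measure_display} {T : measurableType d} {R : realType}.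
Variable (P : probability T R).

Lemma borel_cantelli (E : nat -> set T) (a : nat -> R) (k0 : nat) (B : R) :
  (forall n, measurable (E n)) -> (forall n, 0 <= a n) ->
  (forall n, (k0 <= n)%N -> fine (P (E n)) <= a n) ->
  (forall n, \sum_(i < n) a i <= B) ->
  {ae P, forall w, exists k, forall n, (k <= n)%N -> ~ E n w}.
Proof.
move=> mE a0 Ea aB.
pose E' n := if (k0 <= n)%N then E n else set0.
have mE' n : measurable (E' n) by rewrite /E'; case: ifP.
have h : (\sum_(0 <= n <oo) P (E' n) < +oo)%E.
  apply: (@le_lt_trans _ _ B%:E); last exact: ltry.
  apply: lime_le; first by apply: is_cvg_nneseries.
  apply: nearW => n; rewrite big_mkord (le_trans (lee_sum _ (fun (i : 'I_n) _ => _ : _ <= (a i)%:E)%E))//.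
    move=> /= i; rewrite /E'; case: ifPn => [ki|_]; last by rewrite measure0 lee_fin.
    by rewrite -[P (E i)]fineK ?fin_num_measure// lee_fin Ea.
  by rewrite sumEFin lee_fin; exact: aB.
have h0 := lim_sup_set_cvg0 mE' h.
exists (lim_sup_set E'); split => //.
  apply: bigcapT_measurable => n; apply: bigcup_measurable => j _; exact: mE'.
move=> w /= hw; rewrite /lim_sup_set => n _.
apply: contrapT => nE; apply: hw; exists (maxn n k0) => j.
rewrite geq_max => /andP[nj kj] Ej; apply: nE; exists j => //=.
by rewrite /E' kj.
Qed.

Lemma pseries_bound (e : R) : 0 < e ->
  exists B, forall n, \sum_(i < n) (i.+1%:R `^ (- (1 + e)) : R) <= B.
Proof.
move=> e0; exists (1 + e^-1).
have step (i : nat) : (0 < i)%N ->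
    i.+1%:R `^ (- (1 + e)) <= e^-1 * (i%:R `^ (- e) - i.+1%:R `^ (- e)) :> R.
  move=> i0; have i0' : 0 < i%:R :> R by rewrite ltr0n.
  have ii : i%:R <= i.+1%:R :> R by rewrite ler_nat.
  have D (x : R) : i%:R <= x -> is_derive x 1 (fun x => x `^ (- e)) (- e * x `^ (- e - 1)).
    by move=> ix; apply: is_derive1_powR; rewrite (lt_le_trans i0').
  have [||z zi h] := @MVT_segment _ (fun x : R => x `^ (- e)) (fun x => - e * x `^ (- e - 1)) _ _ ii.
  - by move=> z; rewrite in_itv/= => /andP[/ltW xz _]; apply: D.
  - apply: derivable_within_continuous => z; rewrite in_itv/= => /andP[xz _].
    by have hD := D z xz; apply: ex_derive.
  rewrite -opprB h -natrB// subSnn mulr1 mulNr opprK mulKf ?lt0r_neq0//.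
  have -> : - e - 1 = - (1 + e) by ring.
  move: zi; rewrite in_itv/= => /andP[iz zi].
  have z0 : 0 < z by exact: lt_le_trans iz.
  rewrite !powRN lef_pV2 ?posrE ?powR_gt0// ?ltr0n//.
  by rewrite ge0_ler_powR ?nnegrE ?addr_ge0 ?(ltW e0) ?(ltW z0).
have main n : \sum_(i < n.+1) (i.+1%:R `^ (- (1 + e)) : R) <= 1 + e^-1 * (1 - n.+1%:R `^ (- e)).
  elim: n => [|n IH]; first by rewrite big_ord_recl big_ord0 addr0 !powR1 subrr mulr0 addr0.
  rewrite big_ord_recr/= (le_trans (lerD IH (step n.+1 _)))// -addrA -mulrDr.
  by rewrite addrA subrK.
move=> [|n]; first by rewrite big_ord0 addr_ge0// invr_ge0 ltW.
apply: (le_trans (main n)); rewrite lerD2l ler_piMr ?invr_ge0 ?(ltW e0)//.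
Qed.

End borel_cantelli.

Section scales.
Context {R : realType}.

Lemma ln2_bounds : 2^-1 <= ln (2 : R) <= 1.
Proof.
apply/andP; split.
  have : ln (1 + - 2^-1) <= - 2^-1 :> R by apply: le_ln1Dx; rewrite ltrN2 invf_lt1// ltr1n.
  have -> : 1 + - 2^-1 = 2^-1 :> R by lra.
  by rewrite lnV ?posrE// lerN2.
rewrite -[leRHS](expRK 1) ler_ln ?posrE ?expR_gt0//; exact: expR1_ge2.
Qed.

Lemma ln_pow2 (k : nat) : k%:R / 2 <= ln (2 ^+ k : R) <= k%:R.
Proof.
rewrite lnXn// -[ln 2 *+ k]mulr_natl; have /andP[h1 h2] := ln2_bounds.
by rewrite ler_wpM2l//= ler_piMr.
Qed.

Lemma scale_growth (a : R) (h M : R) : 0 < h -> exists k0 : nat, forall k, (k0 <= k)%N ->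
  M * ln (2 ^+ k : R) `^ a <= (2 ^+ k) `^ h /\ M <= 2 ^+ k.
Proof.
move=> h0; pose M' := Num.max M 1.
have M'0 : 0 < M' by rewrite lt_max ltr01 orbT.
have [b hb] := @ln_powR_le R a h M'^-1 h0 ltac:(by rewrite invr_gt0).
have ex : exists k0 : nat, Num.max b M <= k0%:R.
  exists (Num.truncn (Num.max b M)).+1; apply/ltW; exact: truncnS_gt.
have [k0 hk0] := ex; exists k0 => k kk0.
have k2 : k0%:R <= 2 ^+ k :> R.
  rewrite -natrX ler_nat (leq_trans kk0)// ltnW// ltn_expl//.
move: (le_trans hk0 k2); rewrite ge_max => /andP[bk Mk]; split => //.
have := hb _ bk; rewrite mulrC ler_pdivlMr// mulrC; apply: le_trans.
by rewrite ler_wpM2r ?powR_ge0// le_max lexx.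
Qed.

Lemma lower_scales (q u K e b' alpha : R) : 2 <= q -> 0 < u <= 1 -> 0 < K -> 0 < e -> 0 <= alpha ->
  exists (C0 : R) (k0 : nat), 0 < C0 /\ forall k, (k0 <= k)%N -> exists (y : R) (n1 n2 : nat),
    [/\ b' <= y, K * mlog q u (2 * y) <= n1%:R, n2%:R <= e * y ^+ 2,
     (k * (n1 + n2) + 1 <= 2 ^ k)%N &
     C0 * (2 ^+ k / ln (2 ^+ k) `^ (1 + u)) `^ ((alpha + 2) / q) <= n2.+1%:R * (y / 2) `^ alpha].
Proof.
move=> q2 /andP[u0 u1] K0 e0 a0.
have q0 : 0 < q by lra.
pose kap := (4 * (K * 2 `^ q + e) + 1)^-1.
have K2q : 0 <= K * 2 `^ q by rewrite mulr_ge0 ?powR_ge0// ltW.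
have den0 : 0 < 4 * (K * 2 `^ q + e) + 1 by lra.
have kap0 : 0 < kap by rewrite invr_gt0.
have kap1 : kap <= 1 by rewrite invf_le1//; lra.
have kapK : 4 * (K * 2 `^ q + e) * kap <= 1.
  by rewrite /kap ler_pdivrMr//; lra.
pose Y := Num.max (Num.max b' 1) 2.
pose M := Y `^ q / kap.
have Y0 : 0 < Y by rewrite lt_max ltr0n orbT.
have [k1 hk1] := @scale_growth (1 + u) 1 M ltr01.
have [k2 hk2] := @scale_growth 1 1 16 ltr01.
pose th := (alpha + 2) / q.
have th0 : 0 <= th by rewrite divr_ge0//; lra.
exists (e * 2 `^ (- alpha) * kap `^ th), (maxn (maxn k1 k2) 2); split.
  by rewrite !mulr_gt0 ?powR_gt0.
move=> k; rewrite !geq_max => /andP[/andP[/hk1[g1 _] /hk2[g2 g2']] k2'].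
set N : R := 2 ^+ k in g1 g2 g2' *.
have N0 : 0 < N by rewrite exprn_gt0.
have /andP[l1 l2] := ln_pow2 k; rewrite -/N in l1 l2.
have kge2 : 2 <= k%:R :> R by rewrite ler_nat.
have ell1 : 1 <= ln N by lra.
have ell0 : 0 < ln N by lra.
rewrite powRr1 ?(ltW N0)// in g1; rewrite !powRr1 ?(ltW N0) ?(ltW ell0)// in g2.
pose Z := kap * (N / ln N `^ (1 + u)).
have L0 : 0 < ln N `^ (1 + u) by rewrite powR_gt0.
have Z0 : 0 < Z by rewrite mulr_gt0// divr_gt0.
pose y := Z `^ q^-1.
have y0 : 0 < y by rewrite powR_gt0.
have yq : y `^ q = Z by rewrite /y -powRrM mulVf ?lt0r_neq0// powRr1// ltW.
have YZ : Y `^ q <= Z.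
  rewrite /Z mulrC mulrAC ler_pdivlMr//; move: g1; rewrite /M.
  by rewrite mulrAC ler_pdivrMr.
have Yy : Y <= y.
  rewrite leNgt; apply/negP => yY.
  have : y `^ q < Y `^ q by rewrite gt0_ltr_powR ?nnegrE ?(ltW y0) ?(ltW Y0).
  by rewrite yq ltNge YZ.
have y2 : 2 <= y by rewrite (le_trans _ Yy)// le_max lexx orbT.
have ZN : Z <= N.
  rewrite /Z -[leRHS]mul1r ler_pM ?divr_ge0 ?powR_ge0 ?(ltW N0) ?(ltW kap0)//.
  rewrite ler_pdivrMr// ler_peMr ?(ltW N0)//.
  apply: (@le_trans _ _ (ln N `^ 0)); first by rewrite powRr0.
  by rewrite ler_powR//; lra.
have y2q : y ^+ 2 <= Z.
  by rewrite -yq -powR_mulrn ?(ltW y0)// ler_powR//; lra.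
have yy : 2 * y <= N by apply: le_trans ZN; apply: le_trans y2q; nra.
have lny : ln (2 * y) <= ln N by rewrite ler_ln ?posrE// mulr_gt0.
have lny0 : 0 <= ln (2 * y) by rewrite ln_ge0//; lra.
have ZlN : Z * ln N `^ u = kap * N / ln N.
  rewrite /Z powRDp// powRr1 ?(ltW ell0)//.
  have Lu : ln N `^ u != 0 by rewrite lt0r_neq0// powR_gt0.
  by field; rewrite Lu lt0r_neq0.
have mb : K * mlog q u (2 * y) <= K * 2 `^ q * (kap * N / ln N).
  rewrite -mulrA ler_wpM2l ?(ltW K0)// -ZlN /mlog powRM ?(ltW y0)// yq.
  rewrite -mulrA ler_wpM2l ?powR_ge0// ler_wpM2l ?(ltW Z0)//.
  by rewrite ge0_ler_powR ?nnegrE ?(ltW u0) ?(ltW ell0).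
have m0 : 0 <= K * mlog q u (2 * y) by rewrite mulr_ge0 ?mlog_ge0// ltW.
pose n1 := (Num.truncn (K * mlog q u (2 * y))).+1.
pose n2 := Num.truncn (e * y ^+ 2).
have ey0 : 0 <= e * y ^+ 2 by rewrite mulr_ge0 ?sqr_ge0// ltW.
have hn2 : n2%:R <= e * y ^+ 2 by rewrite /n2 truncn_le.
have hn2' : e * y ^+ 2 <= n2.+1%:R by apply/ltW; exact: truncnS_gt.
have hn1 : n1%:R <= K * mlog q u (2 * y) + 1.
  by rewrite /n1 -addn1 natrD lerD2r truncn_le.
exists y, n1, n2; split.
- by rewrite (le_trans _ Yy)// !le_max lexx.
- by apply/ltW; rewrite /n1; exact: truncnS_gt.
- exact: hn2.
- rewrite -(@ler_nat R) natrD natrM natrX -/N natrD.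
  have Zl : Z <= kap * N / ln N.
    rewrite -ZlN ler_peMr ?(ltW Z0)//.
    apply: (@le_trans _ _ (ln N `^ 0)); first by rewrite powRr0.
    by rewrite ler_powR// ltW.
  have h1 : n1%:R + n2%:R <= (K * 2 `^ q + e) * kap * (N / ln N) + 1.
    have : e * y ^+ 2 <= e * (kap * N / ln N) by rewrite ler_wpM2l ?(ltW e0)// (le_trans y2q).
    move: mb hn1 hn2; set m := K * mlog _ _ _; set p2 := 2 `^ q.
    have -> : (K * p2 + e) * kap * (N / ln N) = K * p2 * (kap * N / ln N) + e * (kap * N / ln N) by ring.
    lra.
  have kl : k%:R <= 2 * ln N by lra.
  have h2 : k%:R * (n1%:R + n2%:R) <= 2 * ln N * ((K * 2 `^ q + e) * kap * (N / ln N) + 1).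
    by apply: ler_pM => //; rewrite addr_ge0.
  have h3 : 2 * ln N * ((K * 2 `^ q + e) * kap * (N / ln N) + 1) =
      2 * (K * 2 `^ q + e) * kap * N + 2 * ln N by field; rewrite lt0r_neq0.
  have h4 : 4 * (K * 2 `^ q + e) * kap * N <= 1 * N by rewrite ler_wpM2r// ltW.
  lra.
- have Zth : kap `^ th * (N / ln N `^ (1 + u)) `^ th = y `^ (alpha + 2).
    rewrite -powRM ?(ltW kap0) ?divr_ge0 ?(ltW N0) ?(ltW L0)// -/Z -yq -powRrM /th.
    by congr (_ `^ _); field; rewrite lt0r_neq0.
  rewrite -mulrA -/th Zth powRDp// powR_mulrn ?(ltW y0)// powR_div// ?(ltW y0)// powRN.
  have -> : e * (2 `^ alpha)^-1 * (y `^ alpha * y ^+ 2) = e * y ^+ 2 * (y `^ alpha / 2 `^ alpha) by ring.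
  by rewrite ler_wpM2r// divr_ge0 ?powR_ge0.
Qed.

Lemma geometric34 n : \sum_(i < n) (3 / 4 : R) ^+ i <= 4.
Proof.
have := subrX1 (3 / 4 : R) n; have : 0 <= (3 / 4 : R) ^+ n by rewrite exprn_ge0.
lra.
Qed.

Lemma dyadic_lower (f : nat -> R) (C0 th v e : R) (k0 : nat) : 0 < C0 -> 0 <= th -> 0 <= v -> 0 < e ->
  {homo f : m n / (m <= n)%N >-> m <= n} ->
  (forall k, (k0 <= k)%N -> C0 * (2 ^+ k / ln (2 ^+ k) `^ v) `^ th <= f (2 ^ k)%N) ->
  \forall t \near \oo, t%:R `^ th * ln t%:R `^ (- (v * th) - e) <= f t.
Proof.
move=> C00 th0 v0 e0 hf hC.
have [b hb] := @powR_ge_near R e ((C0 * 2 `^ (- th))^-1) e0.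
have [k1 hk1] : exists k1 : nat, expR (Num.max b 1) <= k1%:R.
  exists (Num.truncn (expR (Num.max b 1))).+1; apply/ltW; exact: truncnS_gt.
near=> t.
have t1 : (2 ^ k0.+1 <= t)%N by near: t; exact: nbhs_infty_ge.
have t2 : (k1 <= t)%N by near: t; exact: nbhs_infty_ge.
have t0 : (0 < t)%N by rewrite (leq_trans _ t1)// expn_gt0.
pose k := trunc_log 2 t.
have kt : (2 ^ k <= t)%N by apply: trunc_logP.
have tk : (t < 2 ^ k.+1)%N by apply: trunc_log_ltn.
have k0k : (k0 < k)%N.
  by rewrite -ltnS -(@ltn_exp2l 2)// (leq_ltn_trans t1).
apply: (le_trans _ (hf _ _ kt)); apply: (le_trans _ (hC k (ltnW k0k))).
set N : R := 2 ^+ k; set tt : R := t%:R.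
have Nt : N <= tt by rewrite /N /tt -natrX ler_nat.
have tN : tt / 2 <= N.
  by rewrite ler_pdivrMr// /N /tt mulrC -exprS -natrX ler_nat ltnW.
have lt : Num.max b 1 <= ln tt.
  rewrite -[leLHS]expRK ler_ln ?posrE ?expR_gt0// ?ltr0n//.
  by rewrite (le_trans hk1)// ler_nat.
move: lt; rewrite ge_max => /andP[bl l1].
have N1 : 1 < N by rewrite exprn_egt1// ?ltr1n// -lt0n (leq_ltn_trans _ k0k).
have tt0 : 0 < tt by rewrite ltr0n.
clearbody N tt.
have N0 : 0 < N by rewrite (lt_trans _ N1).
have lN0 : 0 < ln N by rewrite ln_gt0.
have lNt : ln N <= ln tt by rewrite ler_ln ?posrE.
have ltt0 : 0 < ln tt by rewrite (lt_le_trans _ l1).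
apply: (@le_trans _ _ (C0 * (tt / 2 / ln tt `^ v) `^ th)); last first.
  have a0 : 0 <= tt / 2 by apply: divr_ge0; [exact: ltW|].
  have L0 : 0 <= (ln tt `^ v)^-1 by rewrite invr_ge0; exact: powR_ge0.
  have L0' : 0 <= (ln N `^ v)^-1 by rewrite invr_ge0; exact: powR_ge0.
  apply: ler_wpM2l; first exact: ltW.
  apply: ge0_ler_powR; first exact: th0.
  - by rewrite nnegrE; exact: mulr_ge0 a0 L0.
  - by rewrite nnegrE; exact: mulr_ge0 (ltW N0) L0'.
  apply: ler_pM; [exact: a0|exact: L0|exact: tN|].
  rewrite lef_pV2 ?posrE; [|exact: powR_gt0|exact: powR_gt0].
  by apply: ge0_ler_powR; rewrite ?nnegrE; [exact: v0|exact: ltW|exact: ltW|exact: lNt].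
rewrite !powR_div ?divr_ge0 ?powR_gt0 ?(ltW tt0)// -powRrM powRDp// !powRN.
have h := hb _ bl; have B0 : 0 < ln tt `^ e by rewrite powR_gt0.
have D0 : 0 < ln tt `^ (v * th) by rewrite powR_gt0.
have E0 : 0 < 2 `^ th :> R by rewrite powR_gt0.
have -> : C0 * (tt `^ th / 2 `^ th / ln tt `^ (v * th)) =
  tt `^ th * ((ln tt `^ (v * th))^-1 * (C0 / 2 `^ th)) by field; rewrite !lt0r_neq0.
rewrite ler_wpM2l ?powR_ge0// ler_wpM2l ?invr_ge0 ?powR_ge0//.
rewrite -[leRHS]invrK lef_pV2 ?posrE ?invr_gt0 ?divr_gt0//.
by move: h; rewrite powRN.
Unshelve. all: by end_near.
Qed.

End scales.

Section lower_bound.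
Context {d : measure_display} {T : measurableType d} {R : realType}.
Variables (P : probability T R) (S : set R) (F : nat -> set (set T)) (X : nat -> T -> R).
Variables (c s2 p : R).
Hypotheses (hA0 : A0 P S F X) (hA1 : A1 P S F X) (hA2 : A2 P F X c s2)
  (hMp : Mp P F X p) (p_gt2 : 2 < p).
Implicit Types (t n : nat) (A B : set T) (x y z q u alpha : R).

Lemma Ssum_homo alpha w : {homo (fun t => Ssum X alpha t w) : m n / (m <= n)%N >-> m <= n}.
Proof.
move=> m n mn; rewrite /Ssum [leRHS](@big_cat_nat _ _ _ m.+1)//= lerDl.
by apply: sumr_ge0 => i _; rewrite powR_ge0.
Qed.

Lemma Ssum_sojourn alpha t0 n1 n2 y t w : (0 < t0)%N -> 0 <= alpha -> 0 <= y ->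
  sojourn X t0 n1 n2 y w -> (t0 + n1 + n2 <= t)%N ->
  n2.+1%:R * (y / 2) `^ alpha <= Ssum X alpha t w.
Proof.
move=> t00 a0 y0 [j [jn h]] tt; rewrite /Ssum.
have e1 : (t0 + j <= t.+1)%N.
  by rewrite (leq_trans (leq_add (leqnn t0) jn))// (leq_trans (leq_addr n2 _))// (leq_trans tt).
have e2 : (t0 + j <= n2.+1 + (t0 + j))%N by rewrite leq_addl.
have e3 : (n2.+1 + (t0 + j) <= t.+1)%N.
  by rewrite addSn ltnS addnC (leq_trans _ tt)// leq_add2r leq_add2l.
rewrite (@big_cat_nat _ _ _ (t0 + j))//=; last by rewrite addn_gt0 t00.
rewrite [X in _ <= _ + X](@big_cat_nat _ _ _ (n2.+1 + (t0 + j)))//=.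
have g0 a b : 0 <= \sum_(a <= s < b) X s w `^ alpha.
  by apply: sumr_ge0 => i _; rewrite powR_ge0.
apply: (@le_trans _ _ (\sum_(t0 + j <= s < n2.+1 + (t0 + j)) X s w `^ alpha)); last first.
  by rewrite addrCA lerDl addr_ge0.
rewrite sum_shift; apply: (@le_trans _ _ (\sum_(i < n2.+1) (y / 2) `^ alpha)).
  by rewrite sumr_const card_ord mulr_natl.
apply: ler_sum => i _; rewrite ge0_ler_powR ?nnegrE ?divr_ge0//.
  by apply: (X_ge0 hA0); rewrite addn_gt0 addn_gt0 t00 orbT.
by rewrite addnC; apply: h; rewrite -ltnS.
Qed.

Lemma lower_bound_ae q u (b : R) alpha (e : R) : 2 <= q -> 0 < u <= 1 -> 0 <= c + (q - 1) * s2 / 2 ->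
  (forall x, b <= x -> 1 <= mlog (q - 2) (u - 1) x) -> 0 <= alpha -> 0 < e ->
  {ae P, forall w, \forall t \near \oo,
    t%:R `^ ((alpha + 2) / q) * ln t%:R `^ (- ((1 + u) * ((alpha + 2) / q)) - e)
      <= Ssum X alpha t w}.
Proof.
move=> q2 u01 hq hb a0 e0; have /andP[u0 u1] := u01.
have [K [e' [b' [K0 e'0 eb' hsoj]]]] := sojourn_prob hA0 hA1 hA2 hMp p_gt2 q2 u01 hq hb.
have [C0 [k0 [C00 hk]]] := @lower_scales R q u K e' b' alpha q2 u01 K0 e'0 a0.
have {hk}/choice[ynn hk] : forall k, exists ynn : R * nat * nat, (k0 <= k)%N ->
  [/\ b' <= ynn.1.1, K * mlog q u (2 * ynn.1.1) <= ynn.1.2%:R, ynn.2%:R <= e' * ynn.1.1 ^+ 2,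
     (k * (ynn.1.2 + ynn.2) + 1 <= 2 ^ k)%N &
     C0 * (2 ^+ k / ln (2 ^+ k) `^ (1 + u)) `^ ((alpha + 2) / q) <=
       ynn.2.+1%:R * (ynn.1.1 / 2) `^ alpha].
  move=> k; have [kk|kk] := leqP k0 k; last by exists (0, 0%N, 0%N).
  by have [y [n1 [n2 h]]] := hk k kk; exists (y, n1, n2).
pose E k := [set w | forall i, (i < k)%N ->
  ~ sojourn X (1 + i * ((ynn k).1.2 + (ynn k).2)) (ynn k).1.2 (ynn k).2 (ynn k).1.1 w].
have hE k : measurable (E k) /\ ((k0 <= k)%N -> fine (P (E k)) <= (3 / 4) ^+ k).
  rewrite /E; move: (ynn k) (hk k) => [[y n1] n2] /= hkk.
  set L := (n1 + n2)%N.
  pose E' m := [set w | forall i, (i < m)%N -> ~ sojourn X (1 + i * L) n1 n2 y w].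
  have E'S m : E' m.+1 = E' m `&` ~` sojourn X (1 + m * L) n1 n2 y.
    apply/seteqP; split=> w /=.
      by move=> h; split; [move=> i im; apply: h; rewrite ltnS ltnW|exact: h].
    by move=> [h1 h2] i; rewrite ltnS leq_eqVlt => /orP[/eqP -> //|]; exact: h1.
  have FE' m : F (1 + m * L)%N (E' m).
    elim: m => [|m IH].
      rewrite [X in F _ X](_ : _ = setT); first exact: (F_setT hA0).
      by apply/seteqP; split.
    rewrite E'S; apply: (F_setI hA0) => //.
      by apply: (F_mono hA0) IH => //; rewrite leq_add2l leq_mul2r leqnSn orbT.
    apply: (F_setC hA0) => //.
    have := @F_sojourn _ _ _ P S F X hA0 (1 + m * L) n1 n2 y isT.
    by rewrite -!addnA -/L -mulSnr.
  have mE' m : measurable (E' m) by apply: (F_measurable hA0 _ (FE' m)).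
  split; first exact: mE'.
  move=> kk; have [h1 h2 h3 _ _] := hkk kk.
  suff : forall m, fine (P (E' m)) <= (3 / 4) ^+ m by apply.
  elim=> [|m IH]; first by rewrite expr0 pr_le1.
  rewrite E'S exprS (le_trans (hsoj y (1 + m * L)%N (E' m) n1 n2 h1 isT (FE' m) h2 h3))//.
  by rewrite ler_wpM2l.
have ae := @borel_cantelli _ _ _ P E (fun k => (3 / 4) ^+ k) k0 4 (fun k => (hE k).1)
  (fun k => exprn_ge0 _ _) (fun k => (hE k).2) _.
apply: filterS (ae _ _) => [w [k1 hw]|//|n].
  apply: (@dyadic_lower R (fun t => Ssum X alpha t w) C0 _ (1 + u) e (maxn k0 k1)) => //.
  - by rewrite divr_ge0// ?addr_ge0// (le_trans _ q2).
  - by rewrite addr_ge0// ltW.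
  - exact: Ssum_homo.
  move=> k; rewrite geq_max => /andP[kk0 kk1].
  have [h1 _ _ h4 h5] := hk k kk0.
  apply: (le_trans h5).
  have := hw k kk1 => /existsNP[i /not_implyP[ik /contrapT hs]].
  apply: Ssum_sojourn hs _ => //.
    by rewrite (le_trans _ h1)// (le_trans _ eb')// expR_ge0.
  apply: leq_trans h4; rewrite -addnA -addnA addnC leq_add2r.
  by rewrite -mulSnr leq_mul2r ik orbT.
exact: geometric34.
Qed.

End lower_bound.

(** * Almost sure upper bound *)

Section upper_arithmetic.
Context {R : realType}.
Implicit Types (c q u v x y : R).

Lemma mlog0_le1 (w x : R) : w <= 0 -> expR 1 <= x -> mlog 0 w x <= 1.
Proof.
move=> w0 ex; have l1 := ln_ge1 ex.
by rewrite (le_trans (mlog_le_ln 0 l1 w0))// /mlog !powRr0 mulr1.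
Qed.

Lemma Lmlog2_le c (s2 : R) u x : 0 < s2 -> -1 <= u <= 0 -> expR 1 <= x ->
  Lmlog c s2 2 u x + 1 * mlog (2 - 2) (u - 1) x <= 3 * `|c| + 4 * s2 + 1.
Proof.
move=> s20 /andP[u1 u0] ex; rewrite /Lmlog /mlog2.
rewrite subrr.
have := @mlog0_le1 u x u0 ex.
have := @mlog0_le1 (u - 1) x ltac:(lra) ex.
have := @mlog0_le1 (u - 2) x ltac:(lra) ex.
have := @mlog_ge0 R 0 u x; have := @mlog_ge0 R 0 (u - 1) x; have := @mlog_ge0 R 0 (u - 2) x.
move: (mlog 0 u x) (mlog 0 (u - 1) x) (mlog 0 (u - 2) x) => m0 m1 m2 h2 h1 h0 h2' h1' h0'.
have c1 : c * (2 * m0 + u * m1) <= 3 * `|c|.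
  rewrite (le_trans (ler_norm _))// normrM mulrC ler_wpM2r//.
  by rewrite ler_norml; apply/andP; split; nra.
have c2 : u * (2 * 2 - 1) * m1 <= 0 by nra.
have c3 : u * (u - 1) * m2 <= 2 by nra.
have c4 : s2 / 2 * (2 * (2 - 1) * m0 + u * (2 * 2 - 1) * m1 + u * (u - 1) * m2) <= s2 / 2 * 8.
  by rewrite ler_wpM2l//; lra.
lra.
Qed.

Lemma Lmlog_crit_le c (s2 : R) q v x : 0 < s2 -> 2 < q -> 0 < v <= 1 -> c + (q - 1) * s2 / 2 = 0 ->
  expR 1 <= x ->
  Lmlog c s2 q (- v) x + v * (s2 / 2) * (q - 2) * mlog (q - 2) (- v - 1) x <= 0.
Proof.
move=> s20 q2 /andP[v0 v1] hc ex; have l1 := ln_ge1 ex.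
have h21 : mlog (q - 2) (- v - 2) x <= mlog (q - 2) (- v - 1) x by rewrite mlog_le_ln//; lra.
rewrite /Lmlog /mlog2; have -> : c = - ((q - 1) * s2 / 2) by lra.
have := @mlog_ge0 R (q - 2) (- v - 2) x.
move: (mlog (q - 2) (- v) x) (mlog (q - 2) (- v - 1) x) (mlog (q - 2) (- v - 2) x) h21 => m0 m1 m2 h21 h2.
rewrite [leLHS](_ : _ = v * (s2 / 2) * (- 2 * m1 + (1 + v) * m2)); last by field.
by rewrite mulr_ge0_le0//; nra.
Qed.

Lemma upper_scales q v alpha (x0 C D b : R) : 2 <= q -> 0 < v <= 1 -> 0 <= alpha -> q <= alpha + 2 ->
  0 <= x0 -> 0 <= C -> 0 <= D ->
  exists (C1 : R) (k0 : nat), 0 <= C1 /\ forall k, (k0 <= k)%N -> exists y B : R,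
    [/\ b <= y, expR 1 <= y, 0 < B,
      C * (2 ^ k).+1%:R / mlog q (- v) y + D * mlog (alpha + 2) 1 (2 * y) / B
        <= C1 * k.+1%:R `^ (- (1 + v)) &
      (2 ^ k)%:R * x0 `^ alpha + B <= C1 * ((2 ^+ k) `^ ((alpha + 2) / q)
         * ln (2 ^+ k) `^ ((1 + 2 * v) * ((alpha + 2) / q) + 2 + v))].
Proof.
move=> q2 /andP[v0 v1] a0 qa x00 C0 D0.
have q0 : 0 < q by lra.
pose th := (alpha + 2) / q.
have th1 : 1 <= th by rewrite /th ler_pdivlMr// mul1r.
have p0 : 0 <= 2 `^ (alpha + 2) :> R by rewrite powR_ge0.
have px : 0 <= x0 `^ alpha by rewrite powR_ge0.
pose Y := Num.max b (expR 1).
have Y1 : expR 1 <= Y by rewrite le_max lexx orbT.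
have Y0 : 0 < Y by rewrite (lt_le_trans _ Y1)// expR_gt0.
have [k1 hk1] := @scale_growth R 0 1 (Y `^ q) ltr01.
have [k2 hk2] := @scale_growth R (1 + 2 * v) 1 (2 `^ q) ltr01.
pose C1 := (2 * C + D) * 4 `^ (1 + v) + x0 `^ alpha + 2 `^ (alpha + 2).
have p4 : 0 <= 4 `^ (1 + v) :> R by rewrite powR_ge0.
have C1a : 0 <= (2 * C + D) * 4 `^ (1 + v) by rewrite mulr_ge0//; clear -C0 D0; lra.
exists C1, (maxn (maxn k1 k2) 2); split; first by rewrite /C1; clear -C1a p0 px; lra.
move=> k; rewrite !geq_max => /andP[/andP[/hk1[_ g1] /hk2[g2 _]] k2'].
rewrite natrX; set N : R := 2 ^+ k in g1 g2 *.
have kge2 : 2 <= k%:R :> R by rewrite ler_nat.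
have /andP[l1 l2] := @ln_pow2 R k; rewrite -/N in l1 l2.
have N1 : 1 <= N by rewrite /N -natrX ler1n expn_gt0.
have Nnat : (2 ^ k).+1%:R <= 2 * N by rewrite -addn1 natrD natrX -/N; clear -N1; lra.
clearbody N; have N0 : 0 < N by (clear -N1; lra).
have ell1 : 1 <= ln N by (clear -kge2 l1; lra).
have ell0 : 0 < ln N by (clear -kge2 l1; lra).
rewrite powRr1 ?(ltW N0)// in g2.
pose L := ln N; rewrite -/L in l1 l2 ell1 ell0 g2 *.
have Lp w : 0 < L `^ w by rewrite powR_gt0.
have LpW w : 0 <= L `^ w by rewrite ltW.
have Lge1 w : 0 <= w -> 1 <= L `^ w.
  move=> w0; apply: (@le_trans _ _ (L `^ 0)); first by rewrite powRr0.
  by rewrite ler_powR.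
pose Z := N * L `^ (1 + 2 * v).
have Z0 : 0 < Z by rewrite mulr_gt0.
have NZ : N <= Z by rewrite ler_peMr ?(ltW N0)// Lge1//; clear -v0; lra.
pose y := Z `^ q^-1.
have y0 : 0 < y by rewrite powR_gt0.
have yq : y `^ q = Z by rewrite /y -powRrM mulVf ?lt0r_neq0// powRr1// ltW.
have Yy : Y <= y.
  rewrite leNgt; apply/negP => yY.
  have : y `^ q < Y `^ q by rewrite gt0_ltr_powR ?nnegrE ?(ltW y0) ?(ltW Y0).
  by rewrite yq ltNge (le_trans g1).
have ey : expR 1 <= y by exact: le_trans Yy.
have ly1 := ln_ge1 ey.
have y2N : 2 * y <= N.
  rewrite leNgt; apply/negP => Ny.
  have : N `^ q < (2 * y) `^ q by rewrite gt0_ltr_powR ?nnegrE ?mulr_ge0 ?(ltW y0) ?(ltW N0).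
  rewrite powRM ?(ltW y0)// yq ltNge /Z mulrCA => /negP; apply.
  apply: (@le_trans _ _ (N * N)); first by rewrite ler_wpM2l// ltW.
  by rewrite -expr2 -powR_mulrn ?(ltW N0)// ler_powR.
have lyL : ln (2 * y) <= L by rewrite ler_ln ?posrE ?mulr_gt0.
have lyL' : ln y <= L.
  by rewrite ler_ln ?posrE// (le_trans _ y2N)// ler_peMl ?ler1n// ltW.
pose B := mlog (alpha + 2) 1 (2 * y) * L `^ (1 + v).
have e2 := @expR1_ge2 R.
have H0 : 0 < mlog (alpha + 2) 1 (2 * y).
  by rewrite mulr_gt0 ?powR_gt0 ?ln_gt0 ?mulr_gt0//; clear -Y1 Yy e2; lra.
have B0 : 0 < B by rewrite mulr_gt0.
have m0 : N * L `^ (1 + v) <= mlog q (- v) y.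
  rewrite /mlog yq /Z.
  have -> : L `^ (1 + 2 * v) = L `^ (1 + v) * L `^ v by rewrite -powRDp//; congr (_ `^ _); ring.
  have -> : N * (L `^ (1 + v) * L `^ v) * ln y `^ (- v) =
    N * L `^ (1 + v) * (L `^ v * ln y `^ (- v)) by ring.
  rewrite -[leLHS]mulr1 ler_wpM2l ?mulr_ge0 ?(ltW N0)//.
  rewrite powRN ler_pdivlMr ?mul1r ?powR_gt0//; last (clear -ly1; lra).
  by rewrite ge0_ler_powR ?nnegrE ?(ltW v0) ?(ltW ell0)//; clear -ly1; lra.
have kL : L `^ (- (1 + v)) <= 4 `^ (1 + v) * k.+1%:R `^ (- (1 + v)).
  have k4 : k.+1%:R <= 4 * L :> R by rewrite -natr1; clear -kge2 l1; lra.
  rewrite !powRN ler_pdivlMr ?powR_gt0// mulrC ler_pdivrMr//.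
  by rewrite -powRM ?(ltW ell0)// ge0_ler_powR ?nnegrE ?mulr_ge0 ?(ltW ell0)//; clear -v0; lra.
exists y, B; split => //.
- by rewrite (le_trans _ Yy)// le_max lexx.
- have t1 : C * (2 ^ k).+1%:R / mlog q (- v) y <= 2 * C * L `^ (- (1 + v)).
    apply: (@le_trans _ _ (C * (2 * N) / (N * L `^ (1 + v)))).
      apply: ler_pM; rewrite ?mulr_ge0 ?invr_ge0 ?mlog_ge0//.
        by rewrite ler_wpM2l.
      by rewrite lef_pV2 ?posrE ?(lt_le_trans _ m0) ?mulr_gt0.
    rewrite powRN le_eqVlt; apply/orP; left; apply/eqP; field.
    by rewrite !lt0r_neq0.
  have t2 : D * mlog (alpha + 2) 1 (2 * y) / B = D * L `^ (- (1 + v)).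
    by rewrite /B powRN; field; rewrite !lt0r_neq0.
  rewrite t2 (le_trans (lerD t1 (lexx _)))// -mulrDl.
  apply: (@le_trans _ _ ((2 * C + D) * (4 `^ (1 + v) * k.+1%:R `^ (- (1 + v))))).
    by rewrite ler_wpM2l//; clear -C0 D0; lra.
  by rewrite mulrA ler_wpM2r ?powR_ge0// /C1; clear -p0 px; lra.
- set G := N `^ th * L `^ ((1 + 2 * v) * th + 2 + v).
  have G1 : N <= G.
    rewrite /G -[leLHS]mulr1 ler_pM ?(ltW N0)//; first exact: le1r_powR.
    apply: Lge1; apply: addr_ge0; last exact: ltW.
    apply: addr_ge0 => //; apply: mulr_ge0; last exact: le_trans th1.
    by apply: addr_ge0 => //; apply: mulr_ge0 => //; exact: ltW.
  have BG : B <= 2 `^ (alpha + 2) * G.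
    rewrite /B /mlog powRM ?(ltW y0)// powRr1; last by rewrite ln_ge0//; clear -Y1 Yy e2; lra.
    have -> : y `^ (alpha + 2) = N `^ th * L `^ ((1 + 2 * v) * th).
      rewrite (_ : alpha + 2 = q * th); last by rewrite /th mulrCA divff ?mulr1// lt0r_neq0.
      by rewrite powRrM yq /Z powRM ?(ltW N0)// -powRrM.
    have -> : G = N `^ th * L `^ ((1 + 2 * v) * th) * L * L `^ (1 + v).
      have eE : (1 + 2 * v) * th + 2 + v = (1 + 2 * v) * th + (1 + (1 + v)) by ring.
      by rewrite /G eE powRDp// powRDp// powRr1 ?(ltW ell0)// !mulrA.
    rewrite !mulrA ler_wpM2r// ler_wpM2l// ?mulr_ge0 ?powR_ge0//.
  have : N * x0 `^ alpha <= x0 `^ alpha * G by rewrite mulrC ler_wpM2l.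
  have : 0 <= (2 * C + D) * 4 `^ (1 + v) * G by rewrite mulr_ge0// (le_trans _ G1)// ltW.
  by rewrite /C1 !mulrDl; move: BG; clear; lra.
Qed.

Lemma dyadic_upper (f : nat -> R) (C0 th v e : R) (k0 : nat) : 0 <= C0 -> 0 <= th -> 0 <= v -> 0 < e ->
  {homo f : m n / (m <= n)%N >-> m <= n} ->
  (forall k, (k0 <= k)%N -> f (2 ^ k)%N <= C0 * ((2 ^+ k) `^ th * ln (2 ^+ k) `^ v)) ->
  \forall t \near \oo, f t <= t%:R `^ th * ln t%:R `^ (v + e).
Proof.
move=> C00 th0 v0 e0 hf hC.
have [b hb] := @powR_ge_near R e (C0 * 2 `^ th * 2 `^ v) e0.
have [k1 hk1] : exists k1 : nat, expR (Num.max b 1) <= k1%:R.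
  exists (Num.truncn (expR (Num.max b 1))).+1; apply/ltW; exact: truncnS_gt.
near=> t.
have t1 : (2 ^ k0 <= t)%N by near: t; exact: nbhs_infty_ge.
have t2 : (k1 <= t)%N by near: t; exact: nbhs_infty_ge.
have t0 : (0 < t)%N by rewrite (leq_trans _ t1)// expn_gt0.
pose k := (trunc_log 2 t).+1.
have kt : (2 ^ k.-1 <= t)%N by apply: trunc_logP.
have tk : (t < 2 ^ k)%N by apply: trunc_log_ltn.
have k0k : (k0 <= k)%N.
  by rewrite -ltnS -(@ltn_exp2l 2)// (leq_ltn_trans t1)// (ltn_trans tk)// ltn_exp2l.
apply: (le_trans (hf _ _ (ltnW tk))); apply: (le_trans (hC k k0k)).
set N : R := 2 ^+ k; set tt : R := t%:R.
have Nt : N <= 2 * tt.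
  by rewrite /N exprS ler_pM2l// /tt -natrX ler_nat.
have lt : Num.max b 1 <= ln tt.
  rewrite -[leLHS]expRK ler_ln ?posrE ?expR_gt0// ?ltr0n//.
  by rewrite (le_trans hk1)// ler_nat.
move: lt; rewrite ge_max => /andP[bl l1].
have N1 : 1 <= N by rewrite /N -natrX ler1n expn_gt0.
have tt0 : 0 < tt by rewrite ltr0n.
clearbody N tt.
have N0 : 0 < N by rewrite (lt_le_trans _ N1).
have lN0 : 0 <= ln N by rewrite ln_ge0.
have ltt0 : 0 < ln tt by rewrite (lt_le_trans _ l1).
have /andP[_ l2] := @ln2_bounds R.
have lNt : ln N <= 2 * ln tt.
  have h1 : ln N <= ln (2 * tt) by rewrite ler_ln ?posrE ?mulr_gt0.
  have h2 : ln (2 * tt) = ln 2 + ln tt by rewrite lnM ?posrE.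
  by clear -h1 h2 l2 l1; lra.
have h := hb _ bl.
apply: (@le_trans _ _ (C0 * ((2 * tt) `^ th * (2 * ln tt) `^ v))).
  apply: ler_wpM2l => //; apply: ler_pM; [exact: powR_ge0|exact: powR_ge0| |].
    by apply: ge0_ler_powR; rewrite ?nnegrE; [exact: th0|exact: ltW|apply: mulr_ge0 => //; exact: ltW|exact: Nt].
  by apply: ge0_ler_powR; rewrite ?nnegrE; [exact: v0|exact: lN0|apply: mulr_ge0 => //; exact: ltW|exact: lNt].
rewrite (powRM th (ler0n _ 2) (ltW tt0)) (powRM v (ler0n _ 2) (ltW ltt0)) powRDp//.
rewrite [leLHS](_ : _ = tt `^ th * ln tt `^ v * (C0 * 2 `^ th * 2 `^ v)); last by ring.
rewrite [leRHS]mulrA; apply: ler_wpM2l; last exact: h.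
by apply: mulr_ge0; exact: powR_ge0.
Unshelve. all: by end_near.
Qed.

End upper_arithmetic.

Section upper_bound.
Context {d : measure_display} {T : measurableType d} {R : realType}.
Variables (P : probability T R) (S : set R) (F : nat -> set (set T)) (X : nat -> T -> R).
Variables (c s2 p : R).
Hypotheses (hA0 : A0 P S F X) (hA2 : A2 P F X c s2) (hMp : Mp P F X p) (p_gt2 : 2 < p).
Implicit Types (t n : nat) (A B : set T) (x y z q u v alpha : R).
Local Notation pr A := (fine (P A)).
Local Notation below y := [set z : R | (z < y)%R].
Local Notation between a b := [set z : R | (a <= z < b)%R].

Let s20 : 0 < s2. Proof. by case: hA2. Qed.

Lemma drift_max q v (D : set R) : q <= p -> 0 < v <= 1 ->
  q = 2 \/ 2 < q /\ c + (q - 1) * s2 / 2 = 0 ->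
  exists C, 0 <= C /\ drift_le P S F X D (ftop q (- v)) (fun=> 0) (fun=> C).
Proof.
move=> qp v01 hq; have /andP[v0 v1] := v01.
have u01 : -1 <= - v <= 0 by rewrite lerN2 v1 oppr_le0 ltW.
have q2 : 2 <= q by case: hq => [->//|[/ltW]].
have q1 : 1 <= q by rewrite (le_trans _ q2)// ler1n.
have [e0 [C [e00 C0 hL]]] : exists e0 C : R, [/\ 0 < e0, 0 <= C & forall x, expR 1 <= x ->
    Lmlog c s2 q (- v) x + e0 * mlog (q - 2) (- v - 1) x <= C].
  case: hq => [->|[q2' hc]].
    exists 1, (3 * `|c| + 4 * s2 + 1); split => //.
      by rewrite !addr_ge0// mulr_ge0// ltW.
    by move=> x ex; exact: Lmlog2_le.
  exists (v * (s2 / 2) * (q - 2)), 0; split => //.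
    by rewrite !mulr_gt0 ?divr_gt0 ?subr_gt0.
  by move=> x ex; exact: Lmlog_crit_le.
have [x0 [C1 [ex0 C10 hx0]]] := drift_upper hA0 hA2 hMp p_gt2 q1 qp u01 e00.
exists (C + C1); split; first by rewrite addr_ge0.
move=> t x A t0 Sx _ FA Ax; rewrite mul0e adde0.
apply: (le_trans (hx0 t x A t0 Sx FA Ax)); apply: lee_wpmul2r => //; rewrite lee_fin.
case: ifPn => [x0x|_]; last by rewrite addrA lerDr addr_ge0// ftop_ge0.
have ex : expR 1 <= x by rewrite (le_trans _ x0x)// (le_trans _ ex0)// ler_expR ler1n.
rewrite /ftop max_l// -addrA lerD2l (le_trans (hL x ex))// lerDl//.
Qed.

Lemma drift_stopped_const t0 (D : set R) (f : R -> R) (C : R) A n : (0 < t0)%N ->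
  (forall x, S x -> 0 <= f x) -> 0 <= C -> drift_le P S F X D f (fun=> 0) (fun=> C) -> F t0 A ->
  (\int[P]_(w in A) (f (stopped X t0 D n w))%:E
    <= \int[P]_(w in A) (f (X t0 w))%:E + (n%:R * C)%:E)%E.
Proof.
move=> t00 f0 C0 hD FA; have mA := F_measurable hA0 t00 FA.
have := @drift_stopped _ _ _ P S F X hA0 t0 D t00 f (fun=> 0) (fun=> C) A n
  f0 (fun _ _ _ => lexx 0) (fun _ _ _ => C0) hD FA.
rewrite [X in (_ + X <= _)%E]big1 ?adde0; last by move=> j _; rewrite integral0.
move=> H; apply: (le_trans H); apply: leeD2l.
apply: (@le_trans _ _ (\sum_(j < n) C%:E)%E); last first.
  by rewrite sumEFin sumr_const card_ord mulr_natl.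
apply: lee_sum => j _; rewrite integral_cst; last exact: (measurable_occ hA0).
rewrite -[leRHS]mule1; apply: lee_wpmul2l; rewrite ?lee_fin//.
by apply: probability_le1; exact: (measurable_occ hA0).
Qed.

Lemma max_prob q v : q <= p -> 0 < v <= 1 ->
  q = 2 \/ 2 < q /\ c + (q - 1) * s2 / 2 = 0 ->
  exists C, 0 <= C /\ forall y n, expR 1 <= y ->
    pr (stopped X 1 (below y) n @^-1` (~` below y)) <= C * n.+1%:R / mlog q (- v) y.
Proof.
move=> qp v01 hq; have /andP[v0 v1] := v01.
have q2 : 2 <= q by case: hq => [->//|[/ltW]].
have q1 : 1 <= q by rewrite (le_trans _ q2)// ler1n.
have [C [C0 hC]] := drift_max setT qp v01 hq.
pose C1 := ftop q (- v) 0.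
have C10 : 0 <= C1 := ftop_ge0 _ _ _.
exists (C + C1); split; first by rewrite addr_ge0.
move=> y n ey; set D := below y; set W := stopped X 1 D.
have m0 : 0 < mlog q (- v) y.
  have y1 : 1 < y by rewrite (lt_le_trans _ ey)// -expR0 ltr_expR.
  by rewrite mulr_gt0 ?powR_gt0 ?ln_gt0// (lt_trans _ y1).
have hC' : drift_le P S F X D (ftop q (- v)) (fun=> 0) (fun=> C).
  by move=> t x A t0 Sx _; exact: hC.
have H := drift_stopped_const n (isT : (0 < 1)%N) (fun z _ => ftop_ge0 q (- v) z) C0 hC' (F_setT hA0 (isT : (0 < 1)%N)).
have X1E : (\int[P]_w (ftop q (- v) (X 1 w))%:E = C1%:E)%E.
  transitivity (\int[P]_w (cst C1%:E w))%E; last first.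
    by rewrite integral_cst// [X in (_ * X)%E]probability_setT mule1.
  apply: ae_eq_integral => //; first exact: (measurable_fun_X hA0 (fun z => (ftop q (- v) z)%:E)).
  have [_ [_ _ _ X1]] := hA0.
  have hP : P (~` (X 1 @^-1` [set 0])) = 0%E.
    rewrite probability_setC; last exact: (measurable_X hA0).
    by rewrite [X in (_ - X)%E]X1 subee.
  exists (~` (X 1 @^-1` [set 0])); split; last 2 first.
  - exact: hP.
  - by move=> w /= h; apply: contra_not h => -> _; rewrite /C1.
  - by apply: measurableC; exact: (measurable_X hA0).
rewrite X1E in H.
rewrite ler_pdivlMr// -lee_fin.
apply: (le_trans _ (le_trans H _)).
  rewrite mulrC EFinM -prE; last exact: (measurable_stopped hA0).
  rewrite -integral_cst; last exact: (measurable_stopped hA0).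
  apply: (@le_trans _ _ (\int[P]_(w in W n @^-1` (~` D)) (ftop q (- v) (W n w))%:E)%E).
    apply: ge0_le_integral => //.
    - exact: (measurable_stopped hA0).
    - by move=> w _; rewrite lee_fin ltW.
    - exact: (@measurable_fun_stopped _ _ _ P S F X hA0 1 D isT n _ _ (fun z => (ftop q (- v) z)%:E)).
    - move=> w /= /negP; rewrite -leNgt => yw; rewrite lee_fin /ftop mlog_homo//.
        by rewrite normrN ger0_norm// ltW.
      by rewrite le_max yw.
  apply: ge0_subset_integral => //.
  - exact: (measurable_stopped hA0).
  - exact: (@measurable_fun_stopped _ _ _ P S F X hA0 1 D isT n _ _ (fun z => (ftop q (- v) z)%:E)).
  - by move=> w _; rewrite lee_fin ftop_ge0.
rewrite -EFinD lee_fin -natr1 (_ : (C + C1) * (n%:R + 1) = C1 + n%:R * C + (C1 * n%:R + C)); last by ring.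
by rewrite lerDl addr_ge0// mulr_ge0.
Qed.

Lemma SsumE alpha n w : Ssum X alpha n w = \sum_(j < n) X j.+1 w `^ alpha.
Proof. by rewrite /Ssum big_add1 big_mkord. Qed.

Lemma measurable_Ssum alpha n D : measurable_fun D (Ssum X alpha n).
Proof.
rewrite (_ : Ssum X alpha n = fun w => \sum_(j < n) X j.+1 w `^ alpha); last first.
  by apply/funext => w; exact: SsumE.
by apply: measurable_sum => j; exact: (measurable_fun_X hA0 (fun z => z `^ alpha)).
Qed.

Lemma sum_prob alpha : 0 <= alpha -> 0 <= c + (alpha + 1) * s2 / 2 ->
  exists x0, expR 2 <= x0 /\ forall y n (B : R), x0 <= y -> 0 < B ->
    pr [set w | n%:R * x0 `^ alpha + B < Ssum X alpha n w] <=
    pr (stopped X 1 (below y) n @^-1` (~` below y)) + 4 / s2 * mlog (alpha + 2) 1 (2 * y) / B.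
Proof.
move=> a0 hc.
have q2 : 2 <= alpha + 2 by rewrite lerDr.
have u01 : 0 < (1 : R) <= 1 by rewrite ltr01 lexx.
have hc' : 0 <= c + (alpha + 2 - 1) * s2 / 2.
  by rewrite (_ : alpha + 2 - 1 = alpha + 1)//; ring.
have [x0 [ex0 _ hx0]] := occupation_lower hA0 hA2 hMp p_gt2 0 q2 u01 hc'.
exists x0; split => // y n B x0y B0.
set D := below y; set W := stopped X 1 D.
have mW (E : set R) j : measurable (W j @^-1` E) by exact: (measurable_stopped hA0).
have x00 : 0 <= x0 by rewrite (le_trans _ ex0)// expR_ge0.
pose f (z : R) := if x0 <= z < y then z `^ alpha else 0.
have f0 z : 0 <= f z by rewrite /f; case: ifP => // _; exact: powR_ge0.
have mf j E : measurable_fun E (fun w => (f (W j w))%:E).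
  exact: (@measurable_fun_stopped _ _ _ P S F X hA0 1 D isT j _ _ (fun z => (f z)%:E)).
pose V w := \sum_(j < n) f (W j w).
have mV : measurable_fun setT V.
  apply: measurable_sum => j.
  exact: (@measurable_fun_stopped _ _ _ P S F X hA0 1 D isT j _ _ f).
have mVB : measurable [set w | B <= V w].
  have -> : [set w | B <= V w] = V @^-1` `[B, +oo[%classic.
    by apply/seteqP; split=> w /=; rewrite in_itv/= andbT.
  by rewrite -[X in measurable X]setTI; apply: mV.
have mS : measurable [set w | n%:R * x0 `^ alpha + B < Ssum X alpha n w].
  have -> : [set w | n%:R * x0 `^ alpha + B < Ssum X alpha n w] =
      Ssum X alpha n @^-1` `]n%:R * x0 `^ alpha + B, +oo[%classic.
    by apply/seteqP; split=> w /=; rewrite in_itv/= andbT.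
  by rewrite -[X in measurable X]setTI; apply: measurable_Ssum.
apply: (@le_trans _ _ (pr (W n @^-1` (~` D) `|` [set w | B <= V w]))).
  apply: pr_le => //; first by apply: measurableU => //; exact: mW.
  move=> w /= hw; have [Dn|nDn] := pselect (D (W n w)); [right|by left].
  have hWj j : (j < n)%N -> W j w = X j.+1 w /\ W j w < y.
    move=> jn; have Dj : D (W j w) by apply: stopped_outW Dn; exact: ltnW.
    by split => //; rewrite -[j.+1]add1n; exact: (stopped_in Dj).1.
  have : Ssum X alpha n w <= n%:R * x0 `^ alpha + V w.
    rewrite SsumE /V mulr_natl; have -> : x0 `^ alpha *+ n = \sum_(j < n) x0 `^ alpha by rewrite sumr_const card_ord.
    rewrite -big_split/=; apply: ler_sum => j _.
    have [e1 e2] := hWj j (ltn_ord j); rewrite -e1 /f e2 andbT.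
    case: ifPn => [_|]; first by rewrite lerDr powR_ge0.
    rewrite -ltNge addr0 => h; apply: ge0_ler_powR => //; rewrite ?nnegrE//.
      by rewrite e1; apply: (X_ge0 hA0).
    exact: ltW.
  by move=> h; have := lt_le_trans hw h; rewrite ltrD2l => /ltW.
apply: (le_trans (prU_le P (mW _ n) mVB)); rewrite lerD2l ler_pdivlMr// mulrC.
rewrite -lee_fin EFinM -prE// -integral_cst//.
apply: (@le_trans _ _ (\int[P]_w (V w)%:E)%E).
  apply: (@le_trans _ _ (\int[P]_(w in [set w | (B <= V w)%R]) (V w)%:E)%E).
    apply: ge0_le_integral => //.
    - by move=> w _; rewrite lee_fin ltW.
    - by apply/measurable_EFinP; exact: measurable_funTS.
  apply: ge0_subset_integral => //; first exact/measurable_EFinP.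
  by move=> w _; rewrite lee_fin sumr_ge0.
under eq_integral do rewrite -sumEFin.
rewrite ge0_integral_sum//; last by move=> j w _; rewrite lee_fin.
have := hx0 y 1%N setT n x0y isT (F_setT hA0 (isT : (0 < 1)%N)).
rewrite -/W probability_setT/= mulr1 => H.
have s4 : 0 < s2 / 4 by rewrite divr_gt0.
have -> : (4 / s2 * mlog (alpha + 2) 1 (2 * y))%:E = ((s2 / 4)^-1%:E * (mlog (alpha + 2) 1 (2 * y))%:E)%E.
  by rewrite -EFinM invf_div.
rewrite lee_pdivlMl//.
apply: le_trans H; rewrite ge0_sume_distrr; last first.
  by move=> j _; apply: integral_ge0 => w _; rewrite lee_fin.
apply: lee_sum => j _.
rewrite -ge0_integralZl//; last 2 first.
- by move=> w _; rewrite lee_fin.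
- by rewrite lee_fin ltW.
rewrite [leRHS]integral_mkcond le_eqVlt; apply/orP; left; apply/eqP.
apply: eq_integral => w _; rewrite patchE; case: ifPn => [|].
  rewrite inE => -[_ /= h]; rewrite /f h -EFinM mul1r; congr (_%:E).
  have -> : alpha + 2 - 2 = alpha by ring.
  by rewrite subrr /mlog powRr0 mulr1.
by rewrite notin_setE => h; rewrite /f; case: ifP => [h'|_]; [exfalso; apply: h|rewrite mule0].
Qed.

Lemma upper_bound_ae q v alpha (e : R) : q <= p -> 0 < v <= 1 ->
  q = 2 \/ 2 < q /\ c + (q - 1) * s2 / 2 = 0 ->
  0 <= alpha -> q <= alpha + 2 -> 0 <= c + (alpha + 1) * s2 / 2 -> 0 < e ->
  {ae P, forall w, \forall t \near \oo, Ssum X alpha t w <=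
    t%:R `^ ((alpha + 2) / q) * ln t%:R `^ ((1 + 2 * v) * ((alpha + 2) / q) + 2 + v + e)}.
Proof.
move=> qp v01 hq a0 qa hc e0; have /andP[v0 v1] := v01.
have q2 : 2 <= q by case: hq => [->//|[/ltW]].
have [C [C0 hC]] := max_prob qp v01 hq.
have [x0 [ex0 hx0]] := sum_prob a0 hc.
have x00 : 0 <= x0 by rewrite (le_trans _ ex0)// expR_ge0.
have D0 : 0 <= 4 / s2 by rewrite divr_ge0// ltW.
have [C1 [k0 [C10 hk]]] := @upper_scales R q v alpha x0 C (4 / s2) x0 q2 v01 a0 qa x00 C0 D0.
have {hk}/choice[yB hk] : forall k, exists yB : R * R, (k0 <= k)%N ->
  [/\ x0 <= yB.1, expR 1 <= yB.1, 0 < yB.2,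
      C * (2 ^ k).+1%:R / mlog q (- v) yB.1 + 4 / s2 * mlog (alpha + 2) 1 (2 * yB.1) / yB.2
        <= C1 * k.+1%:R `^ (- (1 + v)) &
      (2 ^ k)%:R * x0 `^ alpha + yB.2 <= C1 * ((2 ^+ k) `^ ((alpha + 2) / q)
         * ln (2 ^+ k) `^ ((1 + 2 * v) * ((alpha + 2) / q) + 2 + v))].
  move=> k; have [kk|kk] := leqP k0 k; last by exists (0, 0).
  by have [y [B h]] := hk k kk; exists (y, B).
pose E k := [set w | (2 ^ k)%:R * x0 `^ alpha + (yB k).2 < Ssum X alpha (2 ^ k) w].
have mE k : measurable (E k).
  have -> : E k = Ssum X alpha (2 ^ k) @^-1` `](2 ^ k)%:R * x0 `^ alpha + (yB k).2, +oo[%classic.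
    by apply/seteqP; split=> w /=; rewrite in_itv/= andbT.
  by rewrite -[X in measurable X]setTI; apply: measurable_Ssum.
have [Bd hBd] := @pseries_bound R v v0.
have ae := @borel_cantelli _ _ _ P E (fun k => C1 * k.+1%:R `^ (- (1 + v))) k0 (C1 * Bd) mE.
apply: filterS (ae _ _ _) => [w [k1 hw]|n|n kn|n].
- apply: (@dyadic_upper R (fun t => Ssum X alpha t w) C1 _ _ e (maxn k0 k1)) => //.
  + by rewrite divr_ge0// ?addr_ge0// (le_trans _ q2).
  + rewrite !addr_ge0 ?mulr_ge0 ?addr_ge0 ?invr_ge0// ?(ltW v0)//.
      by rewrite mulr_ge0// ltW.
    by rewrite (le_trans _ q2).
  + exact: Ssum_homo.
  move=> k; rewrite geq_max => /andP[kk0 kk1].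
  have [_ _ _ _ h5] := hk k kk0; apply: le_trans h5.
  by rewrite leNgt; apply/negP; exact: hw k kk1.
- by rewrite mulr_ge0// powR_ge0.
- have [h1 h2 h3 h4 _] := hk n kn; apply: le_trans h4.
  apply: (le_trans (hx0 (yB n).1 (2 ^ n)%N (yB n).2 h1 h3)); rewrite lerD2r.
  exact: hC.
- by rewrite -mulr_sumr ler_wpM2l.
Qed.

End upper_bound.

(** * Strong law for countably valued i.i.d. sequences *)

Section deterministic_averages.
Context {R : realType}.
Implicit Types (f w : nat -> R) (p e lam : R).

Lemma square_interpolation_arith (m n p e a b fn : R) : 1 <= m -> 0 <= p -> 0 < e -> 3 * p <= e * m ->
  m * m <= n -> n <= (m + 1) * (m + 1) -> a <= fn -> fn <= b ->
  `|a - m * m * p| <= e * (m * m) -> `|b - (m + 1) * (m + 1) * p| <= e * ((m + 1) * (m + 1)) ->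
  `|fn - n * p| <= 5 * e * n.
Proof.
move=> m1 p0 e0 pm mn nm afn fnb /ler_normlP[a1 a2] /ler_normlP[b1 b2].
have h1 : n * p <= (m + 1) * (m + 1) * p by rewrite ler_wpM2r.
have h2 : m * m * p <= n * p by rewrite ler_wpM2r.
have h3 : 3 * p * m <= e * m * m by rewrite ler_wpM2r// (le_trans _ m1).
have h4 : p <= p * m by rewrite ler_peMr.
have h5 : e * ((m + 1) * (m + 1)) <= 4 * (e * (m * m)).
  have : (m + 1) * (m + 1) <= 4 * (m * m) by nra.
  by rewrite -(ler_pM2l e0); lra.
have h6 : e * (m * m) <= e * n by rewrite ler_pM2l.
by apply/ler_normlP; split; lra.
Qed.

Lemma square_interpolation f p : 0 <= p -> {homo f : m n / (m <= n)%N >-> m <= n} ->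
  (forall e, 0 < e -> exists k, forall n, (k <= n)%N ->
     `|f (n.+1 ^ 2)%N - n.+1%:R ^+ 2 * p| <= e * n.+1%:R ^+ 2) ->
  f n / n%:R @[n --> \oo] --> p.
Proof.
move=> p0 hf H; apply/cvgrPdist_le => e e0.
have e5 : 0 < e / 5 by rewrite divr_gt0.
have [k hk] := H _ e5.
near=> n.
have [m [km mn nm]] : exists m, [/\ (k.+1 <= m)%N /\ 3 * p <= e / 5 * m%:R, (m ^ 2 <= n)%N & (n <= m.+1 ^ 2)%N].
  pose M := maxn k.+1 (Num.truncn (3 * p / (e / 5))).+1.
  have Mn : (M ^ 2 <= n)%N by near: n; exact: nbhs_infty_ge.
  have ub m : (m ^ 2 <= n)%N -> (m <= n)%N.
    by apply: leq_trans; case: m => // m; rewrite expnS leq_pmulr// expn_gt0.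
  have ex : exists m, (M <= m)%N && (m ^ 2 <= n)%N by exists M; rewrite leqnn.
  have ub' m : (M <= m)%N && (m ^ 2 <= n)%N -> (m <= n)%N by move=> /andP[_ /ub].
  case: (ex_maxnP ex ub') => m /andP[Mm mn] hm; exists m; split => //.
    split; first by rewrite (leq_trans _ Mm)// leq_maxl.
    rewrite -ler_pdivrMl// mulrC ltW// (lt_le_trans (truncnS_gt _))// ler_nat.
    by rewrite (leq_trans _ Mm)// leq_maxr.
  rewrite leqNgt; apply/negP => /ltnW h; have := hm m.+1.
  by rewrite h (leq_trans Mm)// ltnn => /(_ isT).
case: km => km pm; case: m km mn nm pm => // m km mn nm pm.
have n0 : (0 < n)%N by rewrite (leq_trans _ mn)// expn_gt0.
have nn0 : 0 < n%:R :> R by rewrite ltr0n.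
have h1 := hk m km; have h2 := hk m.+1 (leqW km).
rewrite distrC -[X in `|_ - X|](@mulfK _ n%:R) ?gt_eqF// -mulrBl normrM normfV.
rewrite (ger0_norm (ltW nn0)) ler_pdivrMr// [p * _]mulrC.
have -> : e = 5 * (e / 5) by rewrite mulrCA divff// mulr1.
have eS : m.+2%:R = m.+1%:R + 1 :> R by rewrite -natr1.
apply: (@square_interpolation_arith m.+1%:R _ _ _ (f (m.+1 ^ 2)%N) (f (m.+2 ^ 2)%N)) => //.
- by rewrite ler1n.
- by rewrite -natrM ler_nat mulnn.
- by rewrite -eS -natrM ler_nat mulnn.
- exact: hf.
- exact: hf.
- by move: h2; rewrite -eS !expr2.
Unshelve. all: by end_near.
Qed.

Lemma cvg_sum_ord (u : nat -> nat -> R) (l : nat -> R) K :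
  (forall k, u k n @[n --> \oo] --> l k) ->
  \sum_(k < K) u k n @[n --> \oo] --> \sum_(k < K) l k.
Proof.
move=> h; elim: K => [|K IH].
  by under eq_fun do rewrite big_ord0; rewrite big_ord0; exact: cvg_cst.
by under eq_fun do rewrite big_ord_recr; rewrite big_ord_recr; apply: cvgD.
Qed.

Definition large_average (N : nat) lam w (i : nat) := exists n,
  (0 < n <= N)%N /\ lam * n%:R < \sum_(i <= k < i + n) w k.

(* Greedy covering: at a bad index, jump over the block that witnesses it. *)
Lemma large_average_count (N : nat) lam w M j : 0 <= lam -> (forall k, 0 <= w k) ->
  lam * \sum_(j <= i < j + M) `[< large_average N lam w i >]%:R <= \sum_(j <= k < j + M + N) w k.
Proof.
move=> lam0 w0; elim/ltn_ind: M j => -[|M] IH j.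
  by rewrite addn0 big_geq// mulr0 sumr_ge0.
have [[n [/andP[n0 nN] hn]]|nb] := pselect (large_average N lam w j); last first.
  rewrite big_ltn ?addnS ?ltnS ?leq_addr// asboolF// add0r -addSn.
  apply: (le_trans (IH M (ltnSn _) j.+1)).
  by rewrite [leRHS]big_ltn ?lerDr// addSn addSn ltnS -addnA leq_addr.
have [nM|Mn] := leqP n M.+1.
  rewrite (@big_cat_nat _ _ _ (j + n))/= ?leq_addr// ?leq_add2l//.
  rewrite [leRHS](@big_cat_nat _ _ _ (j + n))/= ?leq_addr//; last first.
    by rewrite -addnA leq_add2l (leq_trans nM)// leq_addr.
  rewrite mulrDr; apply: lerD.
    apply: (le_trans _ (ltW hn)); apply: ler_wpM2l => //.
    apply: (@le_trans _ _ (\sum_(j <= i < j + n) 1)).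
      by apply: ler_sum => i _; case: asboolP.
    by rewrite big_const_nat iter_addr_0 addKn.
  have := IH (M.+1 - n)%N _ (j + n)%N; rewrite -addnA subnKC//; apply.
  by rewrite ltn_subrL n0.
apply: (@le_trans _ _ (lam * n%:R)).
  apply: ler_wpM2l => //; apply: (@le_trans _ _ (\sum_(j <= i < j + M.+1) 1)).
    by apply: ler_sum => i _; case: asboolP.
  by rewrite big_const_nat iter_addr_0 addKn ler_nat ltnW.
apply: (le_trans (ltW hn)).
rewrite [leRHS](@big_cat_nat _ _ _ (j + n))/= ?leq_addr ?lerDl ?sumr_ge0//.
by rewrite -addnA leq_add2l (leq_trans nN)// leq_addl.
Qed.

End deterministic_averages.

Section discrete_law.
Context {d : measure_display} {T : measurableType d} {R : realType} (P : probability T R).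
Local Notation pr A := (fine (P A)).

Lemma preimage_singletons (V : countType) (f : T -> V) (B : set V) :
  f @^-1` B = \bigcup_(n in [set n | if @pickle_inv V n is Some v then B v else False])
    (if @pickle_inv V n is Some v then f @^-1` [set v] else set0).
Proof.
apply/seteqP; split=> [w Bw|w [n]/=]; last by case: pickle_inv => // v Bv /= ->.
by exists (pickle (f w)) => /=; rewrite pickleK_inv.
Qed.

Lemma measurable_countable_valued (V : countType) (f : T -> V) (B : set V) :
  (forall v, measurable (f @^-1` [set v])) -> measurable (f @^-1` B).
Proof.
move=> mf; rewrite preimage_singletons; apply: bigcup_measurable => n _.
by case: pickle_inv.
Qed.

Lemma eq_countable_law (V : countType) (f g : T -> V) (B : set V) :
  (forall v, measurable (f @^-1` [set v])) -> (forall v, measurable (g @^-1` [set v])) ->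
  (forall v, P (f @^-1` [set v]) = P (g @^-1` [set v])) ->
  P (f @^-1` B) = P (g @^-1` B).
Proof.
have H (h : T -> V) : (forall v, measurable (h @^-1` [set v])) -> P (h @^-1` B) =
    (\sum_(n <oo | n \in [set n | if @pickle_inv V n is Some v then B v else False])
      P (if @pickle_inv V n is Some v then h @^-1` [set v] else set0))%E.
  move=> mh; rewrite preimage_singletons measure_bigcup//.
    by move=> n _; case: pickle_inv.
  move=> i j _ _ [w []]; have := @pickle_invK V i; have := @pickle_invK V j.
  case: (@pickle_inv V i) => //= v; case: (@pickle_inv V j) => //= v'.
  by move=> <- <- -> ->.
move=> mf mg fg; rewrite (H f)// (H g)//; apply: eq_eseriesr => n _.
by case: pickle_inv.
Qed.

End discrete_law.

Section strong_law.
Context {d : measure_display} {T : measurableType d} {R : realType}.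
Variables (P : probability T R) (E : nat -> T -> nat).
Local Notation pr A := (fine (P A)).
Hypothesis mE : forall i (B : set nat), measurable (E i @^-1` B).
Hypothesis iidE : forall k (B : nat -> set nat),
  pr [set w | forall i, (i < k)%N -> B i (E i w)] = \prod_(i < k) pr (E 0 @^-1` B i).
Implicit Types (B : set nat) (g : nat -> R) (lam e : R).

Lemma iid_window j k (B : nat -> set nat) :
  pr [set w | forall i, (i < k)%N -> B i (E (j + i)%N w)] = \prod_(i < k) pr (E 0 @^-1` B i).
Proof.
have := iidE (j + k) (fun m => if (m < j)%N then setT else B (m - j)%N).
rewrite big_split_ord/= big1 ?mul1r; last first.
  by move=> i _; rewrite ltn_ord preimage_setT probability_setT.
under eq_bigr do rewrite ltnNge leq_addr/= addKn.
move=> <-; congr (pr _); apply/seteqP; split=> w /= h i ik.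
  by case: ltnP => // ji; rewrite -{2}(subnKC ji); apply: h; rewrite ltn_subLR.
by have := h (j + i)%N; rewrite ltn_add2l [(j + i < j)%N]ltnNge leq_addr/= addKn; apply.
Qed.

Lemma iid_marginal i B : pr (E i @^-1` B) = pr (E 0 @^-1` B).
Proof.
have := iid_window i 1 (fun=> B); rewrite big_ord1 => <-; congr (pr _).
apply/seteqP; split=> w /= h; last by have := h 0%N; rewrite addn0; apply.
by case=> // _; rewrite addn0.
Qed.

Lemma iid_pair_le i j B : pr (E i @^-1` B `&` E j @^-1` B) <=
  pr (E 0 @^-1` B) *+ (i == j) + pr (E 0 @^-1` B) ^+ 2.
Proof.
wlog ij : i j / (i <= j)%N.
  move=> H; have [/H//|/ltnW/H] := leqP i j.
  by rewrite eq_sym setIC.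
have [->|ne] := eqVneq i j; first by rewrite setIid iid_marginal lerDl sqr_ge0.
rewrite add0r.
have [n jE] : exists n, j = (i + n.+1)%N.
  by exists (j - i).-1; rewrite prednK ?subnKC// subn_gt0 ltn_neqAle ne.
have := iid_window i n.+2 (fun m => if (m == 0%N) || (m == n.+1) then B else setT).
rewrite big_ord_recl big_ord_recr/= eqxx [X in _ * (X * _)]big1 ?mul1r; last first.
  by move=> k _; rewrite /= /bump/= add1n eqSS ltn_eqF ?ltn_ord// preimage_setT probability_setT.
rewrite -expr2 => <-; rewrite jE le_eqVlt; apply/orP; left; apply/eqP.
congr (pr _); apply/seteqP; split=> w /=.
  move=> [h1 h2] k _; case: eqP => [->|_] /=; first by rewrite addn0.
  by case: eqP => // ->.
by move=> h; split; [have := h 0%N; rewrite addn0; apply|have := h n.+1; rewrite eqxx orbT; apply].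
Qed.

Local Notation count B n w := (\sum_(i < n) \1_(E i @^-1` B) w : R).

Lemma integral_indic_pr (A : set T) : measurable A -> (\int[P]_w (\1_A w)%:E = (pr A)%:E)%E.
Proof. by move=> mA; rewrite integral_indic// setIT -prE. Qed.

Lemma measurable_count B n : measurable_fun setT (fun w => count B n w).
Proof. by apply: measurable_sum => i; exact: measurable_indic. Qed.

Lemma count_variance B n (p := pr (E 0 @^-1` B)) :
  (\int[P]_w ((count B n w - n%:R * p) ^+ 2)%:E <= (n%:R * p)%:E)%E.
Proof.
have p0 : 0 <= p by exact: pr_ge0.
have np0 : 0 <= n%:R * p by rewrite mulr_ge0.
have c0 w : 0 <= count B n w by exact: sumr_ge0.
have mc := measurable_count B n.
have int1 : (\int[P]_w (count B n w)%:E = (n%:R * p)%:E)%E.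
  under eq_integral do rewrite -sumEFin.
  rewrite ge0_integral_sum//; last first.
    by move=> i; apply/measurable_EFinP; exact: measurable_indic.
  under eq_bigr => i _ do rewrite integral_indic_pr// iid_marginal.
  by rewrite sumEFin sumr_const card_ord mulr_natl.
have int2 : (\int[P]_w ((count B n w) ^+ 2)%:E <= (n%:R * p + (n%:R * p) ^+ 2)%:E)%E.
  have -> : (fun w => ((count B n w) ^+ 2)%:E) =
      (fun w => \sum_(i < n) \sum_(j < n) (\1_(E i @^-1` B `&` E j @^-1` B) w)%:E)%E.
    apply/funext => w; rewrite expr2 mulr_suml -sumEFin; apply: eq_bigr => i _.
    by rewrite mulr_sumr -sumEFin; apply: eq_bigr => j _; rewrite indicI.
  rewrite ge0_integral_sum//; last 2 first.
  - move=> i; apply: emeasurable_sum => j; apply/measurable_EFinP.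
    by apply: measurable_indic; exact: measurableI.
  - by move=> i w _; apply: sume_ge0 => j _; rewrite lee_fin.
  apply: (@le_trans _ _ (\sum_(i < n) \sum_(j < n) (p *+ (i == j) + p ^+ 2)%:E)%E).
    apply: lee_sum => i _; rewrite ge0_integral_sum//; last first.
      by move=> j; apply/measurable_EFinP; apply: measurable_indic; exact: measurableI.
    apply: lee_sum => j _; rewrite integral_indic_pr//; last exact: measurableI.
    by rewrite lee_fin; exact: iid_pair_le.
  under eq_bigr => i _ do rewrite sumEFin.
  rewrite sumEFin lee_fin.
  have -> : \sum_(i < n) \sum_(j < n) (p *+ (i == j) + p ^+ 2) =
      \sum_(i < n) (p + n%:R * p ^+ 2).
    apply: eq_bigr => i _; rewrite big_split/= sumr_const card_ord mulr_natl; congr (_ + _).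
    rewrite (bigD1 i)//= eqxx big1 ?addr0// => j ji.
    by rewrite eq_sym (negbTE ji).
  by rewrite sumr_const card_ord -[leLHS]mulr_natl mulrDr exprMn mulrA.
have mq : measurable_fun setT (fun w => ((count B n w - n%:R * p) ^+ 2)%:E).
  by apply/measurable_EFinP; apply: measurable_funX; apply: measurable_funB.
(* (N - np)^2 + 2np N = N^2 + (np)^2, where every integrand is nonnegative *)
have split : (\int[P]_w ((count B n w - n%:R * p) ^+ 2)%:E + (2 * (n%:R * p) ^+ 2)%:E =
    \int[P]_w ((count B n w) ^+ 2)%:E + ((n%:R * p) ^+ 2)%:E)%E.
  transitivity (\int[P]_w ((count B n w - n%:R * p) ^+ 2 + (2 * (n%:R * p)) * count B n w)%:E)%E.
    under [RHS]eq_integral do rewrite EFinD [X in (_ + X)%E]EFinM.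
    rewrite ge0_integralD//; last 3 first.
    - by move=> w _; rewrite lee_fin sqr_ge0.
    - by move=> w _; rewrite -EFinM lee_fin mulr_ge0// mulr_ge0.
    - by apply/measurable_EFinP; exact: measurable_funM.
    rewrite ge0_integralZl//; last 3 first.
    - exact/measurable_EFinP.
    - by move=> w _; rewrite lee_fin.
    - by rewrite lee_fin mulr_ge0.
    by rewrite int1 -EFinM expr2 !mulrA.
  transitivity (\int[P]_w ((count B n w) ^+ 2 + (n%:R * p) ^+ 2)%:E)%E.
    by apply: eq_integral => w _; congr (_%:E); ring.
  under [LHS]eq_integral do rewrite EFinD.
  rewrite ge0_integralD//; last 3 first.
  - by move=> w _; rewrite lee_fin sqr_ge0.
  - by apply/measurable_EFinP; exact: measurable_funX.
  - by move=> w _; rewrite lee_fin sqr_ge0.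
  by rewrite integral_cst// [X in (_ * X)%E]probability_setT mule1.
rewrite -(@leeD2rE _ (2 * (n%:R * p) ^+ 2)%:E)// split.
apply: (le_trans (leeD2r _ int2)); rewrite -!EFinD lee_fin.
by rewrite mulr2n mulrDl mul1r addrA.
Qed.

Lemma frequency B : {ae P, forall w, count B n w / n%:R @[n --> \oo] --> pr (E 0 @^-1` B)}.
Proof.
set p := pr (E 0 @^-1` B).
have p0 : 0 <= p by exact: pr_ge0.
have p1 : p <= 1 by exact: pr_le1.
pose D (e : R) k := [set w | e * k.+1%:R ^+ 2 <= `|count B (k.+1 ^ 2) w - k.+1%:R ^+ 2 * p|].
have mD e k : measurable (D e k).
  have mf : measurable_fun setT (fun w => `|count B (k.+1 ^ 2) w - k.+1%:R ^+ 2 * p|).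
    apply: measurableT_comp => //; apply: measurable_funB => //; exact: measurable_count.
  have -> : D e k = (fun w => `|count B (k.+1 ^ 2) w - k.+1%:R ^+ 2 * p|) @^-1` `[e * k.+1%:R ^+ 2, +oo[%classic.
    by apply/seteqP; split=> w /=; rewrite in_itv/= andbT.
  by rewrite -[X in measurable X]setTI; exact: mf.
have prD (e : R) k : 0 < e -> pr (D e k) <= e ^- 2 * k.+1%:R `^ (- (1 + 1)).
  move=> e0; have k0 : 0 < k.+1%:R :> R by rewrite ltr0n.
  have -> : k.+1%:R `^ (- (1 + 1)) = (k.+1%:R ^+ 2)^-1 :> R.
    by rewrite powRN -(powR_mulrn 2 (ltW k0)).
  have q0 : 0 < k.+1%:R ^+ 2 :> R by rewrite exprn_gt0.
  rewrite ler_pdivlMr// -[leRHS]mulr1 ler_pdivlMl ?exprn_gt0// -(ler_pM2r q0) mul1r.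
  rewrite (_ : _ * _ * _ = (e * k.+1%:R ^+ 2) ^+ 2 * pr (D e k)); last by ring.
  rewrite -lee_fin EFinM -(prE P (mD _ _)) -integral_cst//.
  have V := count_variance B (k.+1 ^ 2).
  rewrite -/p natrX in V.
  apply: (le_trans (le_trans _ V)); last by rewrite lee_fin ler_piMr// ltW.
  have mq : measurable_fun setT (fun w => ((count B (k.+1 ^ 2) w - k.+1%:R ^+ 2 * p) ^+ 2)%:E).
    by apply/measurable_EFinP; apply: measurable_funX; apply: measurable_funB => //; exact: measurable_count.
  apply: (@le_trans _ _ (\int[P]_(w in D e k) ((count B (k.+1 ^ 2) w - k.+1%:R ^+ 2 * p) ^+ 2)%:E)%E).
    apply: ge0_le_integral => //.
    - by move=> w _; rewrite lee_fin sqr_ge0.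
    - exact: measurable_funTS.
    - move=> w; rewrite /D/= => h; rewrite lee_fin -[leRHS]real_normK ?num_real//.
      by rewrite lerXn2r ?nnegrE ?normr_ge0// mulr_ge0// ltW.
  by apply: ge0_subset_integral => // w _; rewrite lee_fin sqr_ge0.
have [b hb] := @pseries_bound R 1 ltr01.
have H (e : R) : 0 < e -> {ae P, forall w, exists k, forall n, (k <= n)%N -> ~ D e n w}.
  move=> e0; apply: (@borel_cantelli _ _ _ P (D e) (fun k => e ^- 2 * k.+1%:R `^ (- (1 + 1))) 0 (e ^- 2 * b)) => //.
  - by move=> k; rewrite mulr_ge0 ?powR_ge0// invr_ge0 sqr_ge0.
  - by move=> k _; exact: prD.
  - by move=> n; rewrite -mulr_sumr ler_wpM2l ?invr_ge0 ?sqr_ge0.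
have : {ae P, forall w, forall m : nat, exists k, forall n, (k <= n)%N -> ~ D m.+1%:R^-1 n w}.
  by apply: ae_foralln => m; apply: H; rewrite invr_gt0.
apply: filterS => w hw; apply: square_interpolation => //.
  move=> m n mn; rewrite -(big_mkord xpredT (fun i => \1_(E i @^-1` B) w)).
  rewrite -(big_mkord xpredT (fun i => \1_(E i @^-1` B) w)).
  by rewrite [leRHS](@big_cat_nat _ _ _ m)//= lerDl sumr_ge0.
move=> e e0; have [k hk] := hw (Num.truncn e^-1).
exists k => n kn; have /= := hk n kn; rewrite /D/= => /negP; rewrite -ltNge => /ltW h.
apply: (le_trans h); rewrite ler_wpM2r ?sqr_ge0// invf_ple ?posrE//.
exact/ltW/truncnS_gt.
Qed.

Lemma integral_marginal i g : (forall k, 0 <= g k) ->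
  (\int[P]_w (g (E i w))%:E = \int[P]_w (g (E 0 w))%:E)%E.
Proof.
move=> g0.
have mEf j : measurable_fun setT (E j) by move=> _ B _; rewrite setTI; exact: mE.
have H j : (\int[P]_w (g (E j w))%:E = \int[pushforward P (E j)]_k (g k)%:E)%E.
  by rewrite ge0_integral_pushforward// => k _; rewrite lee_fin.
rewrite !H; apply: eq_measure_integral => B _ _; change (P (E i @^-1` B) = P (E 0 @^-1` B)).
by rewrite (prE P (mE i B)) (prE P (mE 0 B)) iid_marginal.
Qed.

Lemma measurable_fun_iid i g D : measurable_fun D (fun w => g (E i w)).
Proof.
apply: (@measurable_funTS _ _ _ _ D) => _ B _; rewrite setTI.
exact: (mE i (g @^-1` B)).
Qed.

Lemma large_average_window N lam g j w :
  large_average N lam (fun i => g (E i w)) j <->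
  [set l : seq nat | large_average N lam (fun i => g (nth 0%N l i)) 0%N] [seq E (j + i)%N w | i <- iota 0 N].
Proof.
have H n : (n <= N)%N -> \sum_(j <= k < j + n) g (E k w) =
    \sum_(0 <= k < 0 + n) g (nth 0%N [seq E (j + i)%N w | i <- iota 0 N] k).
  move=> nN; rewrite [(j + n)%N]addnC (sum_shift (fun k => g (E k w))) [(0 + n)%N]add0n big_mkord.
  apply: eq_bigr => i _; have iN := leq_trans (ltn_ord i) nN.
  by rewrite (nth_map 0%N) ?size_iota// nth_iota// add0n addnC.
by split=> -[n [/andP[n0 nN] hn]]; exists n; rewrite n0 nN; split => //; [rewrite -H|rewrite H].
Qed.

Lemma measurable_window N j (l : seq nat) :
  measurable ((fun w => [seq E (j + i)%N w | i <- iota 0 N]) @^-1` [set l]).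
Proof.
elim: N j l => [|N IH] j l; first by apply: measurable_countable_valued => v /=;
  have [->|h] := pselect ([::] = v); [rewrite (_ : _ @^-1` _ = setT)//; apply/seteqP; split
  |rewrite (_ : _ @^-1` _ = set0)//; apply/seteqP; split].
case: l => [|a l]; first by rewrite (_ : _ @^-1` _ = set0)//; apply/seteqP; split.
rewrite (_ : _ @^-1` _ = E j @^-1` [set a] `&`
  (fun w => [seq E (j.+1 + i)%N w | i <- iota 0 N]) @^-1` [set l]); first exact: measurableI.
have e w : [seq E (j + i)%N w | i <- iota 1 N] = [seq E (j.+1 + i)%N w | i <- iota 0 N].
  by rewrite (iotaDl 1 0) -map_comp; apply: eq_map => i /=; rewrite add1n addSnnS.
by apply/seteqP; split=> w /=; rewrite e addn0 => -[-> ->].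
Qed.

Lemma large_average_stationary N lam g j :
  measurable [set w | large_average N lam (fun i => g (E i w)) j] /\
  pr [set w | large_average N lam (fun i => g (E i w)) j] =
  pr [set w | large_average N lam (fun i => g (E i w)) 0%N].
Proof.
pose W j w := [seq E (j + i)%N w | i <- iota 0 N].
have e i : [set w | large_average N lam (fun i => g (E i w)) i] =
    W i @^-1` [set l : seq nat | large_average N lam (fun i => g (nth 0%N l i)) 0%N].
  by apply/seteqP; split=> w; [move=> /large_average_window|move=> h; apply/large_average_window].
split; first by rewrite e; apply: measurable_countable_valued; exact: measurable_window.
rewrite !e; congr fine; apply: eq_countable_law; try exact: measurable_window.
move=> l; have [sl|sl] := eqVneq (size l) N; last first.
  have e0 i : W i @^-1` [set l] = set0.
    by apply/seteqP; split => // w /= h; move: sl; rewrite -h size_map size_iota eqxx.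
  by rewrite !e0.
have eW i : W i @^-1` [set l] = [set w | forall m, (m < N)%N -> [set nth 0%N l m] (E (i + m)%N w)].
  apply/seteqP; split=> w /=.
    by move=> <- m mN; rewrite (nth_map 0%N) ?size_iota// nth_iota.
  move=> h; apply: (@eq_from_nth _ 0%N); rewrite size_map size_iota// => m mN.
  by rewrite (nth_map 0%N) ?size_iota// nth_iota// add0n h.
have mW i : measurable (W i @^-1` [set l]) := measurable_window N i l.
by rewrite (prE P (mW j)) (prE P (mW 0%N)) !eW !(iid_window _ N (fun m => [set nth 0%N l m])).
Qed.

Lemma maximal_inequality N lam g : 0 <= lam -> (forall k, 0 <= g k) ->
  (\int[P]_w (g (E 0 w))%:E < +oo)%E ->
  lam * pr [set w | large_average N lam (fun i => g (E i w)) 0%N] <= fine (\int[P]_w (g (E 0 w))%:E)%E.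
Proof.
move=> lam0 g0 goo; set A := fun j => [set w | large_average N lam (fun i => g (E i w)) j].
set m := fine (\int[P]_w _)%E.
have mA j : measurable (A j) := (large_average_stationary N lam g j).1.
have prA j : pr (A j) = pr (A 0%N) := (large_average_stationary N lam g j).2.
have intE i : (\int[P]_w (g (E i w))%:E = m%:E)%E.
  rewrite integral_marginal// /m fineK// ge0_fin_numE//.
  by apply: integral_ge0 => w _; rewrite lee_fin.
have m0 : 0 <= m by apply: fine_ge0; apply: integral_ge0 => w _; rewrite lee_fin.
have H M : M%:R * (lam * pr (A 0%N)) <= (M + N)%:R * m.
  have e1 : (\int[P]_w (lam * \sum_(i < M) \1_(A i) w)%:E = (M%:R * (lam * pr (A 0%N)))%:E)%E.
    under eq_integral do rewrite EFinM.
    rewrite ge0_integralZl//; last 2 first.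
    - by apply/measurable_EFinP; apply: measurable_sum => i; exact: measurable_indic.
    - by move=> w _; rewrite lee_fin sumr_ge0.
    under eq_integral do rewrite -sumEFin.
    rewrite ge0_integral_sum//; last first.
      by move=> i; apply/measurable_EFinP; exact: measurable_indic.
    under eq_bigr => i _ do rewrite integral_indic_pr// prA.
    by rewrite sumEFin sumr_const card_ord -EFinM mulrCA mulr_natl.
  have e2 : (\int[P]_w (\sum_(i < M + N) g (E i w))%:E = ((M + N)%:R * m)%:E)%E.
    under eq_integral do rewrite -sumEFin.
    rewrite ge0_integral_sum//; last 2 first.
    - by move=> i; apply/measurable_EFinP; exact: measurable_fun_iid.
    - by move=> i w _; rewrite lee_fin.
    under eq_bigr => i _ do rewrite intE.
    by rewrite sumEFin sumr_const card_ord mulr_natl.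
  rewrite -lee_fin -e1 -e2; apply: ge0_le_integral => //.
  - by move=> w _; rewrite lee_fin mulr_ge0// sumr_ge0.
  - apply/measurable_EFinP; apply: measurable_funM => //.
    by apply: measurable_sum => i; exact: measurable_indic.
  - by apply/measurable_EFinP; apply: measurable_sum => i; exact: measurable_fun_iid.
  - move=> w _; rewrite lee_fin.
    have := @large_average_count R N lam (fun i => g (E i w)) M 0 lam0 (fun=> g0 _).
    rewrite add0n !big_mkord; by apply: le_trans; apply: ler_wpM2l.
rewrite leNgt; apply/negP; rewrite -subr_gt0; set dl := _ - m => dl0.
have := H (Num.truncn (N%:R * m / dl)).+1; apply/negP; rewrite -ltNge natrD mulrDl -ltrBrDl -mulrBr.
by rewrite -ltr_pdivrMr//; exact: truncnS_gt.
Qed.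

Lemma strong_law_discrete g : (forall k, 0 <= g k) ->
  (\int[P]_w (g (E 0 w))%:E < +oo)%E ->
  {ae P, forall w, (\sum_(i < n) g (E i w)) / n%:R @[n --> \oo]
     --> fine (\int[P]_w (g (E 0 w))%:E)%E}.
Proof.
move=> g0 goo; set m := fine _.
have m0 : 0 <= m by apply: fine_ge0; apply: integral_ge0 => w _; rewrite lee_fin.
have intE : (\int[P]_w (g (E 0 w))%:E = m%:E)%E.
  by rewrite /m fineK// ge0_fin_numE//; apply: integral_ge0 => w _; rewrite lee_fin.
pose p k := pr (E 0 @^-1` [set k]).
pose mK K := \sum_(k < K) g k * p k.
pose lo K k := if (k < K)%N then g k else 0.
pose hi K k := if (k < K)%N then 0 else g k.
have lo0 K k : 0 <= lo K k by rewrite /lo; case: ifP.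
have hi0 K k : 0 <= hi K k by rewrite /hi; case: ifP.
have loE K i w : lo K (E i w) = \sum_(k < K) g k * \1_(E i @^-1` [set (k : nat)]) w.
  rewrite /lo; case: ltnP => h.
    rewrite (bigD1 (Ordinal h))//= big1 ?addr0.
      by rewrite indicE mem_set//= mulr1.
    move=> k kE; rewrite indicE memNset ?mulr0//= => e; case/eqP: kE; exact/val_inj.
  rewrite big1// => k _; rewrite indicE memNset ?mulr0//= => e.
  by move: h; rewrite e leqNgt ltn_ord.
have intlo K : (\int[P]_w (lo K (E 0 w))%:E = (mK K)%:E)%E.
  under eq_integral do rewrite loE -sumEFin.
  rewrite ge0_integral_sum//; last 2 first.
  - move=> k; apply/measurable_EFinP; apply: measurable_funM => //; exact: measurable_indic.
  - by move=> k w _; rewrite lee_fin mulr_ge0.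
  rewrite /mK -sumEFin; apply: eq_bigr => k _.
  under eq_integral do rewrite EFinM.
  rewrite ge0_integralZl ?lee_fin//; last by apply/measurable_EFinP; exact: measurable_indic.
  by rewrite integral_indic_pr// EFinM.
have inthi K : (\int[P]_w (hi K (E 0 w))%:E = (m - mK K)%:E)%E.
  rewrite EFinB -intE -intlo.
  have -> : (\int[P]_w (g (E 0 w))%:E = \int[P]_w (lo K (E 0 w))%:E + \int[P]_w (hi K (E 0 w))%:E)%E.
    rewrite -ge0_integralD//; last 4 first.
    - by move=> w _; rewrite lee_fin.
    - by apply/measurable_EFinP; exact: measurable_fun_iid.
    - by move=> w _; rewrite lee_fin.
    - by apply/measurable_EFinP; exact: measurable_fun_iid.
    by apply: eq_integral => w _; rewrite -EFinD /lo /hi; case: ifP; rewrite ?addr0 ?add0r.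
  by rewrite intlo addeAC subee// add0e.
have cvgmK : mK K @[K --> \oo] --> m.
  suff : (mK K)%:E @[K --> \oo] --> m%:E by move/fine_cvgP => [].
  rewrite -intE; under eq_fun do rewrite -intlo.
  have := @cvg_monotone_convergence _ T R P setT measurableT (fun K w => (lo K (E 0 w))%:E).
  have -> : (fun w => limn (fun K => (lo K (E 0 w))%:E)) = (fun w => (g (E 0 w))%:E).
    apply/funext => w; apply: lim_near_cst => //; near=> K.
    by rewrite /lo ifT//; near: K; exact: nbhs_infty_gt.
  apply.
  - by move=> K; apply/measurable_EFinP; exact: measurable_fun_iid.
  - by move=> K w _; rewrite lee_fin.
  - move=> w _ K K' KK'; rewrite lee_fin /lo; case: ifP => [h|_].
      by rewrite (leq_trans h KK').
    by case: ifP.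
pose A (e : R) K N := [set w | large_average N e (fun i => hi K (E i w)) 0%N].
have mA e K N : measurable (A e K N) := (large_average_stationary N e (hi K) 0).1.
pose G (e : R) := \bigcap_K \bigcup_N A e K N.
have G0 (e : R) : 0 < e -> P.-negligible (G e).
  move=> e0; have mU K : measurable (\bigcup_N A e K N) by exact: bigcup_measurable.
  exists (G e); split => //; first exact: bigcap_measurable.
  have hU K : (P (\bigcup_N A e K N) <= (e^-1 * (m - mK K))%:E)%E.
    have := @nondecreasing_cvg_mu _ T R P (A e K) (mA e K) (mU K).
    move=> /(_ _)/cvg_lim <-//.
      apply: lime_le.
        apply: ereal_nondecreasing_is_cvgn => n n' nn'; apply: le_measure; rewrite ?inE//.
        by move=> w [k [/andP[k0 kn] h]]; exists k; rewrite k0 (leq_trans kn).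
      apply: nearW => N /=; rewrite (prE P (mA e K N)) lee_fin ler_pdivlMl//.
      have := @maximal_inequality N e (hi K) (ltW e0) (hi0 K).
      by rewrite inthi/= ltry; apply.
    move=> n n' nn'; apply/subsetPset => w [k [/andP[k0 kn] h]].
    by exists k; rewrite k0 (leq_trans kn).
  apply/eqP; rewrite eq_le measure_ge0 andbT.
  have hc : (e^-1 * (m - mK K))%:E @[K --> \oo] --> 0%:E.
    apply: cvg_EFin; first exact: nearW.
    rewrite -[X in _ --> X](mulr0 e^-1) -(subrr m); apply: cvgMr.
    by apply: cvgB => //; exact: cvg_cst.
  apply: (@le_trans _ _ (limn (fun K => (e^-1 * (m - mK K))%:E))); last by rewrite (cvg_lim _ hc).
  apply: lime_ge; first by apply/cvg_ex; eexists; exact: hc.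
  apply: nearW => K; apply: le_trans (hU K); apply: le_measure; rewrite ?inE//.
    exact: bigcap_measurable.
  by move=> w /(_ K I).
have h1 : {ae P, forall w, forall k : nat, (\sum_(i < n) \1_(E i @^-1` [set k]) w) / n%:R @[n --> \oo] --> p k}.
  by apply: ae_foralln => k; exact: frequency.
have h2 : {ae P, forall w, forall j : nat, ~ G j.+1%:R^-1 w}.
  apply: ae_foralln => j; apply: negligibleS (G0 j.+1%:R^-1 _) => //.
    by move=> w /= /contrapT.
move: h1 h2; apply: filterS2 => w h1 h2.
have cl K : (\sum_(i < n) lo K (E i w)) / n%:R @[n --> \oo] --> mK K.
  under eq_fun => n.
    under eq_bigr do rewrite loE.
    rewrite exchange_big/= mulr_suml; under eq_bigr do rewrite -mulr_sumr -mulrA.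
    over.
  rewrite /mK; apply: (@cvg_sum_ord _ (fun k n => g k * ((\sum_(i < n) \1_(E i @^-1` [set k]) w) / n%:R))
    (fun k => g k * p k)) => k; apply: cvgMr; exact: h1.
apply/cvgrPdist_le => e e0.
have e2 : 0 < e / 2 by rewrite divr_gt0.
pose j := Num.truncn (e / 2)^-1.
have [K hK] : exists K, forall N, ~ A j.+1%:R^-1 K N w.
  apply: contrapT => /forallNP H; apply: (h2 j) => K _; have /existsNP[N hN] := H K.
  by exists N => //; exact: contrapT.
have : \forall K' \near \oo, m - mK K' <= e / 2.
  move/cvgrPdist_le : cvgmK => /(_ _ e2); apply: filterS => K'.
  by apply: le_trans; exact: ler_norm.
move=> [K' _ /(_ K' (leqnn _)) hK'].
have mKm : mK K <= m.
  rewrite -subr_ge0 -lee_fin -inthi; apply: integral_ge0 => w' _; rewrite lee_fin//.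
have /cvgrPdist_le/(_ _ e2) n1 := cl K.
have /cvgrPdist_le/(_ _ e2) n2 := cl K'.
near=> n.
have n0 : (0 < n)%N by near: n; exact: nbhs_infty_gt.
have nn0 : 0 < n%:R :> R by rewrite ltr0n.
have u1 : `|mK K - (\sum_(i < n) lo K (E i w)) / n%:R| <= e / 2 by near: n.
have u2 : `|mK K' - (\sum_(i < n) lo K' (E i w)) / n%:R| <= e / 2 by near: n.
have u3 : (\sum_(i < n) hi K (E i w)) / n%:R <= e / 2.
  apply: (@le_trans _ _ j.+1%:R^-1); last first.
    by rewrite invf_ple ?posrE//; exact/ltW/truncnS_gt.
  rewrite ler_pdivrMr// leNgt; apply/negP => h; apply: (hK n); exists n.
  by rewrite n0 leqnn add0n big_mkord.
have u4 : (\sum_(i < n) g (E i w)) / n%:R =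
    (\sum_(i < n) lo K (E i w)) / n%:R + (\sum_(i < n) hi K (E i w)) / n%:R.
  rewrite -mulrDl -big_split/=; congr (_ / _); apply: eq_bigr => i _.
  by rewrite /lo /hi; case: ifP; rewrite ?addr0 ?add0r.
have u5 : (\sum_(i < n) lo K' (E i w)) / n%:R <= (\sum_(i < n) g (E i w)) / n%:R.
  rewrite ler_pM2r ?invr_gt0//; apply: ler_sum => i _.
  by rewrite /lo; case: ifP.
move: u1 u2 => /ler_normlP[u1 _] /ler_normlP[_ u2].
apply/ler_normlP; split; move: u1 u2 u3 u4 u5 hK' mKm.
  clear; lra.
clear; lra.
Unshelve. all: by end_near.
Qed.

End strong_law.

(** * Excursions *)

Section excursion_times.
Context {d : measure_display} {T : measurableType d} {R : realType}.
Variables (P : probability T R) (S : set R) (F : nat -> set (set T)) (X : nat -> T -> R).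
Hypotheses (hA0 : A0 P S F X).
Implicit Types (s t k n : nat) (w : T) (h : R -> R).
Local Notation pr A := (fine (P A)).

Lemma next_zeroP s w k : next_zero X s w = Some k <->
  [/\ (s < k)%N, X k w = 0 & forall j, (s < j < k)%N -> X j w <> 0].
Proof.
rewrite /next_zero; case: pselect => h.
  case: ex_minnP => m /andP[sm /asboolP Xm] hm; split.
    move=> [<-]; split=> // j /andP[sj jm] Xj.
    by have := hm j; rewrite sj /= asboolT// leqNgt jm => /(_ isT).
  move=> [sk Xk hk]; congr Some; apply/eqP; rewrite eqn_leq (hm k) ?sk ?asboolT//=.
  by rewrite leqNgt; apply/negP => mk; apply: (hk m) => //; rewrite sm mk.
by split => // -[sk Xk _]; exfalso; apply: h; exists k.
Qed.

Lemma tau_gt0 n w k : tau X n w = Some k -> (0 < k)%N.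
Proof.
case: n => [[<-]//|n] /=; case: tau => // s /next_zeroP[sk _ _].
exact: leq_ltn_trans sk.
Qed.

Lemma measurable_next_zero s k : (0 < s)%N -> measurable [set w | next_zero X s w = Some k].
Proof.
move=> s0; have [sk|ks] := ltnP s k; last first.
  rewrite (_ : [set w | _] = set0)//; apply/seteqP; split => // w /= /next_zeroP[].
  by rewrite ltnNge ks.
have k0 : (0 < k)%N by exact: leq_ltn_trans sk.
rewrite (_ : [set w | _] = X k @^-1` [set 0%R] `&`
    \bigcap_(j in [set j | (s < j < k)%N]) (X j @^-1` [set~ 0])); last first.
  by apply/seteqP; split=> w /= => [/next_zeroP[]//|[Xk hk]]; apply/next_zeroP.
apply: measurableI; first exact: (measurable_X hA0).
apply: bigcap_measurableType => j /= /andP[sj _]; apply: (measurable_X hA0).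
exact: leq_ltn_trans sj.
Qed.

Lemma measurable_tau n k : measurable [set w | tau X n w = Some k].
Proof.
elim: n k => [|n IH] k.
  have [->|h] := eqVneq k 1%N; first by rewrite (_ : [set w | _] = setT)//; apply/seteqP; split.
  rewrite (_ : [set w | _] = set0)//; apply/seteqP; split => // w /= [] e.
  by rewrite -e eqxx in h.
rewrite (_ : [set w | _] = \bigcup_(s in [set s | (0 < s)%N])
    ([set w | tau X n w = Some s] `&` [set w | next_zero X s w = Some k])); last first.
  apply/seteqP; split=> w /=.
    by case E : (tau X n w) => [s|]// h; exists s => //=; exact: tau_gt0 E.
  by move=> [s s0 /= [-> ->]].
apply: bigcup_measurable => s /= s0; apply: measurableI => //.
exact: measurable_next_zero.
Qed.

Lemma measurable_tau_finite n : measurable [set w | tau X n w != None].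
Proof.
rewrite (_ : [set w | _] = \bigcup_k [set w | tau X n w = Some k]).
  by apply: bigcup_measurable => k _; exact: measurable_tau.
apply/seteqP; split=> w /=; last by move=> [k _ /= ->].
by case E : (tau X n w) => [k|]// _; exists k.
Qed.

Lemma measurable_N_infinite : measurable (N_infinite X).
Proof.
rewrite (_ : N_infinite X = \bigcap_n [set w | tau X n w != None]); last first.
  by apply/seteqP; split=> w /= h n => [_|]; [exact: h|exact: (h n I)].
by apply: bigcapT_measurable => n; exact: measurable_tau_finite.
Qed.

Lemma before_tau1P t w : before_tau1 X t w <-> forall i, (1 < i <= t)%N -> X i w <> 0.
Proof.
rewrite /before_tau1; case E : (tau X 1 w) => [k|].
  have /next_zeroP[k1 Xk hk] : next_zero X 1 w = Some k by exact: E.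
  split=> [tk i /andP[i1 it]|h].
    by apply: hk; rewrite i1 (leq_ltn_trans it).
  by rewrite ltnNge; apply/negP => kt; apply: (h k); rewrite ?k1.
split => // _ i /andP[i1 _] Xi; move: E; rewrite /= /next_zero.
by case: pselect => // h _; apply: h; exists i.
Qed.

Lemma measurable_before_tau1 t : measurable [set w | before_tau1 X t w].
Proof.
rewrite (_ : [set w | _] = ~` \bigcup_(k in [set k | (k <= t)%N]) [set w | tau X 1 w = Some k]).
  by apply: measurableC; apply: bigcup_measurable => k _; exact: measurable_tau.
apply/seteqP; split=> w /=; rewrite /before_tau1.
  by move=> h [k kt E]; move: h; rewrite (E : tau X 1 w = Some k) ltnNge (kt : (k <= t)%N).
case E : (tau X 1 w) => [k|]// h; rewrite ltnNge; apply/negP => kt; apply: h.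
by exists k.
Qed.

Definition exterm h t w : \bar R := (h (X t w) * (before_tau1 X t w)%:R)%:E.

Definition exsum h w : \bar R := (\sum_(1 <= t <oo) exterm h t w)%E.

Lemma xi1E alpha : xi1 X alpha = exsum (fun z => z `^ alpha).
Proof. by []. Qed.

Lemma eta1E : eta1 X = exsum (fun=> 1).
Proof. by apply/funext => w; apply: eq_eseriesr => t _; rewrite /exterm mul1r. Qed.

Lemma ell1E x : ell1 X x = exsum (fun z => (z == x)%:R).
Proof.
by apply/funext => w; apply: eq_eseriesr => t _; rewrite /exterm -natrM mulnb.
Qed.

Lemma measurable_exterm h t : (0 < t)%N -> measurable_fun setT (exterm h t).
Proof.
move=> t0; apply/measurable_EFinP; apply: measurable_funM.
  exact: (measurable_fun_X hA0 h).
have -> : (fun w => (before_tau1 X t w)%:R : R) = \1_[set w | before_tau1 X t w].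
  apply/funext => w; rewrite indicE; congr (_%:R); congr nat_of_bool.
  by apply/idP/idP => [?|]; rewrite ?inE.
by apply: measurable_indic; exact: measurable_before_tau1.
Qed.

Section nonnegative_functional.
Variable h : R -> R.
Hypothesis h0 : forall x, 0 <= h x.

Lemma exterm_ge0 t w : (0 <= exterm h t w)%E.
Proof. by rewrite lee_fin mulr_ge0. Qed.

Lemma exsum_ge0 w : (0 <= exsum h w)%E.
Proof. by apply: nneseries_ge0 => t _ _; exact: exterm_ge0. Qed.

Lemma exsum_addn w : exsum h w = (\sum_(t <oo) exterm h (t + 1) w)%E.
Proof. by rewrite /exsum (nneseries_addn 1 (fun t => exterm_ge0 t w)). Qed.

Lemma measurable_exsum : measurable_fun setT (exsum h).
Proof.
rewrite (_ : exsum h = fun w => (\sum_(t <oo | t \in xpredT) exterm h (t + 1) w)%E).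
  apply: (@ge0_emeasurable_sum _ _ _ setT (fun t => exterm h (t + 1)%N) xpredT).
    by move=> t w _ _; exact: exterm_ge0.
  by move=> t _; apply: measurable_exterm; rewrite addn1.
by apply/funext => w; rewrite exsum_addn.
Qed.

Lemma integral_exsum :
  (\int[P]_w exsum h w = \sum_(t <oo) \int[P]_w exterm h (t + 1) w)%E.
Proof.
under eq_integral do rewrite exsum_addn.
rewrite integral_nneseries//.
- by move=> t; apply: measurable_exterm; rewrite addn1.
- by move=> t w _; exact: exterm_ge0.
Qed.

Lemma exsum_excursion k w : tau X 1 w = Some k ->
  exsum h w = (\sum_(x <- excursion X 1 w) h x)%:E.
Proof.
move=> E; have k0 := tau_gt0 E.
rewrite /excursion E /= big_map -sumEFin /exsum.
rewrite (@nneseries_split _ _ 1 (k - 1)); last by move=> t _; exact: exterm_ge0.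
rewrite [X in (_ + X)%E]eseries0 ?adde0; last first.
  move=> t + _; rewrite subnKC// => kt; rewrite /exterm /before_tau1 E ltnNge kt/=.
  by rewrite mulr0.
rewrite subnKC// big_seq_cond [RHS]big_seq_cond; apply: eq_bigr => t; rewrite andbT.
rewrite mem_iota subnKC// => /andP[_ tk].
by rewrite /exterm /before_tau1 E tk mulr1.
Qed.

End nonnegative_functional.

End excursion_times.

Lemma Lmlog_subcritical (R : realType) (c s2 q e0 x : R) : expR 1 <= x -> 0 < e0 ->
  q * (c + (q - 1) * s2 / 2) = - (2 * e0) ->
  Lmlog c s2 q 0 x + e0 * mlog (q - 2) (0 - 1) x <= - (e0 * x `^ (q - 2)).
Proof.
move=> ex e00 hq; have l1 := ln_ge1 ex.
rewrite /Lmlog /mlog2 !mul0r !addr0.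
have h1 : mlog (q - 2) 0 x = x `^ (q - 2) by rewrite /mlog powRr0 mulr1.
have : mlog (q - 2) (0 - 1) x <= mlog (q - 2) 0 x by apply: mlog_le_ln => //; rewrite sub0r oppr_le0.
rewrite h1 -(ler_pM2l e00); move: (mlog _ _ _) (x `^ _) => a b ab.
have -> : c * (q * b) + s2 / 2 * (q * (q - 1) * b) = q * (c + (q - 1) * s2 / 2) * b.
  by field.
by rewrite hq; move: ab; clear; lra.
Qed.

Section excursion_moments.
Context {d : measure_display} {T : measurableType d} {R : realType}.
Variables (P : probability T R) (S : set R) (F : nat -> set (set T)) (X : nat -> T -> R).
Variables (c s2 p : R).
Hypotheses (hA0 : A0 P S F X) (hA1 : A1 P S F X) (hA2 : A2 P F X c s2).
Hypotheses (hMp : Mp P F X p) (p_gt2 : 2 < p).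
Implicit Types (t n : nat) (A B : set T) (x y z : R).
Local Notation pr A := (fine (P A)).
Local Notation D := [set z : R | z <> 0].
Local Notation W := (stopped X 2 D).

Lemma start_zero : P (X 1 @^-1` [set 0%R]) = 1%E.
Proof. by have [_ [_ _ _ ?]] := hA0. Qed.

Lemma start_nonzero : pr (~` (X 1 @^-1` [set 0%R])) = 0.
Proof.
rewrite probability_setC; last exact: (measurable_X hA0).
by rewrite [X in (_ - X)%E]start_zero subee.
Qed.

Lemma integral_start (f : T -> \bar R) : measurable_fun setT f -> (forall w, 0 <= f w)%E ->
  (\int[P]_w f w = \int[P]_(w in X 1 @^-1` [set 0%R]) f w)%E.
Proof.
move=> mf f0; have mX : measurable (X 1 @^-1` [set 0%R]) by exact: (measurable_X hA0).
rewrite -(setUv (X 1 @^-1` [set 0%R])) ge0_integral_setU//.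
- rewrite [X in (_ + X)%E]integral_null ?adde0//; first exact: measurableC.
  exact: start_nonzero.
- exact: measurableC.
- exact: measurable_funTS.
- by apply/disj_set2P; rewrite setICr.
Qed.

(* The walk is stopped at its first zero after time 1; as X_1 = 0, it is started at time 2. *)
Lemma excursion_occupation alpha : 0 <= alpha -> alpha + 2 <= p -> c + (alpha + 1) * s2 / 2 < 0 ->
  exists C : R, forall n,
    (\sum_(j < n) \int[P]_(w in W j @^-1` D) (W j w `^ alpha)%:E <= C%:E)%E.
Proof.
move=> a0 ap hc; set q := alpha + 2.
have q0 : 0 < q by rewrite ltr_wpDl.
have q1 : 1 <= q by rewrite (@le_trans _ _ 2) ?ler1n// lerDr.
pose e0 := - (q * (c + (q - 1) * s2 / 2)) / 2.
have qe : alpha + 1 = q - 1 by rewrite /q; ring.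
have e00 : 0 < e0 by rewrite divr_gt0// oppr_gt0 pmulr_rlt0// -qe.
have hq : q * (c + (q - 1) * s2 / 2) = - (2 * e0) by rewrite /e0; field.
have u01 : -1 <= (0 : R) <= 0 by rewrite lexx oppr_le0 ler01.
have [x0 [C0 [ex0 C00 hx0]]] := drift_upper hA0 hA2 hMp p_gt2 q1 ap u01 e00.
have x00 : 0 < x0 by rewrite (lt_le_trans _ ex0)// expR_gt0.
have ex0' x : x0 <= x -> expR 1 <= x.
  by move=> h; rewrite (le_trans _ h)// (le_trans _ ex0)// ler_expR ler1n.
pose f := ftop q 0; pose a z := e0 * z `^ alpha.
pose b (z : R) := if x0 <= z then 0 else C0 + e0 * x0 `^ alpha.
have Cb : 0 <= C0 + e0 * x0 `^ alpha by rewrite addr_ge0// mulr_ge0 ?powR_ge0// ltW.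
have a_ge0 z : 0 <= a z by rewrite mulr_ge0 ?powR_ge0// ltW.
have b_ge0 z : 0 <= b z by rewrite /b; case: ifP.
have hD : drift_le P S F X D f a b.
  move=> t x A t0 Sx _ FA Ax; have mA := F_measurable hA0 t0 FA.
  apply: (le_trans (leeD2r _ (hx0 t x A t0 Sx FA Ax))).
  rewrite (prE P mA) -!EFinM -EFinD lee_fin -mulrDl ler_wpM2r ?pr_ge0// /b.
  case: ifPn => [x0x|].
    rewrite addr0 /f /ftop max_l ?ex0'// -addrA -addrA gerDl addrA.
    have := Lmlog_subcritical (ex0' _ x0x) e00 hq.
    have -> : a x = e0 * x `^ (q - 2) by rewrite /a /q addrK.
    by move=> hL; have := lerD hL (lexx (e0 * x `^ (q - 2))); rewrite addNr; exact.
  rewrite -ltNge => xx0; rewrite addrA -[leRHS]addrA addrCA addrA.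
  rewrite -addrA lerD2l -[leLHS]add0r lerD ?ftop_ge0// /a ler_wpM2l ?(ltW e00)//.
  by apply: ge0_ler_powR; rewrite ?nnegrE//; [exact: (state_ge0 hA0)|exact: ltW|exact: ltW].
have F20 : F 2 setT by exact: (F_setT hA0).
have [M [phi [phi0 hM]]] := irreducible_below hA0 x0 hA1 (y0 := 0) (let: conj (And4 _ _ _ h) _ := hA0 in h).
pose I2 := \sum_(i < M.+1) (i%:R : R).
have occ n : \sum_(j < n) pr (setT `&` W j @^-1` (D `&` [set x | x < x0])) <= I2 / phi.
  rewrite ler_pdivlMr// mulrC.
  apply: (le_trans (@time_below _ _ _ P S F X hA0 2 D isT M phi x0 0 setT n hM F20)).
  rewrite [X in X + _]big1 ?add0r; last first.
    move=> i _; apply: big1 => j _.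
    rewrite (_ : [set z | z <> 0] `&` [set 0%R] = set0); last by apply/seteqP; split=> z // [].
    by rewrite preimage_set0 setI0 measure0.
  by apply: ler_sum => i _; rewrite probability_setT mulr1.
have intX2 : (\int[P]_w (f (X 2 w))%:E <= C0%:E)%E.
  rewrite integral_start; last 2 first.
  - exact: (measurable_fun_X hA0 (fun z => (f z)%:E)).
  - by move=> w; rewrite lee_fin ftop_ge0.
  have S0 : S 0 by case: hA0 => -[].
  have := hx0 1%N 0 (X 1 @^-1` [set 0%R]) isT S0 (F_X hA0 _ (isT : (0 < 1)%N)) (fun _ h => h).
  rewrite [x0 <= 0]leNgt x00/= [X in (_ <= _ * X)%E]start_zero mule1; exact.
exists (e0^-1 * (C0 + (C0 + e0 * x0 `^ alpha) * (I2 / phi))) => n.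
have mW j (B : set R) : measurable (W j @^-1` B) by exact: (measurable_stopped hA0).
have mf j (g : R -> \bar R) E : measurable_fun E (fun w => g (W j w)).
  exact: (@measurable_fun_stopped _ _ _ P S F X hA0 2 D isT j _ _ g).
have := @drift_stopped _ _ _ P S F X hA0 2 D isT f a b setT n (fun z _ => ftop_ge0 q 0 z)
  (fun z _ _ => a_ge0 z) (fun z _ _ => b_ge0 z) hD F20.
move=> H; rewrite EFinM lee_pdivlMl// ge0_sume_distrr; last first.
  by move=> j _; apply: integral_ge0 => w _; rewrite lee_fin powR_ge0.
apply: (@le_trans _ _ (\int[P]_(w in setT) (f (W n w))%:E +
   \sum_(j < n) \int[P]_(w in setT `&` W j @^-1` D) (a (W j w))%:E)%E).
  rewrite -[leLHS]add0e; apply: leeD.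
    by apply: integral_ge0 => w _; rewrite lee_fin ftop_ge0.
  apply: lee_sum => j _; rewrite setTI -ge0_integralZl//; last 3 first.
  - exact: (mf j (fun z => (z `^ alpha)%:E)).
  - by move=> w _; rewrite lee_fin powR_ge0.
  - by rewrite lee_fin ltW.
apply: (le_trans H); rewrite EFinD; apply: leeD => //.
apply: (@le_trans _ _ (\sum_(j < n) ((C0 + e0 * x0 `^ alpha) *
    pr (setT `&` W j @^-1` (D `&` [set x | x < x0])))%:E)%E); last first.
  by rewrite sumEFin lee_fin -mulr_sumr ler_wpM2l.
apply: lee_sum => j _; rewrite !setTI EFinM -prE// -integral_cst//.
rewrite [leLHS]integral_mkcond [leRHS]integral_mkcond le_eqVlt; apply/orP; left; apply/eqP.
apply: eq_integral => w _; rewrite !patchE.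
have [wD|wD] := pselect (D (W j w)); last by rewrite !memNset//= => -[].
rewrite mem_set//; have [xw|wx] := ltP (W j w) x0.
  by rewrite mem_set// /b leNgt xw.
by rewrite memNset /b ?wx//= => -[_]; rewrite ltNge wx.
Qed.

Lemma exterm_stopped (h : R -> R) j w :
  exterm X h (j + 2) w = (((fun w => (h (W j w))%:E) \_ (W j @^-1` D)) w)%E.
Proof.
rewrite patchE /exterm; have [b|b] := boolP (before_tau1 X (j + 2) w).
  have Dj : D (W j w).
    apply: stopped_inP => i ij; move/before_tau1P : b; apply.
    by rewrite [(j + 2)%N]addnC leq_add2l ij andbT ltn_addr.
  by rewrite mem_set// mulr1 (stopped_in Dj).1 addnC.
rewrite memNset ?mulr0//= => /(@stopped_in _ _ _ X 2 D)[_ hj]; move/negP : b; apply; apply/before_tau1P.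
move=> i /andP[i1 ij]; have := hj (i - 2)%N; rewrite subnKC//; apply.
by rewrite leq_subLR addnC.
Qed.

Lemma excursion_sum_finite alpha : 0 <= alpha -> alpha + 2 <= p -> c + (alpha + 1) * s2 / 2 < 0 ->
  (\int[P]_w exsum X (fun z => (z `^ alpha)%R) w < +oo)%E.
Proof.
move=> a0 ap hc; have [C hC] := excursion_occupation a0 ap hc.
set h := fun z : R => z `^ alpha.
have h0 z : 0 <= h z by exact: powR_ge0.
have t0 t : (0 <= \int[P]_w exterm X h (t + 1) w)%E.
  by apply: integral_ge0 => w _; exact: exterm_ge0.
rewrite (integral_exsum hA0 h0) nneseries_recl//.
apply: lte_add_pinfty.
  rewrite integral_start; last 2 first.
  - by apply: (measurable_exterm hA0).
  - by move=> w; exact: exterm_ge0.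
  apply: (@le_lt_trans _ _ (\int[P]_(w in X 1 @^-1` [set 0%R]) (h 0)%:E)%E).
    apply: ge0_le_integral => //.
    - exact: (measurable_X hA0).
    - by move=> w _; exact: exterm_ge0.
    - by apply: measurable_funTS; exact: (measurable_exterm hA0).
    - move=> w /= Xw; rewrite /exterm Xw lee_fin ler_piMr//.
      by case: before_tau1.
  rewrite integral_cst; last exact: (measurable_X hA0).
  by rewrite [X in (_ * X)%E]start_zero mule1 ltry.
rewrite -(nneseries_addn 1 t0).
apply: (@le_lt_trans _ _ C%:E); last by rewrite ltry.
apply: lime_le; first by apply: is_cvg_nneseries => t _ _; exact: t0.
apply: nearW => n; rewrite big_mkord; apply: le_trans (hC n); apply: lee_sum => j _.
rewrite -addnA; under eq_integral do rewrite exterm_stopped.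
by rewrite -integral_mkcond.
Qed.

End excursion_moments.

Section renewal_ratio.
Context {R : realType}.

Lemma cvg_ratio_succ : (n%:R / n.+1%:R : R) @[n --> \oo] --> (1 : R).
Proof.
have -> : (fun n => n%:R / n.+1%:R : R) = (fun n => 1 - harmonic n).
  apply/funext => n; rewrite /harmonic/= -[n.+1%:R]natr1; field.
  by rewrite natr1 pnatr_eq0.
rewrite -[X in _ --> X]subr0; apply: cvgB; [exact: cvg_cst|exact: cvg_harmonic].
Qed.

Lemma ratio_arith (A k m N : R) : k != 0 -> m != 0 -> N != 0 ->
  A / k / (N / m) * (k / m) = A / N /\ A / m / (N / k) * (k / m)^-1 = A / N.
Proof. by move=> k0 m0 N0; split; field; rewrite k0 m0 N0. Qed.

Lemma renewal_ratio (f A : nat -> R) (N : nat -> nat) (a b : R) : 0 < b ->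
  (forall t, 0 <= f t) -> {homo f : m n / (m <= n)%N >-> m <= n} ->
  N 0%N = 0%N -> (forall n, (N n < N n.+1)%N) -> (forall n, f (N n) = A n) ->
  A n / n%:R @[n --> \oo] --> a -> (N n)%:R / n%:R @[n --> \oo] --> b ->
  t%:R^-1 * f t @[t --> \oo] --> a / b.
Proof.
move=> b0 f0 hf N0 NS fN cA cN.
have Nmono m n : (m <= n)%N -> (N m <= N n)%N.
  by move=> mn; apply: (@homo_leq _ N leq) mn; [exact: leqnn|exact: leq_trans|move=> k; exact: ltnW].
have Nge n : (n <= N n)%N by elim: n => // n IH; exact: leq_ltn_trans IH (NS n).
have /choice[m hm] : forall t, exists m, [/\ (N m <= t)%N, (t < N m.+1)%N & forall K, (N K <= t)%N -> (K <= m)%N].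
  move=> t; have ex : exists m, (N m <= t)%N by exists 0%N; rewrite N0.
  have ub k : (N k <= t)%N -> (k <= t)%N by apply: leq_trans; exact: Nge.
  case: (ex_maxnP ex ub) => m h1 h2; exists m; split => //.
  by rewrite ltnNge; apply/negP => /h2; rewrite ltnn.
have cm : m t @[t --> \oo] --> \oo.
  move=> Q [K _ hK]; exists (N K) => // t /= NKt; apply: hK => /=.
  by have [_ _] := hm t; apply.
have b_neq0 : b != 0 by rewrite gt_eqF.
have cinv (u : nat -> nat) (v : nat -> R) (l : R) : v n @[n --> \oo] --> l ->
    u n @[n --> \oo] --> \oo -> v (u n) @[n --> \oo] --> l.
  by move=> cv cu; exact: (cvg_comp _ _ cu cv).
have cS : n.+1 @[n --> \oo] --> \oo by move=> Q [K _ hK]; exists K => // n /= Kn; apply: hK; exact: leqW.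
pose L n := A n / (N n.+1)%:R; pose U n := A n.+1 / (N n)%:R.
have cL : L n @[n --> \oo] --> a / b.
  have : A n / n%:R * ((N n.+1)%:R / n.+1%:R)^-1 * (n%:R / n.+1%:R) @[n --> \oo] --> a * b^-1 * 1.
    apply: cvgM; last exact: cvg_ratio_succ.
    by apply: cvgM => //; apply: cvgV => //; exact: (cinv S (fun n => (N n)%:R / n%:R)).
  rewrite mulr1; apply: cvg_trans; apply: near_eq_cvg; near=> n.
  have n0 : (0 < n)%N by near: n; exact: nbhs_infty_gt.
  have N1 : (0 < N n.+1)%N by exact: leq_ltn_trans (NS n).
  by rewrite /L (ratio_arith _ _ _ _).1// pnatr_eq0 -lt0n.
have cU : U n @[n --> \oo] --> a / b.
  have : A n.+1 / n.+1%:R * ((N n)%:R / n%:R)^-1 * (n%:R / n.+1%:R)^-1 @[n --> \oo] --> a * b^-1 * 1^-1.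
    apply: cvgM; last by apply: cvgV; [exact: oner_neq0|exact: cvg_ratio_succ].
    by apply: cvgM; [exact: (cinv S (fun n => A n / n%:R))|exact: cvgV].
  rewrite invr1 mulr1; apply: cvg_trans; apply: near_eq_cvg; near=> n.
  have n0 : (0 < n)%N by near: n; exact: nbhs_infty_gt.
  have N1 : (0 < N n)%N by exact: leq_trans (Nge n).
  by rewrite /U (ratio_arith _ _ _ _).2// pnatr_eq0 -lt0n.
apply: (@squeeze_cvgr _ _ _ _ (fun t => L (m t)) (fun t => U (m t))); last 2 first.
- exact: cinv.
- exact: cinv.
near=> t; have [h1 h2 h3] := hm t.
have m1 : (1 <= m t)%N by apply: h3; near: t; exact: nbhs_infty_ge.
have Nm0 : (0 < N (m t))%N by exact: leq_trans (Nge _).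
have t0 : (0 < t)%N by exact: leq_trans h1.
rewrite /L /U -!fN [t%:R^-1 * _]mulrC; apply/andP; split.
  by rewrite ler_pM ?invr_ge0// ?hf// lef_pV2 ?posrE ?ltr0n ?ler_nat// 1?ltnW// (leq_ltn_trans _ (NS _)).
by rewrite ler_pM ?invr_ge0// ?hf ?(ltnW h2)// lef_pV2 ?posrE ?ltr0n ?ler_nat.
Unshelve. all: by end_near.
Qed.

End renewal_ratio.

Section excursion_strong_law.
Context {d : measure_display} {T : measurableType d} {R : realType}.
Variables (P : probability T R) (S : set R) (F : nat -> set (set T)) (X : nat -> T -> R).
Hypotheses (hA0 : A0 P S F X) (hA3 : A3 P X) (hN : P (N_infinite X) = 1%E).
Variable code : R -> nat.
Hypothesis code_inj : {in S &, injective code}.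
Implicit Types (i t k n : nat) (w : T) (l : seq R) (h : R -> R).
Local Notation pr A := (fine (P A)).

Lemma N_infinite_null : P (~` N_infinite X) = 0%E.
Proof.
apply: (etrans (probability_setC P (measurable_N_infinite hA0))).
by rewrite [X in (_ - X)%E]hN subee.
Qed.

Lemma pr_N_infinite A : measurable A -> pr (N_infinite X `&` A) = pr A.
Proof.
move=> mA; have mN := measurable_N_infinite hA0.
have h0 : pr (A `&` ~` N_infinite X) = 0.
  apply/eqP; rewrite eq_le pr_ge0 andbT (@le_trans _ _ (pr (~` N_infinite X)))//.
    by apply: pr_le => //; [apply: measurableI|]; rewrite ?setCK//; exact: measurableC.
  by rewrite N_infinite_null.
by rewrite [RHS](pr_splitC P mA mN) h0 addr0 setIC.
Qed.

Lemma excursion_state i w x : x \in excursion X i.+1 w -> S x.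
Proof.
rewrite /excursion /=; case E : (tau X i w) => [a|]//.
case: (next_zero X a w) => [b|]// /mapP[t]; rewrite mem_iota => /andP[a_t _] ->.
by apply: (X_state hA0); exact: leq_trans (tau_gt0 E) a_t.
Qed.

(* Coding excursions by integers turns their law into a measure on a discrete space. *)
Definition excode i w : nat := pickle [seq code x | x <- excursion X i.+1 w].

Lemma measurable_coded_path (s l : seq nat) : all (leq 1) s ->
  measurable [set w | [seq code (X t w) | t <- s] = l].
Proof.
elim: s l => [|t s IH] [|a l] //=.
- by move=> _; rewrite (_ : [set w | _] = setT)//; apply/seteqP; split.
- by move=> _; rewrite (_ : [set w | _] = set0)//; apply/seteqP; split.
- by move=> _; rewrite (_ : [set w | _] = set0)//; apply/seteqP; split.
move=> /andP[t0 s0]; rewrite (_ : [set w | _] = X t @^-1` [set x | code x = a] `&`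
    [set w | [seq code (X t w) | t <- s] = l]).
  by apply: measurableI; [exact: (measurable_X hA0)|exact: IH].
by apply/seteqP; split=> w /= => [[-> ->]//|[-> ->]].
Qed.

Lemma measurable_excode i (B : set nat) : measurable (excode i @^-1` B).
Proof.
apply: measurable_countable_valued => v.
pose Q a b := [set w | tau X i w = Some a] `&` [set w | tau X i.+1 w = Some b].
have mQ a b : measurable (Q a b) by apply: measurableI; exact: (measurable_tau hA0).
rewrite (_ : _ @^-1` _ =
  (\bigcup_(a in [set a | (0 < a)%N]) \bigcup_b (Q a b `&`
     (fun w => [seq code (X t w) | t <- iota a (b - a)]) @^-1` [set l | pickle l = v])) `|`
  ((~` \bigcup_a \bigcup_b Q a b) `&` [set w | pickle (Nil nat) = v])).
  apply: measurableU.
    apply: bigcup_measurable => a /= a0; apply: bigcup_measurable => b _.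
    apply: measurableI => //; apply: measurable_countable_valued => l.
    apply: measurable_coded_path; apply/allP => t; rewrite mem_iota => /andP[at_ _].
    exact: leq_trans a0 at_.
  apply: measurableI.
    by apply: measurableC; apply: bigcup_measurable => a _; apply: bigcup_measurable => b _.
  have [e|e] := pselect (pickle (Nil nat) = v).
    by rewrite (_ : [set w | _] = setT)//; apply/seteqP; split.
  by rewrite (_ : [set w | _] = set0)//; apply/seteqP; split.
have exE w a b : Q a b w -> excode i w = pickle [seq code (X t w) | t <- iota a (b - a)].
  by move=> [h1 h2]; rewrite /excode /excursion succnK (h1 : tau X i w = _) (h2 : tau X i.+1 w = _) -map_comp.
apply/seteqP; split=> w /=.
  move=> hv; have [[a _ [b _ Qab]]|nQ] := pselect ((\bigcup_a \bigcup_b Q a b) w).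
    left; exists a; first exact: tau_gt0 Qab.1.
    by exists b => //; split => //=; rewrite -(exE _ _ _ Qab).
  right; split => //; move: hv; rewrite /excode /excursion succnK.
  case E1 : (tau X i w) => [a|]//; case E2 : (tau X i.+1 w) => [b|]//.
  by exfalso; apply: nQ; exists a => //; exists b.
move=> [[a _ [b _ [Qab /= <-]]]|[nQ <-]]; first exact: exE.
rewrite /excode /excursion succnK.
case E1 : (tau X i w) => [a|]//; case E2 : (tau X i.+1 w) => [b|]//.
by exfalso; apply: nQ; exists a => //; exists b.
Qed.

Lemma iid_excode k (B : nat -> set nat) :
  pr [set w | forall i, (i < k)%N -> B i (excode i w)] = \prod_(i < k) pr (excode 0 @^-1` B i).
Proof.
have [+ _] := hA3; rewrite hN => /(_ lte01 k (fun i => [set l | B i (pickle [seq code x | x <- l])])).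
rewrite /= divr1 pr_N_infinite => [->|].
  by apply: eq_bigr => i _; rewrite divr1 pr_N_infinite//; exact: measurable_excode.
rewrite (_ : [set w | _] = \bigcap_(i in [set i | (i < k)%N]) (excode i @^-1` B i)).
  by apply: bigcap_measurableType => i _; exact: measurable_excode.
by apply/seteqP; split=> w hw i; exact: hw.
Qed.

Definition exdecode k : seq R :=
  xget [::] [set l : seq R | (forall x, x \in l -> S x) /\ pickle [seq code x | x <- l] = k].

Lemma exdecodeK i w : exdecode (excode i w) = excursion X i.+1 w.
Proof.
have inj l l' : (forall x, x \in l -> S x) -> (forall x, x \in l' -> S x) ->
    [seq code x | x <- l] = [seq code x | x <- l'] -> l = l'.
  elim: l l' => [|x l IH] [|y l']//= Sl Sl' [e1 e2]; congr (_ :: _).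
    by apply: code_inj => //; rewrite inE; [apply: Sl|apply: Sl']; rewrite mem_head.
  by apply: IH e2 => z zl; [apply: Sl|apply: Sl']; rewrite in_cons zl orbT.
have [] := @xgetPex _ [::] [set l : seq R | (forall x, x \in l -> S x) /\
  pickle [seq code x | x <- l] = excode i w].
  by exists (excursion X i.+1 w); split => // x; exact: excursion_state.
move=> h1 /(pcan_inj pickleK) h2; apply: inj => // x; exact: excursion_state.
Qed.

Definition exfun h k : R := \sum_(x <- exdecode k) h x.

Lemma exfunE h i w : exfun h (excode i w) = \sum_(x <- excursion X i.+1 w) h x.
Proof. by rewrite /exfun exdecodeK. Qed.

Lemma integral_exfun h : (forall x, 0 <= h x) ->
  (\int[P]_w (exfun h (excode 0 w))%:E = \int[P]_w exsum X h w)%E.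
Proof.
move=> h0; apply: ge0_ae_eq_integral => //.
- apply/measurable_EFinP; apply: (@measurable_fun_iid _ _ _ excode) => i B.
  exact: measurable_excode.
- exact: (measurable_exsum hA0 h0).
- by move=> w _; rewrite lee_fin /exfun sumr_ge0.
- by move=> w _; exact: exsum_ge0.
exists (~` N_infinite X); split.
- by apply: measurableC; exact: (measurable_N_infinite hA0).
- exact: N_infinite_null.
move=> w /=; apply: contra_not => hw _; have := hw 1%N.
case E : (tau X 1 w) => [k|]// _; rewrite exfunE.
by rewrite (exsum_excursion h0 E).
Qed.

Lemma excursion_strong_law h : (forall x, 0 <= h x) -> (\int[P]_w exsum X h w < +oo)%E ->
  {ae P, forall w, (\sum_(i < n) \sum_(x <- excursion X i.+1 w) h x) / n%:R @[n --> \oo]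
    --> fine (\int[P]_w exsum X h w)%E}.
Proof.
move=> h0; rewrite -integral_exfun// => hoo.
have := @strong_law_discrete _ _ _ P excode measurable_excode iid_excode (exfun h)
  (fun k => sumr_ge0 _ (fun x _ => h0 x)) hoo.
apply: filterS => w; under eq_fun do under eq_bigr do rewrite exfunE.
exact.
Qed.

Lemma excursion_times_enum w : N_infinite X w -> exists N : nat -> nat,
  [/\ N 0%N = 1%N, forall n, (N n < N n.+1)%N &
      forall h n, \sum_(1 <= t < N n) h (X t w) = \sum_(i < n) \sum_(x <- excursion X i.+1 w) h x].
Proof.
move=> hw; have /choice[N hNn] : forall n, exists k, tau X n w = Some k.
  by move=> n; have := hw n; case: tau => // k _; exists k.
have N0 : N 0%N = 1%N by have [] := hNn 0%N.
have NS n : (N n < N n.+1)%N by have := hNn n.+1; rewrite /= hNn => /next_zeroP[].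
have exE n : excursion X n.+1 w = [seq X t w | t <- iota (N n) (N n.+1 - N n)].
  by rewrite /excursion succnK !hNn.
exists N; split => // h; elim => [|n IH]; first by rewrite N0 big_geq// big_ord0.
rewrite big_ord_recr/= -IH exE big_map (@big_cat_nat _ _ _ (N n))//=; last exact: ltnW.
by rewrite (tau_gt0 (hNn n)).
Qed.

Lemma excursion_visit y : S y -> 0 < y -> A1 P S F X ->
  0 < pr [set w | y \in excursion X 1 w].
Proof.
move=> Sy y0 hA1; have S0 : S 0 by case: hA0 => -[].
have [m [phi [m0 phi0 hm]]] := A1_local hA0 hA1 S0 Sy.
have X10 : P (X 1 @^-1` [set 0]) = 1%E by have [_ []] := hA0.
have := hm 1%N (X 1 @^-1` [set 0]) isT (F_X hA0 _ (isT : (0 < 1)%N)) (fun _ u => u).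
rewrite [X in (_ * X)%E]X10 mule1 => hm1.
pose B := [set k | y \in exdecode k].
have eB i : excode i @^-1` B = [set w | y \in excursion X i.+1 w].
  by apply/seteqP; split=> w /=; rewrite /B/= exdecodeK.
have mB i : measurable (excode i @^-1` B) by exact: measurable_excode.
rewrite -eB lt_neqAle pr_ge0 andbT eq_sym; apply/eqP => h0.
have hi i : P (excode i @^-1` B) = 0%E.
  rewrite (prE P (mB i)) (@iid_marginal _ _ _ P excode iid_excode) h0//.
have mN := measurable_N_infinite hA0.
have : (phi%:E <= P ((\bigcup_i excode i @^-1` B) `|` ~` N_infinite X))%E.
  apply: (le_trans hm1); apply: le_measure; rewrite ?inE.
  - by apply: measurableI; exact: (measurable_X hA0).
  - by apply: measurableU; [exact: bigcup_measurable|exact: measurableC].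
  move=> w [_ /= Xw]; have [Nw|] := pselect (N_infinite X w); [left|by right].
  have [N [N0 NS hNs]] := excursion_times_enum Nw.
  have Nge n : (n < N n)%N by elim: n => [|n IH]; [rewrite N0|exact: leq_ltn_trans IH (NS n)].
  have := hNs (fun z => (z == y)%:R) (1 + m).+1.
  move=> e; have pos : 0 < \sum_(1 <= t < N (1 + m).+1) (X t w == y)%:R :> R.
    rewrite (@big_cat_nat _ _ _ (1 + m))//=; last by rewrite ltnW// (leq_ltn_trans _ (Nge _)).
    rewrite [X in _ + X]big_ltn ?(leq_ltn_trans _ (Nge _))// Xw eqxx.
    by rewrite addrCA ltr_pwDl// addr_ge0// sumr_ge0.
  apply: contrapT => hno; move: pos; rewrite e big1 ?ltxx// => i _.
  apply: big1_seq => x /andP[_ xi]; case: eqP => // xy; exfalso; apply: hno.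
  by exists i => //; rewrite eB /= -xy.
have -> : P ((\bigcup_i excode i @^-1` B) `|` ~` N_infinite X) = 0%E.
  apply: null_set_setU => //.
  - exact: bigcup_measurable.
  - exact: measurableC.
  - apply/eqP; rewrite eq_le measure_ge0 andbT.
    apply: (le_trans (generalized_Boole_inequality _ mB _)); first exact: bigcup_measurable.
    by rewrite eseries0// => i _ _; exact: hi.
  - exact: N_infinite_null.
by rewrite lee_fin leNgt phi0.
Qed.

End excursion_strong_law.

Section positive_recurrence.
Context {d : measure_display} {T : measurableType d} {R : realType}.
Variables (P : probability T R) (S : set R) (F : nat -> set (set T)) (X : nat -> T -> R).
Variables (c s2 p alpha : R).
Hypotheses (hA0 : A0 P S F X) (hA1 : A1 P S F X) (hA2 : A2 P F X c s2) (hA3 : A3 P X).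
Hypotheses (hMp : Mp P F X p) (p_gt2 : 2 < p).
Hypotheses (alpha_ge0 : 0 <= alpha) (alpha_le : alpha + 2 <= p) (hc : c + (alpha + 1) * s2 / 2 < 0).
Implicit Types (i t k n : nat) (w : T) (h : R -> R).
Local Notation pr A := (fine (P A)).
Local Notation pw := (fun z : R => (z `^ alpha)%R).
Local Notation one := (fun _ : R => (1%R : R)).

Lemma integral_eta_finite : (\int[P]_w exsum X one w < +oo)%E.
Proof.
have s20 : 0 < s2 by case: hA2.
have hc0 : c + (0 + 1) * s2 / 2 < 0.
  apply: le_lt_trans hc; rewrite lerD2l ler_pM2r ?invr_gt0// ler_pM2r//.
  by rewrite lerD2r.
have h2 : 0 + 2 <= p by rewrite add0r ltW.
have := excursion_sum_finite hA0 hA1 hA2 hMp p_gt2 (lexx 0) h2 hc0.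
suff -> : (fun z : R => z `^ 0) = one by [].
by apply/funext => z; rewrite powRr0.
Qed.

Lemma tau1_finite : pr [set w | tau X 1 w != None] = 1.
Proof.
set A := [set w | _]; have mA : measurable A by exact: (measurable_tau_finite hA0).
pose B := ~` A; have mB : measurable B by exact: measurableC.
have one0 (z : R) : 0 <= one z by [].
set m := (\int[P]_w exsum X one w)%E.
have m0 : (0 <= m)%E by apply: integral_ge0 => w _; exact: exsum_ge0.
have mfin : m \is a fin_num by rewrite ge0_fin_numE// integral_eta_finite.
have H n : n%:R * pr B <= fine m.
  rewrite -lee_fin fineK// EFinM -(prE P mB) -integral_cst//.
  apply: (@le_trans _ _ (\int[P]_(w in B) exsum X one w)%E); last first.
    apply: ge0_subset_integral => //; first exact: (measurable_exsum hA0).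
    by move=> w _; exact: exsum_ge0.
  apply: ge0_le_integral => //.
  - by move=> w _; rewrite lee_fin.
  - by apply: measurable_funTS; exact: (measurable_exsum hA0).
  move=> w Bw; apply: (@le_trans _ _ (\sum_(1 <= t < 1 + n) exterm X one t w)%E).
    have -> : (\sum_(1 <= t < 1 + n) exterm X one t w = \sum_(1 <= t < 1 + n) 1%:E)%E.
      apply: eq_bigr => t _; rewrite /exterm /before_tau1.
      case E : (tau X 1 w) => [k|]; last by rewrite mul1r.
      by exfalso; apply: Bw; change (tau X 1 w != None); rewrite E.
    by rewrite sumEFin big_const_nat iter_addr_0 addKn.
  by apply: nneseries_lim_ge => t _ _; exact: exterm_ge0.
have B0 : pr B = 0.
  apply/eqP; rewrite eq_le pr_ge0 andbT leNgt; apply/negP => B0.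
  have := H (Num.truncn (fine m / pr B)).+1; apply/negP; rewrite -ltNge -ltr_pdivrMr//.
  exact: truncnS_gt.
have := pr_splitC P measurableT mA; rewrite !setTI -/B B0 addr0 => <-.
by rewrite probability_setT.
Qed.

Lemma N_infinite_as : P (N_infinite X) = 1%E.
Proof.
have mt n : measurable [set w | tau X n w != None] by exact: (measurable_tau_finite hA0).
have H n : P [set w | tau X n w != None] = 1%E.
  rewrite (prE P (mt n)); congr (_%:E).
  case: n => [|n].
    rewrite (_ : [set w | _] = setT); first by rewrite probability_setT.
    by apply/seteqP; split.
  elim: n => [|n IH]; first exact: tau1_finite.
  have [_ hb] := hA3.
  have P1 : P [set w | tau X n.+1 w != None] = 1%E by rewrite (prE P (mt n.+1)) IH.
  have := hb n.+1 isT; rewrite P1 => /(_ lte01); rewrite /= divr1 tau1_finite => e.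
  apply/eqP; rewrite eq_le (pr_le1 P (mt n.+2))/= -e; apply: pr_le.
  - exact: (measurableI _ _ (mt n.+1) (mt n.+2)).
  - exact: (mt n.+2).
  - by move=> w [].
have mN := measurable_N_infinite hA0.
have N0 : pr (~` N_infinite X) = 0.
  suff -> : P (~` N_infinite X) = 0%E by [].
  have mC n : measurable (~` [set w | tau X n w != None]) by exact: measurableC.
  have eC : ~` N_infinite X = \bigcup_n ~` [set w | tau X n w != None].
    by rewrite -setC_bigcap; congr (~` _); apply/seteqP; split=> w hw n => [_|]; [exact: hw|exact: (hw n I)].
  apply/eqP; rewrite eq_le measure_ge0 andbT eC.
  apply: (le_trans (generalized_Boole_inequality _ mC _)); first exact: bigcup_measurable.
  rewrite eseries0// => n _ _; apply: (etrans (probability_setC P (mt n))).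
  by rewrite [X in (_ - X)%E]H subee.
rewrite (prE P mN); congr (_%:E).
have := pr_splitC P measurableT mN; rewrite !setTI N0 addr0 => <-.
by rewrite probability_setT.
Qed.

Lemma integral_eta_ge1 : (1 <= \int[P]_w exsum X one w)%E.
Proof.
have one0 (z : R) : 0 <= one z by [].
have e1 : (\int[P]_(w in setT) 1%:E = 1)%E by rewrite integral_cst// [X in (_ * X)%E]probability_setT mule1.
rewrite -[leLHS]e1; apply: ge0_le_integral => //; first exact: (measurable_exsum hA0).
move=> w _; apply: (@le_trans _ _ (\sum_(1 <= t < 2) exterm X one t w)%E).
  rewrite big_nat1 /exterm mul1r (_ : before_tau1 X 1 w = true)//.
  by apply/before_tau1P => i /andP[i1]; rewrite leqNgt i1.
by apply: nneseries_lim_ge => t _ _; exact: exterm_ge0.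
Qed.

Lemma state_infinite : ~ finite_set S.
Proof.
move=> fS; have [x Sx|M [phi [_ hM]]] := @finite_uniform_bounds R S (fun x => (Num.truncn x).+1) (fun=> 1) fS.
  by [].
have [[_ unb _ _] _] := hA0; have [x Sx Mx] := unb M%:R.
have [+ _] := hM x Sx; rewrite -(ler_nat R) => h.
by have := lt_trans (lt_le_trans (truncnS_gt x) h) Mx; rewrite ltxx.
Qed.

Lemma exsum_enum (e : nat -> R) h w : set_bij [set: nat] S e -> (forall x, 0 <= h x) ->
  exsum X h w = (\sum_(n <oo) (h (e n))%:E * exsum X (fun z => (z == e n)%:R%R) w)%E.
Proof.
move=> [_ einj esurj] h0; pose g n := fun z : R => (z == e n)%:R : R.
have g0 n z : 0 <= g n z by [].
pose a t n := ((h (e n))%:E * exterm X (g n) (t + 1) w)%E.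
have a0 t n : (0 <= a t n)%E by apply: mule_ge0; [rewrite lee_fin|exact: exterm_ge0].
rewrite exsum_addn//.
have -> : (\sum_(t <oo) exterm X h (t + 1) w = \sum_(t <oo) \sum_(n <oo) a t n)%E.
  apply: eq_eseriesr => t _.
  have [n _ en] : (e @` setT) (X (t + 1)%N w).
    by apply: esurj; apply: (X_state hA0); rewrite addn1.
  rewrite (@nneseriesD1 _ _ n) => //; rewrite eseries0 ?adde0.
    by rewrite /a /exterm /g en eqxx -EFinM mul1r.
  move=> m _ /= mn; rewrite /a /exterm /g -en (_ : (e n == e m) = false) ?mul0r ?mule0//.
  apply/negbTE; apply: contra mn => /eqP enm; apply/eqP/esym.
  by apply: einj; rewrite ?inE.
rewrite nneseries_interchange//; apply: eq_eseriesr => n _.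
by rewrite /a nneseriesZl ?(exsum_addn _ (g0 n))// => t _; exact: exterm_ge0.
Qed.

Lemma integral_exsum_enum (e : nat -> R) h : set_bij [set: nat] S e -> (forall x, 0 <= h x) ->
  (\int[P]_w exsum X h w = \sum_(n <oo) (h (e n))%:E * \int[P]_w ell1 X (e n) w)%E.
Proof.
move=> eb h0; under eq_integral do rewrite (exsum_enum _ eb h0).
have g0 n (z : R) : 0 <= (z == e n)%:R :> R by [].
have mg n : measurable_fun setT (exsum X (fun z => (z == e n)%:R%R)) by exact: (measurable_exsum hA0).
rewrite integral_nneseries//.
- by apply: eq_eseriesr => n _; rewrite ell1E ge0_integralZl ?lee_fin// => w _; exact: exsum_ge0.
- by move=> n; apply: emeasurable_funM.
- by move=> n w _; apply: mule_ge0; [rewrite lee_fin|exact: exsum_ge0].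
Qed.

Lemma positive_recurrent_average :
  let L := fine (\int[P]_w xi1 X alpha w)%E / fine (\int[P]_w eta1 X w)%E in
  [/\ (\int[P]_w eta1 X w < +oo)%E, (\int[P]_w xi1 X alpha w < +oo)%E, 0 < L,
      L%:E = \esum_(x in S) ((x `^ alpha) * pi_stat P X x)%:E &
      {ae P, forall w, (fun t : nat => t%:R^-1 * Ssum X alpha t w) @ \oo --> (L : R)}].
Proof.
move=> L.
have etaoo := integral_eta_finite.
have xioo := excursion_sum_finite hA0 hA1 hA2 hMp p_gt2 alpha_ge0 alpha_le hc.
have pw0 (z : R) : 0 <= pw z by exact: powR_ge0.
have one0 (z : R) : 0 <= one z by [].
have /countable_injP[code code_inj] := state_countable hA0.
have hN := N_infinite_as.
have eta1' : 1 <= fine (\int[P]_w exsum X one w)%E.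
  rewrite -lee_fin fineK ?integral_eta_ge1// ge0_fin_numE ?integral_eta_finite//.
  by apply: integral_ge0 => w _; exact: exsum_ge0.
have eta0 : 0 < fine (\int[P]_w exsum X one w)%E by exact: lt_le_trans eta1'.
have etafin : (\int[P]_w exsum X one w)%E \is a fin_num.
  by rewrite ge0_fin_numE//; apply: integral_ge0 => w _; exact: exsum_ge0.
have xifin : (\int[P]_w exsum X pw w)%E \is a fin_num.
  by rewrite ge0_fin_numE//; apply: integral_ge0 => w _; exact: exsum_ge0.
have LE : L = fine (\int[P]_w exsum X pw w)%E / fine (\int[P]_w exsum X one w)%E.
  by rewrite /L xi1E eta1E.
clearbody L.
split.
- by rewrite eta1E.
- by rewrite xi1E.
- rewrite LE divr_gt0//.
  have [[_ unb _ _] _] := hA0; have [y Sy y0] := unb 0.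
  have hv := excursion_visit hA0 hA3 hN code_inj Sy y0 hA1.
  rewrite -lte_fin fineK// -(integral_exfun hA0 hN code_inj pw0).
  set B := [set w | y \in excursion X 1 w] in hv.
  have mB : measurable B.
    rewrite (_ : B = excode X code 0 @^-1` [set k | y \in exdecode S code k]).
      exact: (measurable_excode hA0).
    by apply/seteqP; split=> w /=; rewrite (exdecodeK hA0 code_inj).
  have mE : measurable_fun setT (fun w => (exfun S code pw (excode X code 0 w))%:E).
    apply/measurable_EFinP; apply: (@measurable_fun_iid _ _ _ (excode X code)) => i E.
    exact: (measurable_excode hA0).
  have E0 w : (0 <= (exfun S code pw (excode X code 0 w))%:E)%E.
    by rewrite lee_fin /exfun sumr_ge0.
  apply: (@lt_le_trans _ _ (\int[P]_(w in B) (y `^ alpha)%:E)%E).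
    by rewrite integral_cst// [X in (_ * X)%E](prE P mB) -EFinM lte_fin mulr_gt0// powR_gt0.
  apply: (@le_trans _ _ (\int[P]_(w in B) (exfun S code pw (excode X code 0 w))%:E)%E).
    apply: ge0_le_integral => //.
    - by move=> w _; rewrite lee_fin.
    - exact: measurable_funTS.
    - move=> w; rewrite /B/= => yw; rewrite lee_fin (exfunE hA0 code_inj).
      by rewrite (big_rem y)//= lerDl sumr_ge0.
  exact: ge0_subset_integral.
- have : ([set: nat] #= S)%card by rewrite card_eq_sym; apply: eq_card_nat; [exact: (state_countable hA0)|exact: state_infinite].
  move=> /card_set_bijP[e eb].
  have ellfin n : (\int[P]_w ell1 X (e n) w)%E \is a fin_num.
    rewrite ell1E ge0_fin_numE; last by apply: integral_ge0 => w _; exact: exsum_ge0.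
    apply: le_lt_trans etaoo; apply: ge0_le_integral => //.
    - by move=> w _; exact: exsum_ge0.
    - exact: (measurable_exsum hA0).
    - exact: (measurable_exsum hA0).
    - move=> w _; apply: lee_nneseries => [t _ _|t _]; first exact: exterm_ge0.
      by rewrite lee_fin ler_wpM2r//; case: eqP.
  rewrite (reindex_esum [set: nat] S e)// -nneseries_esumT; last first.
    move=> n; rewrite lee_fin mulr_ge0 ?powR_ge0// divr_ge0// fine_ge0//.
      by rewrite ell1E; apply: integral_ge0 => w _; exact: exsum_ge0.
    by rewrite eta1E; apply: integral_ge0 => w _; exact: exsum_ge0.
  rewrite LE mulrC EFinM fineK// (integral_exsum_enum eb pw0) -nneseriesZl; last first.
    move=> n _; rewrite mule_ge0 ?lee_fin// ell1E.
    by apply: integral_ge0 => w _; exact: exsum_ge0.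
  apply: eq_eseriesr => n _; rewrite /pi_stat eta1E -[X in (_ * (_ * X) = _)%E]fineK//.
  by rewrite -!EFinM; congr (_%:E); rewrite mulrCA [X in _ * X]mulrC.
- have h1 := excursion_strong_law hA0 hA3 hN code_inj pw0 xioo.
  have h2 := excursion_strong_law hA0 hA3 hN code_inj one0 etaoo.
  have h3 : {ae P, forall w, N_infinite X w}.
    exists (~` N_infinite X); split => //; last exact: (N_infinite_null hA0 hN).
    by apply: measurableC; exact: (measurable_N_infinite hA0).
  move: h1 h2 h3; apply: filterS3 => w h1 h2 Nw.
  have [N [N0 NS hNs]] := excursion_times_enum Nw.
  have Npos n : (0 < N n)%N by case: n => [|n]; [rewrite N0|exact: leq_ltn_trans (NS n)].
  rewrite LE.
  apply: (@renewal_ratio R (fun t => Ssum X alpha t w)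
    (fun n => \sum_(i < n) \sum_(x <- excursion X i.+1 w) x `^ alpha) (fun n => (N n).-1)) => //.
  - by move=> t; apply: sumr_ge0 => i _; exact: powR_ge0.
  - move=> m n mn; rewrite /Ssum [leRHS](@big_cat_nat _ _ _ m.+1)//= lerDl.
    by apply: sumr_ge0 => i _; exact: powR_ge0.
  - by rewrite N0.
  - by move=> n; rewrite -ltnS !prednK.
  - by move=> n; rewrite /Ssum prednK// (hNs pw).
  - move: h2; under eq_fun do rewrite -(hNs one) big_const_nat iter_addr_0 subn1.
    exact.
Qed.

End positive_recurrence.

(** * Conclusion *)

Section final_exponents.
Context {R : realType}.
Implicit Types (a r e u v th x : R).

Lemma lower_exponent_i a r e : 0 <= a -> -1 < r -> r <= 1 ->
  - ((a + 2) * (4 + r) / (1 + r)) - e <= - ((1 + 1) * ((a + 2) / 2)) - e.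
Proof.
move=> a0 r0 r1; rewrite lerD2r lerN2 ler_pdivlMr; last by lra.
by rewrite (_ : (1 + 1) * ((a + 2) / 2) = a + 2); [rewrite ler_wpM2l//; lra|field].
Qed.

Lemma upper_exponent_i a r v e : 0 <= a -> -1 < r -> r <= 1 -> v <= 2^-1 -> v <= e / 2 ->
  (1 + 2 * v) * ((a + 2) / 2) + 2 + v + e / 2 <= (3 * a + 6) / (1 + r) + 2 + e.
Proof.
move=> a0 r0 r1 v1 v2.
have h : (3 * a + 6) / 2 <= (3 * a + 6) / (1 + r).
  by rewrite ler_wpM2l ?lef_pV2 ?posrE//; lra.
have : 2 * v * ((a + 2) / 2) <= 1 * ((a + 2) / 2) by rewrite ler_wpM2r//; lra.
by move: h; lra.
Qed.

Lemma lower_exponent_ii u th e : u * th <= e / 2 -> - th - e <= - ((1 + u) * th) - e / 2.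
Proof. by lra. Qed.

Lemma upper_exponent_ii a r v e : 0 <= (a + 2) / (1 + r) -> v <= 2^-1 -> v <= e / 2 ->
  (1 + 2 * v) * ((a + 2) / (1 + r)) + 2 + v + e / 2 <= (2 * a + 4) / (1 + r) + 2 + e.
Proof.
move=> th0 v1 v2; rewrite (_ : (2 * a + 4) / (1 + r) = 2 * ((a + 2) / (1 + r))); last by ring.
have : 2 * v * ((a + 2) / (1 + r)) <= 1 * ((a + 2) / (1 + r)) by rewrite ler_wpM2r//; lra.
lra.
Qed.

Lemma ln_nat_ge1_near : \forall t \near \oo, 1 <= ln (t%:R : R).
Proof.
exists (Num.truncn (expR (1 : R))).+1 => // t /= ht; apply: ln_ge1.
by apply: (le_trans (ltW (truncnS_gt _))); rewrite ler_nat.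
Qed.

Lemma log_exponent_lower (f : nat -> R) th v v' : v' <= v ->
  (\forall t \near \oo, t%:R `^ th * ln t%:R `^ v <= f t) ->
  \forall t \near \oo, t%:R `^ th * ln t%:R `^ v' <= f t.
Proof.
move=> vv; apply: filterS2 ln_nat_ge1_near => t lt; apply: le_trans.
by rewrite ler_wpM2l ?powR_ge0// ler_powR.
Qed.

Lemma log_exponent_upper (f : nat -> R) th v v' : v <= v' ->
  (\forall t \near \oo, f t <= t%:R `^ th * ln t%:R `^ v) ->
  \forall t \near \oo, f t <= t%:R `^ th * ln t%:R `^ v'.
Proof.
move=> vv; apply: filterS2 ln_nat_ge1_near => t lt /le_trans; apply.
by rewrite ler_wpM2l ?powR_ge0// ler_powR.
Qed.

Lemma mlog_ge1_near (q u : R) : 0 < q -> exists b, forall x, b <= x -> 1 <= mlog q u x.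
Proof.
move=> q0; have [b hb] := @ln_powR_le R (- u) q 1 q0 ltr01.
exists (Num.max b (expR 1)) => x; rewrite ge_max => /andP[bx ex].
have l1 := ln_ge1 ex; have l0 : 0 < ln x by rewrite (lt_le_trans _ l1).
have := hb x bx; rewrite mul1r /mlog => h.
have -> : ln x `^ u = (ln x `^ (- u))^-1 by rewrite -powRN opprK.
by rewrite ler_pdivlMr ?powR_gt0// mul1r.
Qed.

End final_exponents.

Theorem theorem2p9 (d : measure_display) (T : measurableType d) (R : realType)
  (P : probability T R) (S : set R) (F : nat -> set (set T))
  (X : nat -> T -> R) (c s2 p alpha : R) :
  A0 P S F X -> A1 P S F X -> A2 P F X c s2 -> A3 P X ->
  -1 < - (2 * c) / s2 ->
  Num.max 2 (1 + - (2 * c) / s2) < p -> Mp P F X p ->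
  0 <= alpha ->
  let r := - (2 * c) / s2 in
  [/\
   (* (i) *)
   (r <= 1 -> forall eps : R, 0 < eps ->
      {ae P, forall w, \forall t \near \oo,
        t%:R `^ ((alpha + 2) / 2)
          * ln t%:R `^ (- ((alpha + 2) * (4 + r) / (1 + r)) - eps)
        <= Ssum X alpha t w /\
        Ssum X alpha t w <=
        t%:R `^ ((alpha + 2) / 2)
          * ln t%:R `^ ((3 * alpha + 6) / (1 + r) + 2 + eps)}),
   (* (ii) *)
   (1 < r -> r <= 1 + alpha -> forall eps : R, 0 < eps ->
      {ae P, forall w, \forall t \near \oo,
        t%:R `^ ((alpha + 2) / (1 + r))
          * ln t%:R `^ (- ((alpha + 2) / (1 + r)) - eps)
        <= Ssum X alpha t w /\
        Ssum X alpha t w <=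
        t%:R `^ ((alpha + 2) / (1 + r))
          * ln t%:R `^ ((2 * alpha + 4) / (1 + r) + 2 + eps)}) &
   (* (iii) *)
   (1 + alpha < r ->
      let L := fine (\int[P]_w xi1 X alpha w)%E / fine (\int[P]_w eta1 X w)%E in
      [/\ (\int[P]_w eta1 X w < +oo)%E,
          (\int[P]_w xi1 X alpha w < +oo)%E,
          0 < L,
          L%:E = \esum_(x in S) ((x `^ alpha) * pi_stat P X x)%:E &
          {ae P, forall w, (fun t : nat => t%:R^-1 * Ssum X alpha t w) @ \oo --> (L : R)}])].
Proof.
move=> hA0 hA1 hA2 hA3 hr hp hMp a0 r.
rewrite -/r in hr hp; move: hp; rewrite gt_max => /andP[p2 rp].
have s20 : 0 < s2 by case: hA2.
have s40 : 0 < s2 / 2 by rewrite divr_gt0.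
have cE y : c + y * s2 / 2 = (y - r) * (s2 / 2).
  by rewrite /r; field; rewrite lt0r_neq0.
have r10 : 0 < 1 + r by rewrite -ltrBlDl sub0r.
clearbody r.
split.
- move=> r1 eps e0.
  have e20 : 0 < eps / 2 by rewrite divr_gt0.
  have v0 : 0 < Num.min 2^-1 (eps / 2) by rewrite lt_min e20 invr_gt0 ltr0n.
  have v1 : Num.min 2^-1 (eps / 2) <= 1 by rewrite ge_min invf_le1 ?ler1n.
  have v01 : 0 < Num.min 2^-1 (eps / 2) <= 1 by rewrite v0 v1.
  have u01 : 0 < (1 : R) <= 1 by rewrite ltr01 lexx.
  have hc : 0 <= c + (2 - 1) * s2 / 2.
    by rewrite cE mulr_ge0 ?(ltW s40)// subr_ge0 (_ : 2 - 1 = 1 :> R)//; ring.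
  have hca : 0 <= c + (alpha + 1) * s2 / 2.
    by rewrite cE mulr_ge0 ?(ltW s40)// subr_ge0 (le_trans r1)// lerDr.
  have hb (x : R) : 0 <= x -> 1 <= mlog (2 - 2) (1 - 1) x by rewrite !subrr /mlog !powRr0 mulr1.
  have low := lower_bound_ae hA0 hA1 hA2 hMp p2 (lexx 2) u01 hc hb a0 e0.
  have q2a : 2 <= alpha + 2 by rewrite lerDr.
  have up := upper_bound_ae hA0 hA2 hMp p2 (ltW p2) v01 (or_introl erefl) a0 q2a hca e20.
  move: low up; apply: filterS2 => w low up.
  have low' := log_exponent_lower (lower_exponent_i eps a0 hr r1) low.
  have vm1 : Num.min 2^-1 (eps / 2) <= 2^-1 by rewrite ge_min lexx.
  have vm2 : Num.min 2^-1 (eps / 2) <= eps / 2 by rewrite ge_min lexx orbT.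
  have up' := log_exponent_upper (upper_exponent_i a0 hr r1 vm1 vm2) up.
  by move: low' up'; apply: filterS2.
- move=> r1 ra eps e0.
  have e20 : 0 < eps / 2 by rewrite divr_gt0.
  have v0 : 0 < Num.min 2^-1 (eps / 2) by rewrite lt_min e20 invr_gt0 ltr0n.
  have v1 : Num.min 2^-1 (eps / 2) <= 1 by rewrite ge_min invf_le1 ?ler1n.
  have v01 : 0 < Num.min 2^-1 (eps / 2) <= 1 by rewrite v0 v1.
  have th0 : 0 < (alpha + 2) / (1 + r) by rewrite divr_gt0// ltr_wpDl.
  set u := Num.min 1 (eps / 2 / ((alpha + 2) / (1 + r))).
  have u01 : 0 < u <= 1 by rewrite lt_min ltr01 divr_gt0//= ge_min lexx.
  have uth : u * ((alpha + 2) / (1 + r)) <= eps / 2.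
    by rewrite -ler_pdivlMr// ge_min lexx orbT.
  have q2 : 2 < 1 + r by rewrite (_ : 2 = 1 + 1 :> R) ?ltrD2l//; ring.
  have qr : 1 + r - 1 = r by rewrite addrAC subrr add0r.
  have hc : c + (1 + r - 1) * s2 / 2 = 0 by rewrite qr cE subrr mul0r.
  have hc' : 0 <= c + (1 + r - 1) * s2 / 2 by rewrite hc.
  have hca : 0 <= c + (alpha + 1) * s2 / 2.
    by rewrite cE mulr_ge0 ?(ltW s40)// subr_ge0 addrC.
  have q20 : 0 < 1 + r - 2 by rewrite subr_gt0.
  have [b hb] := mlog_ge1_near (u - 1) q20.
  have low := lower_bound_ae hA0 hA1 hA2 hMp p2 (ltW q2) u01 hc' hb a0 e20.
  have q2a : 1 + r <= alpha + 2 by rewrite (_ : alpha + 2 = 1 + (1 + alpha)) ?lerD2l//; ring.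
  have up := upper_bound_ae hA0 hA2 hMp p2 (ltW rp) v01 (or_intror (conj q2 hc)) a0 q2a hca e20.
  move: low up; apply: filterS2 => w low up.
  have low' := log_exponent_lower (lower_exponent_ii uth) low.
  have vm1 : Num.min 2^-1 (eps / 2) <= 2^-1 by rewrite ge_min lexx.
  have vm2 : Num.min 2^-1 (eps / 2) <= eps / 2 by rewrite ge_min lexx orbT.
  have up' := log_exponent_upper (upper_exponent_ii (ltW th0) vm1 vm2) up.
  by move: low' up'; apply: filterS2.
- move=> ar.
  apply: (@positive_recurrent_average _ _ _ P S F X c s2 p alpha) => //.
    rewrite (le_trans _ (ltW rp))// (_ : alpha + 2 = 1 + (1 + alpha)); first by rewrite lerD2l ltW.
    ring.
  by rewrite cE nmulr_rlt0// subr_lt0 addrC.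
Qed.
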